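(* Let $\mu$ be a probability measure on $\mathbb{R}$. The following conditions are equivalent. (1) $\mu$ belongs to $\mathcal{P}_1$. (2) $G_\mu(\frac1z)$, defined in $\mathbb{C}_+$, has analytic continuation to $\{z\in\mathbb{C} : |z|<r\}$ for some $r>0$. (3) $F_\mu(\frac1z)-\frac1z$, defined in $\mathbb{C}_+$, has analytic continuation to $\{z\in\mathbb{C} : |z|<r\}$ for some $r>0$. (4) $F_\mu^{-1}(\frac1z)-\frac1z$, defined in $\Omega^{-1}$, has analytic continuation to $\{z\in\mathbb{C} : |z|<r\}$ for some $r>0$. (5) The Fourier transform $\mathcal{F}_\mu(z)$, considered for $z>0$, is the restriction of an entire function $\widetilde{\mathcal{F}}_\mu(z)$ of order one and of finite type. Moreover, when these conditions hold, define $r_\mu(k)$ to be the supremum of the radii $r>0$ in statement ($k$) for $k=2,3$, and $$\widetilde{R}_\mu:=\inf\Big\{R>0 : \sup_{z\in\mathbb{C}}\frac{|\widetilde{\mathcal{F}}_\mu(z)|}{e^{R|z|}}<\infty\Big\}.$$ Then $r_\mu(k)=R_\mu^{-1}$ for $k=2,3$, and $\widetilde{R}_\mu=R_\mu$. The second relation implies that the type of $\widetilde{\mathcal{F}}_\mu$ is $R_\mu$.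
   Context: $\mathbb{C}_\pm$ are the open upper and lower half planes. $\mathcal{F}_\mu(z)=\int_{\mathbb{R}}e^{ixz}\mu(dx)$ for $z\in\mathbb{R}$; $G_\mu(z)=\int_{\mathbb{R}}\frac{\mu(dx)}{z-x}$ for $z\in\mathbb{C}\setminus\mathbb{R}$; $F_\mu=1/G_\mu$. Note that $1/z\in\mathbb{C}_-$ for $z\in\mathbb{C}_+$, so (2), (3) concern $G_\mu,F_\mu$ on $\mathbb{C}_-$. A function $h$ defined on $U$ ($U=\mathbb{C}_+$ or $\Omega^{-1}$) ''has analytic continuation to $\{|z|<r\}$'' if there is an analytic function on $\{|z|<r\}$ that agrees with $h$ on $U\cap\{|z|<r\}$. Inverse of $F_\mu$: $F_\mu^{-1}$ is the analytic right inverse of $F_\mu$ (that is, $F_\mu(F_\mu^{-1}(z))=z$, with $F_\mu^{-1}(z)/z\to1$ as $z\to\infty$ non-tangentially) on a domain $\Omega\subset\mathbb{C}_-$ of the form $\Omega=\bigcup_{\alpha>0}\Gamma_{\alpha,\beta_\alpha}$ for some $\beta_\alpha>0$, where $\Gamma_{\alpha,\beta}=\{z\in\mathbb{C}_- : |\operatorname{Re}z|<\alpha|\operatorname{Im}z|,\ \operatorname{Im}z<-\beta\}$; such a domain exists. $\Omega^{-1}=\{z\in\mathbb{C} : \frac1z\in\Omega\}\subset\mathbb{C}_+$. Class $\mathcal{P}_1$: the probability measures on $\mathbb{R}$ of the form $\mu=\nu+\lambda$, where $\nu$ is a positive measure with compact support and there exist $0<r<R$ and a real analytic function $p(x)=\sum_{n=2}^\infty\frac{a_n}{x^n}$,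 absolutely convergent for $|x|>r$ and non-negative on $|x|\ge R$, such that $\lambda(dx)=p(x)\mathbf{1}_{\{|x|\ge R\}}(x)\,dx$. So $\mu\in\mathcal{P}_1$ has a density of the form $\sum_{n=2}^\infty\frac{a_n}{x^n}$ for sufficiently large $|x|$, and one sets $$R_\mu=\inf\Big\{R>0 : \mu|_{|x|\ge R}(dx)=\sum_{n=2}^\infty\frac{a_n}{x^n}\,dx\Big\}.$$ If $R_\mu=0$, then $R_\mu^{-1}$ is read as $\infty$. Entire functions: an entire function $f$ is of finite order if there exist $0\le\rho<\infty$ and $C_1,C_2>0$ with $|f(z)|\le C_1e^{C_2|z|^\rho}$ for all $z\in\mathbb{C}$; the infimum of such $\rho$ is the order of $f$. If $f$ has order $\rho$, it is of finite type if $\limsup_{a\to\infty}a^{-\rho}\log\big(\sup_{|z|\le a}|f(z)|\big)<\infty$, and the value of this limit superior is the type of $f$.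
   Formalization: r_μ(3)=1/R_μ fails for μ=δ_1, so it is proved assuming the continuations of G_μ(1/z) (off 0) and zF_μ(1/z) have no zeros; ''order one'' fails for δ_0, so (5) reads order at most one with finite type for exponent 1 (order is exactly one if R_μ>0). *)

(* Defs.v *)
From HB Require Import structures.
From mathcomp Require Export all_boot all_order all_algebra.
From mathcomp Require Export all_classical all_reals all_analysis.
From mathcomp Require Export complex.
Export Order.TTheory GRing.Theory Num.Theory.
Export numFieldNormedType.Exports.

Set Implicit Arguments.
Unset Strict Implicit.
Unset Printing Implicit Defensive.

Local Open Scope classical_set_scope.
Local Open Scope complex_scope.
Local Open Scope ring_scope.

Definition cabs {R : realType} (z : R[i]) : R := ComplexField.Normc.normc z.

Definition cre {R : realType} (z : R[i]) : R := complex.Re z.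
Definition cim {R : realType} (z : R[i]) : R := complex.Im z.

Definition disc {R : realType} (r : R) : set R[i] := [set z | cabs z < r].

Definition upper_half {R : realType} : set R[i] := [set z | 0 < cim z].

(* Complex differentiability at every point of [U]; only used for open [U]. *)
Definition analytic_on {R : realType} (U : set R[i]) (f : R[i] -> R[i]) : Prop :=
  forall z, U z -> derivable (f : R[i]^o -> R[i]^o) z 1.

Definition continuation {R : realType} (U : set R[i]) (h : R[i] -> R[i])
    (r : R) (g : R[i] -> R[i]) : Prop :=
  analytic_on (disc r) g /\ forall z, U z -> disc r z -> g z = h z.

Definition has_continuation {R : realType} (U : set R[i]) (h : R[i] -> R[i])
    (r : R) : Prop :=
  exists g, continuation U h r g.

Section Transforms.
Context {R : realType}.
Variable mu : probability (measurableTypeR R) R.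

Definition cintegral (f : R -> R[i]) : R[i] :=
  (\int[mu]_x cre (f x)) +i* (\int[mu]_x cim (f x)).

Definition cauchy_transform (z : R[i]) : R[i] :=
  cintegral (fun x => (z - x%:C)^-1).

Definition recip_cauchy (z : R[i]) : R[i] := (cauchy_transform z)^-1.

Definition fourier (t : R) : R[i] :=
  cintegral (fun x => cos (x * t) +i* sin (x * t)).

Definition G_at_inv (z : R[i]) : R[i] := cauchy_transform z^-1.

Definition F_at_inv_sub (z : R[i]) : R[i] := recip_cauchy z^-1 - z^-1.

End Transforms.

Definition cone {R : realType} (alpha beta : R) : set R[i] :=
  [set z | cim z < 0 /\ `|cre z| < alpha * `|cim z| /\ cim z < - beta].

Definition cone_union {R : realType} (beta : R -> R) : set R[i] :=
  \bigcup_(alpha in [set alpha : R | 0 < alpha]) cone alpha (beta alpha).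

Definition cone_union_inv {R : realType} (beta : R -> R) : set R[i] :=
  [set z | cone_union beta z^-1].

(* [Finv] is required to take values in the lower half plane because
   [recip_cauchy] is only meaningful off the real axis, and a non-real point
   which F_mu maps into the lower half plane lies in the lower half plane. *)
Record right_inverse {R : realType} (mu : probability (measurableTypeR R) R)
    (beta : R -> R) (Finv : R[i] -> R[i]) : Prop := {
  right_inverse_beta : forall alpha, 0 < alpha -> 0 < beta alpha ;
  right_inverse_analytic : analytic_on (cone_union beta) Finv ;
  right_inverse_lower : forall z, cone_union beta z -> cim (Finv z) < 0 ;
  right_inverseK : forall z, cone_union beta z -> recip_cauchy mu (Finv z) = z ;
  right_inverse_nontangential : forall alpha eps, 0 < alpha -> 0 < eps ->
    exists M : R, forall z, cone_union beta z ->
      `|cre z| < alpha * `|cim z| -> M < cabs z -> cabs (Finv z / z - 1) < eps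
}.

Definition Finv_at_inv_sub {R : realType} (Finv : R[i] -> R[i]) (z : R[i]) :
  R[i] := Finv z^-1 - z^-1.

Definition inv_series {R : realType} (a : nat -> R) (x : R) : R :=
  limn (fun N => \sum_(2 <= n < N) a n / x ^+ n).

Definition tail {R : realType} (T : R) : set R := [set x | T <= `|x|].

Definition class_P1 {R : realType} (mu : probability (measurableTypeR R) R) :
    Prop :=
  exists (nu : {measure set (measurableTypeR R) -> \bar R}) (r T : R)
         (a : nat -> R),
    [/\ exists2 K : set R, compact K & nu (~` K) = 0%E,
        0 < r < T,
        forall x, r < `|x| ->
          cvgn (fun N => \sum_(2 <= n < N) `|a n / x ^+ n|),
        forall x, tail T x -> 0 <= inv_series a x &
        forall A : set (measurableTypeR R), measurable A ->
          mu A = (nu A +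
            \int[lebesgue_measure]_(x in A `&` tail T) (inv_series a x)%:E)%E].

Definition tail_density {R : realType}
    (mu : probability (measurableTypeR R) R) (T : R) (a : nat -> R) : Prop :=
  (forall x, tail T x -> cvgn (fun N => \sum_(2 <= n < N) a n / x ^+ n)) /\
  forall A : set (measurableTypeR R), measurable A ->
    mu (A `&` tail T) =
      (\int[lebesgue_measure]_(x in A `&` tail T) (inv_series a x)%:E)%E.

Definition R_mu {R : realType} (mu : probability (measurableTypeR R) R) :
    \bar R :=
  ereal_inf [set T%:E | T in [set T | 0 < T /\ exists a, tail_density mu T a]].

Definition r_mu2 {R : realType} (mu : probability (measurableTypeR R) R) :
    \bar R :=
  ereal_sup [set r%:E | r in
    [set r | 0 < r /\ has_continuation upper_half (G_at_inv mu) r]].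

Definition r_mu3 {R : realType} (mu : probability (measurableTypeR R) R) :
    \bar R :=
  ereal_sup [set r%:E | r in
    [set r | 0 < r /\ has_continuation upper_half (F_at_inv_sub mu) r]].

(* The continuations of G_mu(1/z), away from its zero at 0, and of z F_mu(1/z)
   have no zeros.  A zero of one of them is a singularity of the other, so that
   without this the radii for G_mu and F_mu may differ: if mu is the Dirac mass
   at 1, then G_mu(1/z) = z / (1 - z) whereas F_mu(1/z) - 1/z = -1. *)
Definition zero_free {R : realType} (mu : probability (measurableTypeR R) R) :
    Prop :=
  (forall r g, continuation upper_half (G_at_inv mu) r g ->
     forall z, disc r z -> z != 0 -> g z != 0) /\
  (forall r h, continuation upper_half (F_at_inv_sub mu) r h ->
     forall z, disc r z -> 1 + z * h z != 0).

Definition entire {R : realType} (f : R[i] -> R[i]) : Prop := analytic_on setT f.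

Definition order_bound {R : realType} (f : R[i] -> R[i]) (rho : R) : Prop :=
  exists C1 C2 : R, [/\ 0 < C1, 0 < C2 &
    forall z, cabs (f z) <= C1 * expR (C2 * (cabs z `^ rho))].

(* Equal to +oo when [f] is of infinite order. *)
Definition entire_order {R : realType} (f : R[i] -> R[i]) : \bar R :=
  ereal_inf [set rho%:E | rho in [set rho | 0 <= rho /\ order_bound f rho]].

Definition max_modulus {R : realType} (f : R[i] -> R[i]) (a : R) : \bar R :=
  ereal_sup [set (cabs (f z))%:E | z in [set z | cabs z <= a]].

Definition entire_type {R : realType} (rho : R) (f : R[i] -> R[i]) : \bar R :=
  limf_esup (fun a : R => ((a `^ (- rho))%:E * lne (max_modulus f a))%E)
    (pinfty_nbhs R).

(* As usual for functions of exponential type, "order one and finite type" is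
   order at most one and finite type with respect to the exponent 1: the
   Fourier transform of the Dirac mass at 0 is the constant 1, of order 0. *)
Definition fourier_extension {R : realType}
    (mu : probability (measurableTypeR R) R) (f : R[i] -> R[i]) : Prop :=
  [/\ entire f,
      forall t : R, 0 < t -> f t%:C = fourier mu t,
      (entire_order f <= 1)%E &
      (entire_type 1 f < +oo)%E].

Definition exp_bound_inf {R : realType} (f : R[i] -> R[i]) : \bar R :=
  ereal_inf [set T%:E | T in [set T : R | 0 < T /\
    (ereal_sup [set (cabs (f z) / expR (T * cabs z))%:E | z in setT]
       < +oo)%E]].

(* Main.v *)
From HB Require Import structures.
Require Import Defs.
From mathcomp Require Import measurable_realfun ring lra.

(* Suppose that mu has the density given by the series a_n / x^n on |x| >= T.
   There, the integral of e^(itx) mu(dx) may be moved to the half circle |z| =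
   T' in the upper half plane, for any T' > T, so that the Fourier transform
   extends to an entire function f with |f z| <= C e^(T'|z|). For such an f,
   the numbers n! c_n attached to its Taylor coefficients c_n are O(T''^n) for
   all T'' > T', and their Borel sum continues G_mu(1/z) to |z| < 1/T': on the
   imaginary axis both come from the only solution of L' = s L - f on t > 0
   that grows more slowly than e^(st). Finally, if g continues G_mu(1/z) to
   |z| < r, then Im G_mu(x - iy) tends to Im g(1/x) locally uniformly on |x| >
   1/r as y > 0 tends to 0, and by Stieltjes inversion mu has the density Im
   g(1/x) / pi there. Going round this circle of implications loses an
   arbitrarily small amount of the radius at each step, whence the equalities
   between R_mu, the radius of G_mu(1/z) and the exponential type. F_mu and
   its inverse are obtained from G_mu by taking reciprocals and local
   inverses, and the identity theorem.

   In the logarithmic coordinate, circles are vertical segments, so that Cauchy's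
   theorem is only needed for rectangles. *)

Set Implicit Arguments.
Unset Strict Implicit.
Unset Printing Implicit Defensive.

Local Open Scope classical_set_scope.
Local Open Scope complex_scope.
Local Open Scope ring_scope.

Arguments cabs {R} z : simpl never.

(** * Modulus, continuity and complex derivatives *)

Section ComplexBasics.
Context {R : realType}.
Implicit Types (z w h d : R[i]) (x t : R) (f g : R[i] -> R[i]).

(** The classical argument exchanges integrals twice: to recognise the Laplace transform of the
    Fourier transform as a Cauchy transform, and to integrate [Im G] over an interval. Here the
    inner integral is replaced by its explicit value, [exp (i x t) / (s - i x)] or
    [atan ((b - x) / y)]; differentiating its integral over [mu] gives back the differential
    equation or the Poisson kernel, and uniqueness for a linear equation or the mean value
    inequality concludes. As [mu] need not have moments, the expansion of [G_mu(1/z)] at 0 and the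
    derivative of the Laplace integral rest on tightness: a crude bound on the small mass far away,
    a fine one on a compact set. Complex integrals are taken of bounded measurable functions over
    sets of finite measure, and are bounded through real and imaginary parts, up to a factor 2; only
    radii and exponential rates are sharp. Identities are propagated along segments, the domains
    being convex or star-shaped towards 0. *)

Lemma cabs_ge0 z : 0 <= cabs z.
Proof. by case: z => a b; rewrite /cabs /= sqrtr_ge0. Qed.

Lemma cabs0 : cabs (0 : R[i]) = 0. Proof. exact: Normc.normc0. Qed.
Lemma cabs1 : cabs (1 : R[i]) = 1. Proof. exact: Normc.normc1. Qed.

Lemma cabsN z : cabs (- z) = cabs z.
Proof. by case: z => a b; rewrite /cabs /= !sqrrN. Qed.

Lemma cabsM z w : cabs (z * w) = cabs z * cabs w.
Proof. exact: Normc.normcM. Qed.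

Lemma cabsV z : cabs z^-1 = (cabs z)^-1.
Proof. exact: Normc.normcV. Qed.

Lemma cabsX z n : cabs (z ^+ n) = cabs z ^+ n.
Proof. by elim: n => [|n IH]; rewrite ?expr0 ?cabs1// !exprS cabsM IH. Qed.

Lemma cabsD z w : cabs (z + w) <= cabs z + cabs w.
Proof. exact: le_normcD. Qed.

Lemma cabsB z w : cabs (z - w) <= cabs z + cabs w.
Proof. by rewrite -(cabsN w); exact: cabsD. Qed.

Lemma cabs_distC z w : cabs (z - w) = cabs (w - z).
Proof. by rewrite -cabsN opprB. Qed.

Lemma cabsB_ge z w : cabs z - cabs w <= cabs (z - w).
Proof. by rewrite lerBlDr (le_trans _ (cabsD _ _))// subrK. Qed.

Lemma cabs_eq0 z : (cabs z == 0) = (z == 0).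
Proof.
by apply/idP/idP => [/eqP/Normc.eq0_normc ->//|/eqP ->]; rewrite cabs0.
Qed.

Lemma cabs_gt0 z : (0 < cabs z) = (z != 0).
Proof. by rewrite lt_def cabs_ge0 andbT cabs_eq0. Qed.

Lemma normE z : `|z| = (cabs z)%:C.
Proof. by rewrite normc_def /cabs; case: z. Qed.

Lemma cabsR x : cabs x%:C = `|x|.
Proof. by rewrite /cabs /= expr0n /= addr0 sqrtr_sqr. Qed.

Lemma cabsi : cabs ('i%C : R[i]) = 1.
Proof. by rewrite /cabs /= expr0n /= add0r expr1n sqrtr1. Qed.

Lemma creD z w : cre (z + w) = cre z + cre w. Proof. by case: z; case: w. Qed.
Lemma cimD z w : cim (z + w) = cim z + cim w. Proof. by case: z; case: w. Qed.
Lemma creN z : cre (- z) = - cre z. Proof. by case: z. Qed.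
Lemma cimN z : cim (- z) = - cim z. Proof. by case: z. Qed.
Lemma creB z w : cre (z - w) = cre z - cre w. Proof. by rewrite creD creN. Qed.
Lemma cimB z w : cim (z - w) = cim z - cim w. Proof. by rewrite cimD cimN. Qed.
Lemma creM z w : cre (z * w) = cre z * cre w - cim z * cim w.
Proof. by case: z; case: w. Qed.
Lemma cimM z w : cim (z * w) = cre z * cim w + cim z * cre w.
Proof. by case: z; case: w. Qed.
Lemma creR x : cre x%:C = x. Proof. by []. Qed.
Lemma cimR x : cim x%:C = 0. Proof. by []. Qed.
Lemma creI : cre ('i%C : R[i]) = 0. Proof. by []. Qed.
Lemma cimI : cim ('i%C : R[i]) = 1. Proof. by []. Qed.
Lemma cre0 : cre (0 : R[i]) = 0. Proof. by []. Qed.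
Lemma cim0 : cim (0 : R[i]) = 0. Proof. by []. Qed.
Lemma cre1 : cre (1 : R[i]) = 1. Proof. by []. Qed.
Lemma cim1 : cim (1 : R[i]) = 0. Proof. by []. Qed.

Definition creimE := (creD, cimD, creN, cimN, creM, cimM, creR, cimR, creI,
  cimI, cre0, cim0, cre1, cim1).

Lemma ceqP z w : cre z = cre w -> cim z = cim w -> z = w.
Proof. by case: z => a b; case: w => c d /= -> ->. Qed.

Lemma sqr_cabs z : cabs z ^+ 2 = cre z ^+ 2 + cim z ^+ 2.
Proof. by case: z => a b; rewrite /cabs /= sqr_sqrtr// addr_ge0// sqr_ge0. Qed.

Lemma creV z : cre z^-1 = cre z / cabs z ^+ 2.
Proof. by rewrite sqr_cabs; case: z => a b. Qed.

Lemma cimV z : cim z^-1 = - cim z / cabs z ^+ 2.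
Proof. by rewrite sqr_cabs; case: z => a b /=; rewrite mulNr. Qed.

Lemma cre_le z : `|cre z| <= cabs z.
Proof.
rewrite -(@ler_pXn2r _ 2)// ?nnegrE ?cabs_ge0// sqr_cabs real_normK ?num_real//.
by rewrite lerDl sqr_ge0.
Qed.

Lemma cim_le z : `|cim z| <= cabs z.
Proof.
rewrite -(@ler_pXn2r _ 2)// ?nnegrE ?cabs_ge0// sqr_cabs real_normK ?num_real//.
by rewrite lerDr sqr_ge0.
Qed.

Lemma cabs_le z : cabs z <= `|cre z| + `|cim z|.
Proof.
rewrite -(@ler_pXn2r _ 2)// ?nnegrE ?cabs_ge0 ?addr_ge0// sqr_cabs.
by rewrite sqrrD !real_normK ?num_real// -addrA lerD2l lerDr mulrn_wge0 ?mulr_ge0.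
Qed.

Lemma RcM x y : (x * y)%:C = x%:C * y%:C :> R[i]. Proof. by rewrite -rmorphM. Qed.
Lemma RcD x y : (x + y)%:C = x%:C + y%:C :> R[i]. Proof. by rewrite -rmorphD. Qed.
Lemma Rc_eq0 x : (x%:C == 0 :> R[i]) = (x == 0).
Proof. by rewrite -cabs_eq0 cabsR normr_eq0. Qed.

(** In [R[i]] the radii of balls are complex numbers, positive only if real; real radii keep all
    later estimates in [R]. *)
Definition ccont f z := forall e : R, 0 < e -> exists2 d : R, 0 < d &
  forall w, cabs (w - z) < d -> cabs (f w - f z) < e.

Lemma ccontE f z :
  ccont f z <-> {for z, continuous (f : R[i]^o -> R[i]^o)}.
Proof.
split => [H|H e e0].
  apply/(@cvgrPdist_lt _ R[i]^o R[i]^o (nbhs (z : R[i]^o)) _) => e.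
  rewrite ltcE /= => /andP[/eqP ei er].
  have [d d0 Hd] := H _ er.
  apply/nbhs_ballP; exists (d%:C); first by rewrite /= ltcR.
  move=> w; rewrite /ball /= normE ltcE /= eqxx /= => wz.
  rewrite normE ltcE /= ei eqxx /= cabs_distC; apply: Hd.
  by rewrite cabs_distC.
have e0' : (0 : R[i]) < e%:C by rewrite ltcR.
move/(@cvgrPdist_lt _ R[i]^o R[i]^o (nbhs (z : R[i]^o)) _): H => /(_ _ e0') /nbhs_ballP[d /=].
rewrite ltcE /= => /andP[/eqP ei er] Hd; exists (complex.Re d) => // w wz.
have := Hd w; rewrite /ball /= !normE !ltcE /= ei eqxx /= cabs_distC.
by rewrite (cabs_distC z); apply.
Qed.

Lemma ccont_cst (c : R[i]) z : ccont (fun=> c) z.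
Proof. by move=> e e0; exists 1 => // w _; rewrite subrr cabs0. Qed.

Lemma ccont_id z : ccont id z.
Proof. by move=> e e0; exists e. Qed.

Lemma ccontD f g z : ccont f z -> ccont g z -> ccont (fun w => f w + g w) z.
Proof. by move=> /ccontE cf /ccontE cg; apply/ccontE; apply: (cvgD cf cg). Qed.

Lemma ccontN f z : ccont f z -> ccont (fun w => - f w) z.
Proof. by move=> /ccontE cf; apply/ccontE; apply: (cvgN cf). Qed.

Lemma ccontM f g z : ccont f z -> ccont g z -> ccont (fun w => f w * g w) z.
Proof. by move=> /ccontE cf /ccontE cg; apply/ccontE; apply: (cvgM cf cg). Qed.

Lemma ccontV f z : f z != 0 -> ccont f z -> ccont (fun w => (f w)^-1) z.
Proof. by move=> fz /ccontE cf; apply/ccontE; apply: (cvgV fz cf). Qed.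

Lemma ccont_comp f g z : ccont f z -> ccont g (f z) -> ccont (g \o f) z.
Proof.
move=> cf cg e /cg[d d0 Hd]; have [d' d'0 Hd'] := cf _ d0.
by exists d' => // w /Hd'/Hd.
Qed.

Lemma ccont_near f g z (r : R) : 0 < r ->
  (forall w, cabs (w - z) < r -> f w = g w) -> ccont f z -> ccont g z.
Proof.
move=> r0 fg cf e /cf[d d0 Hd]; exists (Num.min d r); rewrite ?lt_min ?d0//.
by move=> w; rewrite lt_min => /andP[wd wr]; rewrite -!fg ?Hd// subrr cabs0.
Qed.

(** Stated without a quotient, so that [h = 0] is no separate case and error bounds can be summed or
    integrated directly. *)
Definition cderiv f z d := forall e : R, 0 < e -> exists2 r : R, 0 < r &
  forall h, cabs h < r -> cabs (f (z + h) - f z - d * h) <= e * cabs h.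

(** Caratheodory's form: the slope from [z] extends to a continuous function. The rules for sums,
    products and compositions then become identities between slopes. *)
Lemma cderivP f z d : cderiv f z d <-> exists phi,
  [/\ ccont phi z, phi z = d & forall w, f w - f z = phi w * (w - z)].
Proof.
split => [H|[phi [cphi <- Hphi]] e e0].
  exists (fun w => if w == z then d else (f w - f z) / (w - z)); split.
  - move=> e e0; have [r r0 Hr] := H (e / 2) ltac:(by rewrite divr_gt0).
    exists r => // w wz; rewrite eqxx; case: ifPn => [_|wnz].
      by rewrite subrr cabs0.
    have wz0 : w - z != 0 by rewrite subr_eq0.
    have -> : (f w - f z) / (w - z) - d = (f w - f z - d * (w - z)) / (w - z).
      by rewrite [RHS]mulrBl mulfK.
    rewrite cabsM cabsV ltr_pdivrMr ?cabs_gt0//.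
    have := Hr _ wz; rewrite [z + _]addrC subrK => /le_lt_trans; apply.
    by rewrite ltr_pM2r ?cabs_gt0// ltr_pdivrMr// ltr_pMr// ltr1n.
  - by rewrite eqxx.
  - move=> w; case: ifPn => [/eqP->|wnz]; first by rewrite !subrr mulr0.
    by rewrite divfK// subr_eq0.
have [r r0 Hr] := cphi _ e0; exists r => // h hr.
rewrite Hphi [z + h]addrC addrK -mulrBl cabsM ler_wpM2r ?cabs_ge0// ltW//.
by apply: Hr; rewrite addrK.
Qed.

Lemma derivable_cderiv f z :
  derivable (f : R[i]^o -> R[i]^o) z 1 <-> exists d, cderiv f z d.
Proof.
split.
  move=> /cvg_ex[/= d Hd]; exists d => e e0.
  have e0' : (0 : R[i]) < e%:C by rewrite ltcR.
  move/cvgrPdist_le: Hd => /(_ _ e0'); rewrite /dnbhs /within /= => /nbhs_ballP[r /=].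
  rewrite ltcE /= => /andP[/eqP ri rr] Hr; exists (complex.Re r) => // h hr.
  have [->|hn0] := eqVneq h 0.
    by rewrite addr0 subrr mulr0 subr0 cabs0 mulr0.
  have := Hr h; rewrite /ball /= sub0r normrN normE ltcE /= ri eqxx /= => /(_ hr hn0).
  rewrite normE lecE /= eqxx /= => H.
  rewrite -ler_pdivrMr ?cabs_gt0// -cabsV -cabsM.
  apply: le_trans H; rewrite cabs_distC /GRing.scale /= mulr1 [h + z]addrC.
  by rewrite mulrBl mulfK// mulrC lexx.
move=> [d H]; apply/cvg_ex; exists d; apply/cvgrPdist_le => e.
rewrite ltcE /= => /andP[/eqP ei er].
have [r r0 Hr] := H _ er.
rewrite /dnbhs /within /=; apply/nbhs_ballP; exists (r%:C); first by rewrite /= ltcR.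
move=> h; rewrite /ball /= sub0r normrN normE ltcE /= eqxx /= => hr hn0.
rewrite normE lecE /= ei eqxx /=.
have := Hr _ hr; rewrite -ler_pdivrMr ?cabs_gt0// -cabsV -cabsM.
apply: le_trans; rewrite cabs_distC /GRing.scale /= mulr1 [h + z]addrC.
by rewrite mulrBl mulfK// mulrC lexx.
Qed.

Lemma cderiv_cont f z d : cderiv f z d -> ccont f z.
Proof.
move=> /cderivP[phi [cphi _ H]].
have : ccont (fun w => phi w * (w - z) + f z) z.
  apply: ccontD (ccont_cst _ _); apply: ccontM cphi _.
  exact: ccontD (ccont_id _) (ccont_cst _ _).
apply: (ccont_near (r := 1)) => // w _; by rewrite -H subrK.
Qed.

Lemma cderiv_cst (c : R[i]) z : cderiv (fun=> c) z 0.
Proof. by move=> e e0; exists 1 => // h _; rewrite subrr mul0r subr0 cabs0 mulr_ge0 ?cabs_ge0// ltW. Qed.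

Lemma cderiv_id z : cderiv id z 1.
Proof.
move=> e e0; exists 1 => // h _.
by rewrite mul1r [z + h]addrC addrK subrr cabs0 mulr_ge0 ?cabs_ge0// ltW.
Qed.

Lemma cderivD f g z a b : cderiv f z a -> cderiv g z b ->
  cderiv (fun w => f w + g w) z (a + b).
Proof.
move=> /cderivP[p [cp <- Hp]] /cderivP[q [cq <- Hq]]; apply/cderivP.
exists (fun w => p w + q w); split => //; first exact: ccontD.
by move=> w; rewrite mulrDl -Hp -Hq opprD addrACA.
Qed.

Lemma cderivN f z a : cderiv f z a -> cderiv (fun w => - f w) z (- a).
Proof.
move=> /cderivP[p [cp <- Hp]]; apply/cderivP.
exists (fun w => - p w); split => //; first exact: ccontN.
by move=> w; rewrite mulNr -Hp opprD.
Qed.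

Lemma cderivM f g z a b : cderiv f z a -> cderiv g z b ->
  cderiv (fun w => f w * g w) z (a * g z + f z * b).
Proof.
move=> Df Dg; have cg := cderiv_cont Dg.
move: Df Dg => /cderivP[p [cp <- Hp]] /cderivP[q [cq <- Hq]]; apply/cderivP.
exists (fun w => p w * g w + f z * q w); split => //.
  by apply: ccontD; apply: ccontM => //; exact: ccont_cst.
move=> w; transitivity ((f w - f z) * g w + f z * (g w - g z)); first by ring.
by rewrite Hp Hq; ring.
Qed.

(** The formula for the slope of the inverse holds only where [f] does not vanish, so that the
    argument is carried out near [z] and not through a global slope. *)
Lemma cderivV f z a : f z != 0 -> cderiv f z a ->
  cderiv (fun w => (f w)^-1) z (- a / f z ^+ 2).
Proof.
move=> fz Df; have cf := cderiv_cont Df.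
have [r r0 Hr] : exists2 r : R, 0 < r & forall w, cabs (w - z) < r -> f w != 0.
  have [r r0 Hr] := cf (cabs (f z)) ltac:(by rewrite cabs_gt0).
  exists r => // w /Hr; apply: contraTneq => ->.
  by rewrite sub0r cabsN ltxx.
move: Df => /cderivP[p [cp <- Hp]] e e0.
have cq : ccont (fun w => - p w * (f w * f z)^-1) z.
  apply: ccontM; first exact: ccontN.
  apply: ccontV; first by rewrite mulf_neq0.
  by apply: ccontM => //; exact: ccont_cst.
have [r' r'0 Hr'] := cq _ e0.
exists (Num.min r r'); first by rewrite lt_min r0.
move=> h; rewrite lt_min => /andP[hr hr'].
have zh : z + h - z = h by rewrite addrAC subrr add0r.
have fh : f (z + h) != 0 by apply: Hr; rewrite zh.
have E : (f (z + h))^-1 - (f z)^-1 = - p (z + h) * (f (z + h) * f z)^-1 * h.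
  have := Hp (z + h); rewrite zh => Hph.
  have -> : - p (z + h) * (f (z + h) * f z)^-1 * h = - (p (z + h) * h) * (f (z + h) * f z)^-1 by ring.
  by rewrite -Hph; field; rewrite fh fz.
rewrite E -mulrBl cabsM ler_wpM2r ?cabs_ge0// ltW//.
rewrite expr2; apply: Hr'; by rewrite zh.
Qed.

Lemma cderiv_comp f g z a b : cderiv f z a -> cderiv g (f z) b ->
  cderiv (g \o f) z (b * a).
Proof.
move=> Df; have cf := cderiv_cont Df.
move: Df => /cderivP[p [cp <- Hp]] /cderivP[q [cq <- Hq]]; apply/cderivP.
exists (fun w => q (f w) * p w); split => //.
  by apply: ccontM cp; exact: ccont_comp cf cq.
by move=> w; rewrite /= Hq Hp mulrA.
Qed.

Lemma cderiv_near f g z a (r : R) : 0 < r ->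
  (forall w, cabs (w - z) < r -> f w = g w) -> cderiv f z a -> cderiv g z a.
Proof.
move=> r0 fg cf e /cf[d d0 Hd]; exists (Num.min d r); rewrite ?lt_min ?d0//.
move=> h; rewrite lt_min => /andP[wd wr]; rewrite -!fg ?Hd ?subrr ?cabs0//.
by rewrite addrAC subrr add0r.
Qed.

End ComplexBasics.

(** * Integrals of complex-valued functions *)

Section ComplexIntegral.
Context {R : realType} d (T : measurableType d) (m : {measure set T -> \bar R}).
Implicit Types (D : set T) (f g : T -> R[i]) (c : R[i]).

Definition cint D f : R[i] :=
  (\int[m]_(x in D) cre (f x)) +i* (\int[m]_(x in D) cim (f x)).

(** Unlike integrable functions, bounded measurable ones are stable under products; on a set of
    finite measure they are integrable. *)
Definition bmeas D f := [/\ measurable_fun D (cre \o f), measurable_fun D (cim \o f)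
  & exists B : R, forall x, D x -> cabs (f x) <= B].

Lemma bmeas_cst D c : bmeas D (fun=> c).
Proof.
by split; [exact: measurable_cst|exact: measurable_cst|exists (cabs c)].
Qed.

Lemma bmeasD D f g : bmeas D f -> bmeas D g -> bmeas D (fun x => f x + g x).
Proof.
move=> [f1 f2 [B Bf]] [g1 g2 [C Cg]]; split.
- rewrite (_ : _ \o _ = (cre \o f) \+ (cre \o g)); first exact: measurable_funD.
  by apply/funext => x /=; rewrite creD.
- rewrite (_ : _ \o _ = (cim \o f) \+ (cim \o g)); first exact: measurable_funD.
  by apply/funext => x /=; rewrite cimD.
- by exists (B + C) => x Dx; rewrite (le_trans (cabsD _ _))// lerD ?Bf ?Cg.
Qed.

Lemma bmeasM D f g : bmeas D f -> bmeas D g -> bmeas D (fun x => f x * g x).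
Proof.
move=> [f1 f2 [B Bf]] [g1 g2 [C Cg]]; split.
- rewrite (_ : _ \o _ = (cre \o f) \* (cre \o g) \- (cim \o f) \* (cim \o g)).
    by apply: measurable_funB; apply: measurable_funM.
  by apply/funext => x /=; rewrite creM.
- rewrite (_ : _ \o _ = (cre \o f) \* (cim \o g) \+ (cim \o f) \* (cre \o g)).
    by apply: measurable_funD; apply: measurable_funM.
  by apply/funext => x /=; rewrite cimM.
- by exists (B * C) => x Dx; rewrite cabsM ler_pM ?cabs_ge0 ?Bf ?Cg.
Qed.

Lemma bmeasZ D c f : bmeas D f -> bmeas D (fun x => c * f x).
Proof. by move=> mf; apply: bmeasM => //; exact: bmeas_cst. Qed.

Lemma bmeasN D f : bmeas D f -> bmeas D (fun x => - f x).
Proof.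
move=> /(bmeasZ (-1)); rewrite (_ : (fun=> _) = fun x => - f x)//.
by apply/funext => x; rewrite mulN1r.
Qed.

Lemma bmeasS D E f : measurable E -> D `<=` E -> bmeas E f -> bmeas D f.
Proof.
move=> mE DE [f1 f2 [B Bf]]; split; [exact: measurable_funS f1|exact: measurable_funS f2|].
by exists B => x /DE/Bf.
Qed.

Lemma bmeas_integrable D f : measurable D -> (m D < +oo)%E -> bmeas D f ->
  m.-integrable D (EFin \o (fun x => cre (f x))) /\
  m.-integrable D (EFin \o (fun x => cim (f x))).
Proof.
move=> mD Doo [f1 f2 [B Bf]]; split; apply: measurable_bounded_integrable => //.
- exists B; split; rewrite ?num_real// => C BC x Dx.
  by rewrite /= (le_trans (cre_le _))// (le_trans (Bf _ Dx))// ltW.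
- exists B; split; rewrite ?num_real// => C BC x Dx.
  by rewrite /= (le_trans (cim_le _))// (le_trans (Bf _ Dx))// ltW.
Qed.

Lemma eq_cint D f g : (forall x, D x -> f x = g x) -> cint D f = cint D g.
Proof.
by move=> fg; congr (_ +i* _); apply: eq_Rintegral => x /set_mem Dx; rewrite fg.
Qed.

Lemma cintD D f g : measurable D -> (m D < +oo)%E -> bmeas D f -> bmeas D g ->
  cint D (fun x => f x + g x) = cint D f + cint D g.
Proof.
move=> mD Doo /(bmeas_integrable mD Doo)[f1 f2] /(bmeas_integrable mD Doo)[g1 g2].
apply: ceqP => /=.
  by rewrite -RintegralD//; apply: eq_Rintegral => x _; rewrite creD.
by rewrite -RintegralD//; apply: eq_Rintegral => x _; rewrite cimD.
Qed.

Lemma cintZ D c f : measurable D -> (m D < +oo)%E -> bmeas D f ->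
  cint D (fun x => c * f x) = c * cint D f.
Proof.
move=> mD Doo /(bmeas_integrable mD Doo)[f1 f2]; case: c => a b; apply: ceqP => /=.
  rewrite -!RintegralZl// -RintegralB//.
  - by apply: eq_Rintegral => x _; rewrite creM.
  - by apply: eq_integrable (integrableZl mD a f1).
  - by apply: eq_integrable (integrableZl mD b f2).
rewrite -!RintegralZl// -RintegralD//.
- by apply: eq_Rintegral => x _; rewrite cimM.
- by apply: eq_integrable (integrableZl mD a f2).
- by apply: eq_integrable (integrableZl mD b f1).
Qed.

Lemma cintN D f : measurable D -> (m D < +oo)%E -> bmeas D f ->
  cint D (fun x => - f x) = - cint D f.
Proof.
move=> mD Doo mf; rewrite -mulN1r -cintZ//; apply: eq_cint => x _.
by rewrite mulN1r.
Qed.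

Lemma cintB D f g : measurable D -> (m D < +oo)%E -> bmeas D f -> bmeas D g ->
  cint D (fun x => f x - g x) = cint D f - cint D g.
Proof. by move=> mD Doo mf mg; rewrite cintD ?cintN//; exact: bmeasN. Qed.

Lemma cint_cst D c : measurable D -> cint D (fun=> c) = c * (fine (m D))%:C.
Proof.
move=> mD; rewrite /cint !Rintegral_cst//; apply: ceqP => /=.
  by rewrite creM /= mulr0 subr0.
by rewrite cimM /= mulr0 add0r.
Qed.

(** The factor 2 comes from bounding the real and the imaginary part separately. *)
Lemma cint_le D f (B : R) : measurable D -> (m D < +oo)%E -> bmeas D f ->
  (forall x, D x -> cabs (f x) <= B) -> cabs (cint D f) <= 2 * B * fine (m D).
Proof.
move=> mD Doo bf Bf; have [f1 f2] := bmeas_integrable mD Doo bf.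
have cB : m.-integrable D (EFin \o (fun=> B)).
  by have [] := bmeas_integrable mD Doo (bmeas_cst D B%:C).
have H (g : T -> R) : m.-integrable D (EFin \o g) -> (forall x, D x -> `|g x| <= B) ->
    `|\int[m]_(x in D) g x| <= B * fine (m D).
  move=> ig gB; rewrite -Rintegral_cst//.
  apply: le_trans (le_normr_Rintegral _ _) _ => //.
  apply: le_Rintegral => //; exact: integrable_norm.
rewrite -mulrA mulr_natl mulr2n; apply: le_trans (cabs_le _) _.
by apply: lerD; apply: H => // x Dx;
  [rewrite (le_trans (cre_le _))// Bf|rewrite (le_trans (cim_le _))// Bf].
Qed.

Lemma cint_setU D E f : measurable D -> measurable E -> (m (D `|` E) < +oo)%E ->
  [disjoint D & E] -> bmeas (D `|` E) f ->
  cint (D `|` E) f = cint D f + cint E f.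
Proof.
move=> mD mE Uoo DE bf.
have [f1 f2] := bmeas_integrable (measurableU _ _ mD mE) Uoo bf.
by apply: ceqP; rewrite /= Rintegral_setU.
Qed.

End ComplexIntegral.

Arguments cint {R d T} m D f : simpl never.

(** * Integrals of continuous complex functions over compact intervals *)

Section IntervalIntegral.
Context {R : realType}.
Implicit Types (F G : R -> R[i]) (a b t : R).
Local Notation leb := (@lebesgue_measure R).

Definition rcont F t :=
  {for t, continuous (fun x => cre (F x))} /\ {for t, continuous (fun x => cim (F x))}.

Definition ci a b F : R[i] := cint leb (`[a, b] : set (measurableTypeR R)) F.

Lemma eq_continuous_at (f g : R -> R) t : f =1 g ->
  {for t, continuous f} -> {for t, continuous g}.
Proof. by move=> /funext ->. Qed.

Lemma rcont_cst c t : rcont (fun=> c) t.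
Proof. by split; exact: cvg_cst. Qed.

Lemma rcontR (f : R -> R) t : {for t, continuous f} -> rcont (fun x => (f x)%:C) t.
Proof. by move=> cf; split => //; exact: cvg_cst. Qed.

Lemma rcontD F G t : rcont F t -> rcont G t -> rcont (fun x => F x + G x) t.
Proof.
move=> [f1 f2] [g1 g2]; split.
- apply: (@eq_continuous_at (fun x => cre (F x) + cre (G x))) => [x|].
    by rewrite creD.
  exact: cvgD.
- apply: (@eq_continuous_at (fun x => cim (F x) + cim (G x))) => [x|].
    by rewrite cimD.
  exact: cvgD.
Qed.

Lemma rcontN F t : rcont F t -> rcont (fun x => - F x) t.
Proof.
move=> [f1 f2]; split.
- apply: (@eq_continuous_at (fun x => - cre (F x))) => [x|]; first by rewrite creN.
  exact: cvgN.
- apply: (@eq_continuous_at (fun x => - cim (F x))) => [x|]; first by rewrite cimN.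
  exact: cvgN.
Qed.

Lemma rcontM F G t : rcont F t -> rcont G t -> rcont (fun x => F x * G x) t.
Proof.
move=> [f1 f2] [g1 g2]; split.
- apply: (@eq_continuous_at
    (fun x => cre (F x) * cre (G x) - cim (F x) * cim (G x))) => [x|].
    by rewrite creM.
  by apply: cvgB; apply: cvgM.
- apply: (@eq_continuous_at
    (fun x => cre (F x) * cim (G x) + cim (F x) * cre (G x))) => [x|].
    by rewrite cimM.
  by apply: cvgD; apply: cvgM.
Qed.

Lemma rcontP F t : rcont F t <-> (forall e : R, 0 < e -> exists2 d : R, 0 < d &
  forall s, `|s - t| < d -> cabs (F s - F t) < e).
Proof.
split=> [[f1 f2] e e0|H].
  have e2 : 0 < e / 2 by rewrite divr_gt0.
  move/cvgrPdist_lt: f1 => /(_ _ e2)/nbhs_ballP[d1 /= d10 H1].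
  move/cvgrPdist_lt: f2 => /(_ _ e2)/nbhs_ballP[d2 /= d20 H2].
  exists (Num.min d1 d2); first by rewrite lt_min d10.
  move=> s; rewrite lt_min => /andP[sd1 sd2].
  apply: le_lt_trans (cabs_le _) _; rewrite creB cimB (splitr e) ltrD//.
  - by rewrite distrC; apply: H1; rewrite /ball /= distrC.
  - by rewrite distrC; apply: H2; rewrite /ball /= distrC.
split; apply/cvgrPdist_lt => e /H[d d0 Hd]; apply/nbhs_ballP; exists d => //= s.
- rewrite /ball /= distrC => /Hd; apply: le_lt_trans.
  by rewrite distrC -creB cre_le.
- rewrite /ball /= distrC => /Hd; apply: le_lt_trans.
  by rewrite distrC -cimB cim_le.
Qed.

Lemma rcont_comp F (f : R[i] -> R[i]) t : rcont F t -> ccont f (F t) -> rcont (f \o F) t.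
Proof.
move=> /rcontP rF cf; apply/rcontP => e /cf[d /rF[d' d'0 H'] H].
by exists d' => // s /H'/H.
Qed.

Lemma rcontV F t : F t != 0 -> rcont F t -> rcont (fun x => (F x)^-1) t.
Proof.
move=> Ft rF; apply: (rcont_comp (f := fun z => z^-1)) => //.
by apply: ccontV => //; exact: ccont_id.
Qed.

Lemma rcont_bmeas a b F : (forall t, a <= t <= b -> rcont F t) ->
  bmeas (`[a, b]%classic : set (measurableTypeR R)) F.
Proof.
move=> rF.
have c1 : {within `[a, b], continuous (fun x => cre (F x))}.
  apply: continuous_in_subspaceT => t /set_mem /=; rewrite in_itv /= => /rF; by case.
have c2 : {within `[a, b], continuous (fun x => cim (F x))}.
  apply: continuous_in_subspaceT => t /set_mem /=; rewrite in_itv /= => /rF; by case.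
split.
- by apply: subspace_continuous_measurable_fun c1; exact: measurable_itv.
- by apply: subspace_continuous_measurable_fun c2; exact: measurable_itv.
have B (f : R -> R) : {within `[a, b], continuous f} ->
    exists B, forall x, x \in `[a, b] -> `|f x| <= B.
  move=> cf; have [ab|ba] := leP a b; last first.
    by exists 0 => x; rewrite in_itv /= => /andP[ax xb]; have := le_trans ax xb; rewrite leNgt ba.
  have cn : {within `[a, b], continuous (fun x => `|f x|)}.
    by move=> x; apply: (@continuous_comp _ _ _ (f : subspace `[a, b] -> R) Num.norm);
      [exact: cf|exact: norm_continuous].
  by have [c _ cB] := EVT_max ab cn; exists `|f c| => x /cB.
have [B1 H1] := B _ c1; have [B2 H2] := B _ c2.
by exists (B1 + B2) => x /= xab; rewrite (le_trans (cabs_le _))// lerD ?H1 ?H2.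
Qed.

Lemma leb_itv_cc a b :
  leb (`[a, b] : set (measurableTypeR R)) = (Num.max 0 (b - a))%:E.
Proof.
rewrite lebesgue_measure_itv /= lte_fin; have [ab|ba] := ltP a b.
  by rewrite -EFinD max_r// subr_ge0 ltW.
by rewrite max_l// subr_le0.
Qed.

Lemma leb_itv_fin a b : (leb (`[a, b] : set (measurableTypeR R)) < +oo)%E.
Proof. by rewrite leb_itv_cc ltey. Qed.

Let mI a b : measurable (`[a, b]%classic : set (measurableTypeR R)).
Proof. exact: measurable_itv. Qed.

Lemma eq_ci a b F G : (forall t, a <= t <= b -> F t = G t) -> ci a b F = ci a b G.
Proof. by move=> FG; apply: eq_cint => t /=; rewrite in_itv /= => /FG. Qed.

Lemma ciD a b F G : (forall t, a <= t <= b -> rcont F t) ->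
  (forall t, a <= t <= b -> rcont G t) ->
  ci a b (fun t => F t + G t) = ci a b F + ci a b G.
Proof. by move=> cF cG; apply: cintD; rewrite ?leb_itv_fin//; apply: rcont_bmeas. Qed.

Lemma ciZ a b c F : (forall t, a <= t <= b -> rcont F t) ->
  ci a b (fun t => c * F t) = c * ci a b F.
Proof. by move=> cF; apply: cintZ; rewrite ?leb_itv_fin//; apply: rcont_bmeas. Qed.

Lemma ciB a b F G : (forall t, a <= t <= b -> rcont F t) ->
  (forall t, a <= t <= b -> rcont G t) ->
  ci a b (fun t => F t - G t) = ci a b F - ci a b G.
Proof. by move=> cF cG; apply: cintB; rewrite ?leb_itv_fin//; apply: rcont_bmeas. Qed.

Lemma ci_cst a b c : a <= b -> ci a b (fun=> c) = c * (b - a)%:C.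
Proof.
move=> ab; rewrite /ci cint_cst; last exact: mI.
congr (_ * _%:C); apply: (etrans (congr1 fine (leb_itv_cc a b))).
by rewrite /= max_r// subr_ge0.
Qed.

Lemma ci_le a b F (B : R) : a <= b -> (forall t, a <= t <= b -> rcont F t) ->
  (forall t, a <= t <= b -> cabs (F t) <= B) ->
  cabs (ci a b F) <= 2 * B * (b - a).
Proof.
move=> ab cF FB.
have -> : b - a = fine (leb (`[a, b] : set (measurableTypeR R))).
  apply/esym; apply: (etrans (congr1 fine (leb_itv_cc a b))).
  by rewrite /= max_r// subr_ge0.
apply: cint_le => [|||t /=]; [exact: mI|exact: leb_itv_fin|exact: rcont_bmeas|].
by rewrite in_itv /=; exact: FB.
Qed.

Lemma ci_split a c b F : a <= c -> c <= b -> (forall t, a <= t <= b -> rcont F t) ->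
  ci a b F = ci a c F + ci c b F.
Proof.
move=> ac cb cF.
have bF := rcont_bmeas cF.
have [f1 f2] := bmeas_integrable (mI a b) (leb_itv_fin a b) bF.
have H (f : R -> R) : leb.-integrable `[a, b] (EFin \o f) ->
   \int[leb]_(x in `[a, b]) f x = \int[leb]_(x in `[a, c]) f x + \int[leb]_(x in `[c, b]) f x.
  move=> fi; rewrite -(Rintegral_itv_obnd_cbnd (r := c)).
    by rewrite -(Rintegral_itvB (x := c) fi) ?bnd_simp// addrC subrK.
  by apply: integrableS fi => //; apply: subset_itvr; rewrite bnd_simp.
by apply: ceqP; rewrite /= H.
Qed.

End IntervalIntegral.

Arguments ci {R} a b F : simpl never.

(** * Goursat's theorem *)

Section Goursat.
Context {R : realType}.
Implicit Types (h : R[i] -> R[i]) (a b c d x y : R).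

Lemma exists_pow2_gt (x : R) : exists n, x < 2 ^+ n.
Proof.
have [n Hn] : exists n, x < n%:R.
  exists (Num.truncn `|x|).+1; rewrite (le_lt_trans (ler_norm x))//.
  by rewrite truncnS_gt.
exists n; apply: lt_trans Hn _; rewrite -natrX ltr_nat; exact: ltn_expl.
Qed.

Lemma nested_intervals (x w : nat -> R) : (forall n, 0 <= w n) ->
  (forall n, x n <= x n.+1) -> (forall n, x n.+1 + w n.+1 <= x n + w n) ->
  exists l, forall n, x n <= l <= x n + w n.
Proof.
move=> w0 xi wd.
have xm : {homo x : m n / (m <= n)%N >-> m <= n}.
  by apply: homo_leq => //; exact: le_trans.
have wm m n : (m <= n)%N -> x n + w n <= x m + w m.
  elim: n => [|n IH]; first by rewrite leqn0 => /eqP ->.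
  rewrite leq_eqVlt => /predU1P[->//|]; rewrite ltnS => /IH; exact: le_trans.
have ub n m : x m <= x n + w n.
  have [mn|/ltnW nm] := leqP m n.
    by rewrite (le_trans (xm _ _ mn))// lerDl.
  by rewrite (le_trans _ (wm _ _ nm))// lerDl.
exists (sup (range x)) => n; apply/andP; split.
  by apply: ub_le_sup; [exists (x 0%N + w 0%N) => _ [m _ <-]|exists n].
by apply: ge_sup; [exists (x n), n|move=> _ [m _ <-]].
Qed.

(** The counterclockwise integral of [h dz] along the boundary of the rectangle, opposite sides
    being grouped. *)
Definition rect h a b c d : R[i] :=
  ci a b (fun x => h (x +i* c) - h (x +i* d)) +
  'i%C * ci c d (fun y => h (b +i* y) - h (a +i* y)).

Definition cdiff h z := exists D, cderiv h z D.

Definition cdiff_rect h a b c d :=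
  forall x y, a <= x <= b -> c <= y <= d -> cdiff h (x +i* y).

Lemma rcont_horizontal h x y : cdiff h (x +i* y) -> rcont (fun t => h (t +i* y)) x.
Proof.
move=> [D /cderiv_cont ch]; apply: (rcont_comp (F := fun t => t +i* y)) ch.
by split; [exact: cvg_id|exact: cvg_cst].
Qed.

Lemma rcont_vertical h x y : cdiff h (x +i* y) -> rcont (fun t => h (x +i* t)) y.
Proof.
move=> [D /cderiv_cont ch]; apply: (rcont_comp (F := fun t => x +i* t)) ch.
by split; [exact: cvg_cst|exact: cvg_id].
Qed.

Lemma rect_splitx h a m b c d : a <= m -> m <= b -> c <= d ->
  cdiff_rect h a b c d -> rect h a b c d = rect h a m c d + rect h m b c d.
Proof.
move=> am mb cd H; have ab := le_trans am mb; rewrite /rect (ci_split am mb); last first.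
  by move=> x xab; apply: rcontD; last apply: rcontN; apply: rcont_horizontal; apply: H => //;
    rewrite lexx cd.
have Hv x : a <= x <= b -> forall y, c <= y <= d -> rcont (fun t => h (x +i* t)) y.
  by move=> xab y ycd; apply: rcont_vertical; exact: H.
rewrite !ciB; try by apply: Hv; rewrite ?lexx ?ab ?am ?mb.
- by ring.
all: by move=> t /andP[t1 t2]; apply: rcont_horizontal; apply: H;
  apply/andP; split; lra.
Qed.

Lemma rect_splity h a b c m d : a <= b -> c <= m -> m <= d ->
  cdiff_rect h a b c d -> rect h a b c d = rect h a b c m + rect h a b m d.
Proof.
move=> ab cm md H; have cd := le_trans cm md; rewrite /rect (ci_split cm md); last first.
  by move=> y ycd; apply: rcontD; last apply: rcontN; apply: rcont_vertical; apply: H => //;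
    rewrite lexx ab.
have Hv y : c <= y <= d -> forall x, a <= x <= b -> rcont (fun t => h (t +i* y)) x.
  by move=> ycd x xab; apply: rcont_horizontal; exact: H.
rewrite !ciB; try by apply: Hv; rewrite ?lexx ?cd ?cm ?md.
- by ring.
all: by move=> t /andP[t1 t2]; apply: rcont_vertical; apply: H;
  apply/andP; split; lra.
Qed.

Lemma cdiff_rectS h a b c d a' b' c' d' : a <= a' -> b' <= b -> c <= c' -> d' <= d ->
  cdiff_rect h a b c d -> cdiff_rect h a' b' c' d'.
Proof.
move=> aa bb cc dd H x y /andP[x1 x2] /andP[y1 y2]; apply: H.
  by rewrite (le_trans aa)// (le_trans x2).
by rewrite (le_trans cc)// (le_trans y2).
Qed.

Lemma cabs_sum4 (u : R) z1 z2 z3 z4 : u <= cabs (z1 + z2 + z3 + z4 : R[i]) ->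
  [\/ u / 4 <= cabs z1, u / 4 <= cabs z2, u / 4 <= cabs z3 | u / 4 <= cabs z4].
Proof.
move=> H; have := le_trans H (cabsD _ _).
have := cabsD (z1 + z2) z3; have := cabsD z1 z2.
have [?|?] := leP (u / 4) (cabs z1); first by constructor 1.
have [?|?] := leP (u / 4) (cabs z2); first by constructor 2.
have [?|?] := leP (u / 4) (cabs z3); first by constructor 3.
have [?|?] := leP (u / 4) (cabs z4); first by constructor 4.
by move=> ? ? ?; exfalso; lra.
Qed.

(** The affine function [h p + D (z - p)] has zero boundary integral: its differences between
    opposite sides are the constants [k1] and [k2], whose contributions cancel. Only the first-order
    error is left. *)
Lemma rect_le h a b c d (p D : R[i]) (e : R) : a <= b -> c <= d ->
  cdiff_rect h a b c d ->
  (forall x y, a <= x <= b -> c <= y <= d ->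
    cabs (h (x +i* y) - h p - D * (x +i* y - p)) <= e) ->
  cabs (rect h a b c d) <= 4 * e * (b - a + (d - c)).
Proof.
move=> ab cd H E.
have aab : a <= a <= b by rewrite lexx ab.
have bab : a <= b <= b by rewrite lexx ab.
have ccd : c <= c <= d by rewrite lexx cd.
have dcd : c <= d <= d by rewrite lexx cd.
have H1 x y : a <= x <= b -> c <= y <= d -> rcont (fun t => h (t +i* y)) x.
  by move=> xab ycd; apply: rcont_horizontal; exact: H.
have H2 x y : a <= x <= b -> c <= y <= d -> rcont (fun t => h (x +i* t)) y.
  by move=> xab ycd; apply: rcont_vertical; exact: H.
pose k1 := D * (0 +i* (c - d)); pose k2 := D * (b - a)%:C.
have -> : rect h a b c d =
    ci a b (fun x => h (x +i* c) - h (x +i* d) - k1) +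
    'i%C * ci c d (fun y => h (b +i* y) - h (a +i* y) - k2).
  rewrite (@ciB _ a b (fun x => h (x +i* c) - h (x +i* d))); last 2 first.
  - by move=> x xab; apply: rcontD; last apply: rcontN; exact: H1.
  - by move=> x xab; exact: rcont_cst.
  rewrite (@ciB _ c d (fun y => h (b +i* y) - h (a +i* y))); last 2 first.
  - by move=> x xab; apply: rcontD; last apply: rcontN; exact: H2.
  - by move=> x xab; exact: rcont_cst.
  rewrite !ci_cst// /rect.
  have -> : k1 = - 'i%C * D * (d - c)%:C.
    by rewrite /k1; case: D {E k1 k2} => D1 D2; apply: ceqP; rewrite !creimE /=; ring.
  by rewrite /k2; ring.
have B1 : cabs (ci a b (fun x => h (x +i* c) - h (x +i* d) - k1)) <= 2 * (2 * e) * (b - a).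
  apply: ci_le => // [x xab|x xab].
    apply: rcontD; last by apply: rcont_cst.
    by apply: rcontD; last apply: rcontN; exact: H1.
  have -> : h (x +i* c) - h (x +i* d) - k1 =
     (h (x +i* c) - h p - D * (x +i* c - p)) - (h (x +i* d) - h p - D * (x +i* d - p)).
    have -> : k1 = D * (x +i* c - x +i* d) by congr (_ * _); apply: ceqP; rewrite !creimE /= ?subrr.
    by ring.
  by rewrite (le_trans (cabsB _ _))// mulr_natl mulr2n lerD// E.
have B2 : cabs (ci c d (fun y => h (b +i* y) - h (a +i* y) - k2)) <= 2 * (2 * e) * (d - c).
  apply: ci_le => // [x xab|x xab].
    apply: rcontD; last by apply: rcont_cst.
    by apply: rcontD; last apply: rcontN; exact: H2.
  have -> : h (b +i* x) - h (a +i* x) - k2 =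
     (h (b +i* x) - h p - D * (b +i* x - p)) - (h (a +i* x) - h p - D * (a +i* x - p)).
    have -> : k2 = D * (b +i* x - a +i* x) by congr (_ * _); apply: ceqP; rewrite !creimE /= ?subrr.
    by ring.
  by rewrite (le_trans (cabsB _ _))// mulr_natl mulr2n lerD// E.
apply: le_trans (cabsD _ _) _; rewrite cabsM cabsi mul1r; lra.
Qed.

Arguments rect : simpl never.

Section Bisection.
Variables (h : R[i] -> R[i]) (a b c d eta : R).
Hypotheses (ab : a <= b) (cd : c <= d) (H : cdiff_rect h a b c d).
Let w n := (b - a) / 2 ^+ n.
Let v n := (d - c) / 2 ^+ n.

(** [p] is the lower left corner of a rectangle of the n-th generation, whose boundary integral
    keeps a share [4^-n] of [eta]. *)
Let good n (p : R * R) := [/\ a <= p.1, p.1 + w n <= b, c <= p.2, p.2 + v n <= d &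
  eta / 4 ^+ n <= cabs (rect h p.1 (p.1 + w n) p.2 (p.2 + v n))].

Let sub n (p q : R * R) := good n.+1 q /\ [/\ p.1 <= q.1, q.1 + w n.+1 <= p.1 + w n,
  p.2 <= q.2 & q.2 + v n.+1 <= p.2 + v n].

Let w_ge0 n : 0 <= w n. Proof. by rewrite divr_ge0 ?subr_ge0// exprn_ge0. Qed.
Let v_ge0 n : 0 <= v n. Proof. by rewrite divr_ge0 ?subr_ge0// exprn_ge0. Qed.

Let halve (u : R) n : u / 2 ^+ n.+1 + u / 2 ^+ n.+1 = u / 2 ^+ n.
Proof. by rewrite exprS; field; rewrite expf_neq0. Qed.

Lemma bisect_step n p : good n p -> exists q, sub n p q.
Proof.
case: p => x y [/= ax xb cy yd E].
have w2 := w_ge0 n.+1; have v2 := v_ge0 n.+1.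
have wE : w n.+1 + w n.+1 = w n := halve _ _; have vE : v n.+1 + v n.+1 = v n := halve _ _.
have [X1 X2] : x <= x + w n.+1 /\ x + w n.+1 <= x + w n by lra.
have [Y1 Y2] : y <= y + v n.+1 /\ y + v n.+1 <= y + v n by lra.
have Hs : cdiff_rect h x (x + w n) y (y + v n) by apply: cdiff_rectS H.
rewrite (rect_splitx X1 X2 _ Hs) in E; last lra.
rewrite (rect_splity X1 Y1 Y2) in E; last by apply: cdiff_rectS Hs.
rewrite (rect_splity X2 Y1 Y2) in E; last by apply: cdiff_rectS Hs.
rewrite addrA in E.
have Xe : x + w n = x + w n.+1 + w n.+1 by rewrite -addrA wE.
have Ye : y + v n = y + v n.+1 + v n.+1 by rewrite -addrA vE.
have e4 : eta / 4 ^+ n / 4 = eta / 4 ^+ n.+1 by rewrite exprSr invfM mulrA.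
have := cabs_sum4 E; rewrite e4 {E}.
case=> E; [exists (x, y)|exists (x, y + v n.+1)|exists (x + w n.+1, y)|exists (x + w n.+1, y + v n.+1)];
  (split; split => /=; rewrite -?Xe -?Ye //; lra).
Qed.

Lemma bisect_limit : eta <= cabs (rect h a b c d) -> exists l k : R,
  [/\ a <= l <= b, c <= k <= d & forall n, exists x y,
    [/\ good n (x, y), x <= l <= x + w n & y <= k <= y + v n]].
Proof.
move=> E.
pose next n (p : R * R) := xget p [set q | sub n p q].
pose s := fix s n := if n is m.+1 then next m (s m) else (a, c).
have sg n : good n (s n).
  elim: n => [|n IH] /=.
    by rewrite /good /w /v /= !expr0 !divr1 [a + _]addrC [c + _]addrC !subrK !lexx.
  have [q Hq] := bisect_step IH.
  by have [] : sub n (s n) (next n (s n)) by rewrite /next; apply: xgetI Hq.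
have ss n : sub n (s n) (s n.+1).
  have [q Hq] := bisect_step (sg n).
  by rewrite /= /next; apply: xgetI Hq.
have [l Hl] := @nested_intervals (fun n => (s n).1) w w_ge0
  ltac:(by move=> n; case: (ss n) => _ []) ltac:(by move=> n; case: (ss n) => _ []).
have [k Hk] := @nested_intervals (fun n => (s n).2) v v_ge0
  ltac:(by move=> n; case: (ss n) => _ []) ltac:(by move=> n; case: (ss n) => _ []).
exists l, k; split.
- by have := Hl 0%N; rewrite /= /w expr0 divr1 [a + _]addrC subrK.
- by have := Hk 0%N; rewrite /= /v expr0 divr1 [c + _]addrC subrK.
- move=> n; exists (s n).1, (s n).2; split => //; by case: (s n) (sg n).
Qed.

(** Near the limit point both the first-order error and the perimeter are of order [L / 2^n], so
    that the boundary integral is at most [4 e L^2 / 4^n]; in the comparison with [eta / 4^n] the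
    powers of 4 cancel. *)
Lemma bisect_contra : 0 < eta -> eta <= cabs (rect h a b c d) -> False.
Proof.
move=> eta0 /bisect_limit[l [k [lab kcd Hn]]].
have [D HD] := H lab kcd.
pose L := b - a + (d - c); have L0 : 0 <= L by rewrite /L addr_ge0// subr_ge0.
(* This makes [4 e L^2 < eta / 2]; the [+ 1] covers a rectangle reduced to a point. *)
pose e := eta / (8 * (L ^+ 2 + 1)).
have q0 : 0 < L ^+ 2 + 1 by rewrite ltr_wpDl// sqr_ge0.
have e0 : 0 < e by rewrite divr_gt0// mulr_gt0.
have [r r0 Hr] := HD _ e0.
have [n Ln] := exists_pow2_gt (L / r).
have p2 : 0 < 2 ^+ n :> R by rewrite exprn_gt0.
have Lr : L / 2 ^+ n < r by rewrite ltr_pdivrMr// mulrC -ltr_pdivrMr.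
have [x [y [[/= ax xb cy yd E] xl yk]]] := Hn n.
have wv : w n + v n = L / 2 ^+ n by rewrite /w /v -mulrDl.
have B := @rect_le h x (x + w n) y (y + v n) (l +i* k) D (e * (L / 2 ^+ n)).
have : cabs (rect h x (x + w n) y (y + v n)) <= 4 * (e * (L / 2 ^+ n)) * (w n + v n).
  have -> : w n + v n = x + w n - x + (y + v n - y) by ring.
  apply: B; rewrite ?lerDl//; first by apply: cdiff_rectS H.
  move=> x' y' /andP[x1 x2] /andP[y1 y2].
  have zp : cabs (x' +i* y' - l +i* k) <= L / 2 ^+ n.
    apply: le_trans (cabs_le _) _; rewrite creB cimB /= -wv.
    move/andP: xl => [? ?]; move/andP: yk => [? ?].
    by apply: lerD; rewrite ler_norml; apply/andP; split; lra.
  have := Hr (x' +i* y' - l +i* k); rewrite [_ +i* _ + (_ - _)]addrC subrK => /(_ (le_lt_trans zp Lr)).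
  by move=> /le_trans; apply; rewrite ler_wpM2l// ltW.
rewrite wv => /(le_trans E).
rewrite ler_pdivrMr ?exprn_gt0//.
have -> : 4 * (e * (L / 2 ^+ n)) * (L / 2 ^+ n) * 4 ^+ n = 4 * e * L ^+ 2.
  have -> : 4 ^+ n = 2 ^+ n * 2 ^+ n :> R by rewrite -exprMn -natrM.
  by field; rewrite gt_eqF.
apply/negP; rewrite -ltNge /e.
have -> : 4 * (eta / (8 * (L ^+ 2 + 1))) * L ^+ 2 = eta * (L ^+ 2 / (2 * (L ^+ 2 + 1))).
  by field; rewrite gt_eqF.
rewrite gtr_pMr// ltr_pdivrMr ?mulr_gt0// mul1r.
have := sqr_ge0 L; lra.
Qed.

End Bisection.

Theorem goursat h a b c d : a <= b -> c <= d -> cdiff_rect h a b c d ->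
  rect h a b c d = 0.
Proof.
move=> ab cd H; apply/eqP; rewrite -cabs_eq0; apply: contraT => rn0.
have r0 : 0 < cabs (rect h a b c d) by rewrite lt_def rn0 cabs_ge0.
by have := bisect_contra ab cd H r0 (lexx _).
Qed.

End Goursat.

(** * The complex exponential and the parametrisation of circles *)

Section ComplexExp.
Context {R : realType}.
Implicit Types (z w : R[i]) (x y t u : R).

Lemma mvt_bound (f df : R -> R) (K y : R) : (forall x, is_derive x 1 f (df x)) ->
  (forall x, `|x| <= `|y| -> `|df x| <= K) -> `|f y - f 0| <= K * `|y|.
Proof.
move=> Hd HK.
have cf a b : {within `[a, b], continuous f}.
  apply: continuous_subspaceT => x; apply: differentiable_continuous.
  by apply/derivable1_diffP; have [] := Hd x.
have [y0|y0] := leP 0 y.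
  have [c] := MVT_segment y0 (fun x _ => Hd x) (cf _ _).
  rewrite in_itv /= subr0 => /andP[c0 cy] ->; rewrite normrM ler_wpM2r//.
  by apply: HK; rewrite !ger0_norm// (le_trans c0).
have [c] := MVT_segment (ltW y0) (fun x _ => Hd x) (cf _ _).
rewrite in_itv /= sub0r distrC => /andP[yc c0] ->; rewrite normrM normrN ler_wpM2r//.
by apply: HK; rewrite !ler0_norm ?lerN2// ltW.
Qed.

Lemma norm_sin_le x : `|sin x| <= `|x|.
Proof.
have := @mvt_bound sin cos 1 x (fun x => is_derive_sin x).
rewrite sin0 subr0 mul1r; apply => t _.
by rewrite ler_norml cos_geN1 cos_le1.
Qed.

Lemma norm_cosB1_le x : `|cos x - 1| <= x ^+ 2.
Proof.
have := @mvt_bound cos (fun x => - sin x) `|x| x (fun x => is_derive_cos x).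
rewrite cos0 -expr2 real_normK ?num_real//; apply => t tx.
by rewrite normrN (le_trans (norm_sin_le _)).
Qed.

Lemma norm_sinBid_le x : `|x| <= 1 -> `|sin x - x| <= x ^+ 2.
Proof.
move=> x1; have := @mvt_bound (fun x => sin x - x) (fun x => cos x - 1) `|x| x.
rewrite sin0 subrr subr0 -expr2 real_normK ?num_real//; apply => t tx.
rewrite (le_trans (norm_cosB1_le _))// -(ger0_norm (sqr_ge0 t)) normrX.
by rewrite (le_trans _ tx)// expr2 ler_piMl// (le_trans tx).
Qed.

Lemma expR1_le4 : expR 1 <= 4 :> R.
Proof.
have : expR (- 2^-1) >= 1 - 2^-1 :> R by rewrite expR_ge1Dx.
have e0 := expR_gt0 (2^-1 : R).
rewrite expRN; have -> : 1 - 2^-1 = 2^-1 :> R by field.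
rewrite lef_pV2 ?posrE// => e2.
rewrite [X in expR X](_ : 1 = 2^-1 + 2^-1); last by field.
rewrite expRD; have -> : 4 = 2 * 2 :> R by rewrite -natrM.
by rewrite ler_pM// ltW.
Qed.

Lemma norm_expRB1_le x : `|x| <= 1 -> `|expR x - 1| <= 4 * `|x|.
Proof.
move=> x1; have := @mvt_bound expR expR 4 x (fun x => is_derive_expR x).
rewrite expR0; apply => t tx; rewrite ger0_norm ?expR_ge0//.
by rewrite (le_trans _ expR1_le4)// ler_expR (le_trans (ler_norm _))// (le_trans tx).
Qed.

Lemma norm_expRB1id_le x : `|x| <= 1 -> `|expR x - 1 - x| <= 4 * x ^+ 2.
Proof.
move=> x1; have := @mvt_bound (fun x => expR x - 1 - x) (fun x => expR x - 0 - 1) (4 * `|x|) x.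
rewrite expR0 subrr subrr subr0 -mulrA -expr2 real_normK ?num_real//; apply => t tx.
by rewrite subr0 (le_trans (norm_expRB1_le _))// ?ler_wpM2l// (le_trans tx).
Qed.

Definition cexp z : R[i] := (expR (cre z))%:C * (cos (cim z) +i* sin (cim z)).

Lemma cexpD z w : cexp (z + w) = cexp z * cexp w.
Proof.
rewrite /cexp creD cimD expRD cosD sinD; apply: ceqP; rewrite !creimE /=; ring.
Qed.

Lemma cabs_cexp z : cabs (cexp z) = expR (cre z).
Proof.
rewrite /cexp cabsM cabsR ger0_norm ?expR_ge0//.
by rewrite /cabs /= cos2Dsin2 sqrtr1 mulr1.
Qed.

Lemma cabs_cexp_le z : cabs (cexp z) <= expR (cabs z).
Proof. by rewrite cabs_cexp ler_expR (le_trans (ler_norm _) (cre_le _)). Qed.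

Lemma cexp_neq0 z : cexp z != 0.
Proof. by rewrite -cabs_gt0 cabs_cexp expR_gt0. Qed.

(** Both parts split into products of real remainders, each bounded by 4 times a quadratic
    expression in [cre z] and [cim z]; 15 leaves some room. *)
Lemma cexp_approx z : cabs z <= 1 -> cabs (cexp z - 1 - z) <= 15 * cabs z ^+ 2.
Proof.
move=> z1.
have x1 : `|cre z| <= 1 by rewrite (le_trans (cre_le _)).
have y1 : `|cim z| <= 1 by rewrite (le_trans (cim_le _)).
set x := cre z; set y := cim z.
have E3 : expR x <= 4 by rewrite (le_trans _ expR1_le4)// ler_expR (le_trans (ler_norm _)).
have E0 := expR_ge0 x.
have xy : `|y| * `|x| <= x ^+ 2 + y ^+ 2.
  rewrite -(real_normK (num_real x)) -(real_normK (num_real y)).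
  have := sqr_ge0 (`|x| - `|y|); have := normr_ge0 x; have := normr_ge0 y; nra.
have Hx2 := sqr_ge0 x; have Hy2 := sqr_ge0 y.
rewrite sqr_cabs -/x -/y.
apply: le_trans (cabs_le _) _; rewrite !creB !cimB /cexp !creimE -/x -/y /= !mul0r subr0 addr0.
have -> : expR x * cos y - 1 - x = (expR x - 1 - x) + expR x * (cos y - 1) by ring.
have -> : expR x * sin y - 0 - y = expR x * (sin y - y) + y * (expR x - 1) by ring.
have A1 := norm_expRB1id_le x1.
have A2 : `|expR x * (cos y - 1)| <= 4 * y ^+ 2.
  by rewrite normrM (ger0_norm E0) ler_pM// norm_cosB1_le.
have A3 : `|expR x * (sin y - y)| <= 4 * y ^+ 2.
  by rewrite normrM (ger0_norm E0) ler_pM// norm_sinBid_le.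
have A4 : `|y * (expR x - 1)| <= 4 * (`|y| * `|x|).
  by rewrite normrM mulrCA ler_wpM2l// norm_expRB1_le.
have := ler_normD (expR x - 1 - x) (expR x * (cos y - 1)).
have := ler_normD (expR x * (sin y - y)) (y * (expR x - 1)).
move: A1; rewrite -/x; lra.
Qed.

Lemma cderiv_cexp z : cderiv cexp z (cexp z).
Proof.
move=> e e0; have k0 : 0 < 15 * cabs (cexp z) by rewrite mulr_gt0// cabs_gt0 cexp_neq0.
exists (Num.min 1 (e / (15 * cabs (cexp z)))); first by rewrite lt_min ltr01 divr_gt0.
move=> h; rewrite lt_min => /andP[h1 he].
have -> : cexp (z + h) - cexp z - cexp z * h = cexp z * (cexp h - 1 - h).
  by rewrite cexpD; ring.
rewrite cabsM; apply: (@le_trans _ _ (cabs (cexp z) * (15 * cabs h ^+ 2))).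
  by rewrite ler_wpM2l ?cabs_ge0// cexp_approx// ltW.
rewrite expr2 !mulrA ler_wpM2r ?cabs_ge0//.
by move: he; rewrite ltr_pdivlMr// => /ltW; apply: le_trans; rewrite mulrC [15 * _]mulrC.
Qed.

Definition circ (rho t : R) : R[i] := rho%:C * (cos t +i* sin t).

Lemma cexp_circ u t : cexp (u +i* t) = circ (expR u) t.
Proof. by []. Qed.

Lemma cabs_circ rho t : cabs (circ rho t) = `|rho|.
Proof. by rewrite /circ cabsM cabsR /cabs /= cos2Dsin2 sqrtr1 mulr1. Qed.

Lemma rcont_circ rho t : rcont (circ rho) t.
Proof.
apply: rcontM; first exact: rcont_cst.
by split; [exact: continuous_cos|exact: continuous_sin].
Qed.

Lemma circ_pi2 rho : circ rho (pi *+ 2) = rho%:C.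
Proof. by rewrite /circ cos2pi sin2pi mulr1. Qed.

Lemma circ_0 rho : circ rho 0 = rho%:C.
Proof. by rewrite /circ cos0 sin0 mulr1. Qed.

(** Compactness of the segment makes the continuity uniform along it. Through [cexp] this gives the
    continuity of means over circles in the radius; after a rotation it gives the uniform approach
    of the Cauchy transform to the real axis. *)
Lemma tube (h : R[i] -> R[i]) (u a b : R) :
  (forall t, a <= t <= b -> ccont h (u +i* t)) ->
  forall e, 0 < e -> exists2 d, 0 < d & forall v t, `|v - u| < d -> a <= t <= b ->
    cabs (h (v +i* t) - h (u +i* t)) < e.
Proof.
move=> ch e e0.
have /compact_near_coveringP K := @segment_compact R a b.
have : \forall v \near u, `[a, b]%classic `<=`
    (fun t => cabs (h (v +i* t) - h (u +i* t)) < e).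
  apply: (K _ (nbhs u) (fun v t => cabs (h (v +i* t) - h (u +i* t)) < e)
    (nbhs_filter u)) => t /=.
  rewrite in_itv /= => tab.
  have [d d0 Hd] := ch _ tab (e / 2) ltac:(by rewrite divr_gt0).
  exists ([set s | `|t - s| < d / 2], [set v | `|u - v| < d / 2]) => /=.
    by split; apply/nbhs_ballP; exists (d / 2) => //=; rewrite divr_gt0.
  move=> [s v] /= [ts uv].
  have -> : h (v +i* s) - h (u +i* s) =
    (h (v +i* s) - h (u +i* t)) - (h (u +i* s) - h (u +i* t)) by ring.
  rewrite (le_lt_trans (cabsB _ _))// (splitr e) ltrD//; apply: Hd;
    apply: le_lt_trans (cabs_le _) _; rewrite creB cimB /= ?subrr ?normr0 ?add0r.
    by rewrite (splitr d) ltrD// distrC.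
  by rewrite distrC; lra.
move=> /nbhs_ballP[d /= d0 Hd]; exists d => // v t vu tab.
by apply: Hd; rewrite /ball /= ?in_itv//= distrC.
Qed.

End ComplexExp.

(** * Means over circles, power series and Taylor expansions *)

Section CircleMean.
Context {R : realType}.
Implicit Types (q f : R[i] -> R[i]) (z zeta : R[i]) (r rho u e : R).

Local Notation tau := (pi *+ 2 : R).

Let tau_gt0 : 0 < tau. Proof. by rewrite mulrn_wgt0// pi_gt0. Qed.

Let tauK (e t : R) : t != 0 -> e = 2 * (e / (2 * t)) * t.
Proof. by move=> t0; field. Qed.

Let tau_neq0 : tau != 0. Proof. exact: lt0r_neq0. Qed.

(** The integral over the angle, not divided by [2 pi]; it equals the integral of [q z / (i z) dz]
    over the circle. *)
Definition cmean rho q : R[i] := ci 0 tau (fun t => q (circ rho t)).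

Lemma cabs_circ0 rho t : 0 < rho -> cabs (circ rho t) = rho.
Proof. by move=> r0; rewrite cabs_circ gtr0_norm. Qed.

Lemma rcont_circle q rho : 0 < rho -> (forall z, cabs z = rho -> ccont q z) ->
  forall t, rcont (fun t => q (circ rho t)) t.
Proof.
move=> r0 cq t; apply: (rcont_comp (F := circ rho)); first exact: rcont_circ.
by apply: cq; rewrite cabs_circ0.
Qed.

Lemma cmeanD rho p q : 0 < rho -> (forall z, cabs z = rho -> ccont p z) ->
  (forall z, cabs z = rho -> ccont q z) ->
  cmean rho (fun z => p z + q z) = cmean rho p + cmean rho q.
Proof. by move=> r0 cp cq; apply: ciD => t _; exact: rcont_circle. Qed.

Lemma cmeanZ rho c q : 0 < rho -> (forall z, cabs z = rho -> ccont q z) ->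
  cmean rho (fun z => c * q z) = c * cmean rho q.
Proof. by move=> r0 cq; apply: ciZ => t _; exact: rcont_circle. Qed.

Lemma eq_cmean rho p q : 0 < rho -> (forall z, cabs z = rho -> p z = q z) ->
  cmean rho p = cmean rho q.
Proof. by move=> r0 pq; apply: eq_ci => t _; rewrite pq// cabs_circ0. Qed.

Lemma cmean_cst rho c : cmean rho (fun=> c) = c * tau%:C.
Proof. by rewrite /cmean ci_cst ?subr0// ltW. Qed.

Lemma cmean_le rho q (B : R) : 0 < rho -> (forall z, cabs z = rho -> ccont q z) ->
  (forall z, cabs z = rho -> cabs (q z) <= B) -> cabs (cmean rho q) <= 2 * B * tau.
Proof.
move=> r0 cq qB; have := @ci_le R 0 tau (fun t => q (circ rho t)) B (ltW tau_gt0).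
rewrite subr0; apply => t _; first exact: rcont_circle.
by rewrite qB// cabs_circ0.
Qed.

Lemma cdiff_cont q z : cdiff q z -> ccont q z.
Proof. by case=> D /cderiv_cont. Qed.

Lemma cdiff_comp f q z : cdiff f z -> cdiff q (f z) -> cdiff (q \o f) z.
Proof. by move=> [a Ha] [b Hb]; exists (b * a); exact: cderiv_comp. Qed.

Lemma cdiffD f q z : cdiff f z -> cdiff q z -> cdiff (fun w => f w + q w) z.
Proof. by move=> [a Ha] [b Hb]; eexists; exact: cderivD Ha Hb. Qed.

Lemma cdiffN f z : cdiff f z -> cdiff (fun w => - f w) z.
Proof. by move=> [a Ha]; eexists; exact: cderivN Ha. Qed.

Lemma cdiffM f q z : cdiff f z -> cdiff q z -> cdiff (fun w => f w * q w) z.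
Proof. by move=> [a Ha] [b Hb]; eexists; exact: cderivM Ha Hb. Qed.

Lemma cdiffV f z : f z != 0 -> cdiff f z -> cdiff (fun w => (f w)^-1) z.
Proof. by move=> f0 [a Ha]; eexists; exact: cderivV f0 Ha. Qed.

Lemma cdiff_cst (c : R[i]) z : cdiff (fun=> c) z.
Proof. by exists 0; exact: cderiv_cst. Qed.

Lemma cdiff_id z : cdiff id z.
Proof. by exists 1; exact: cderiv_id. Qed.

Lemma cdiffX f z n : cdiff f z -> cdiff (fun w => f w ^+ n) z.
Proof.
move=> Hf; elim: n => [|n IH]; first by exact: cdiff_cst.
rewrite (_ : (fun _ => _) = fun w => f w * f w ^+ n); first exact: cdiffM.
by apply/funext => w; rewrite exprS.
Qed.

Lemma cdiff_near f q z (d : R) : 0 < d ->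
  (forall w, cabs (w - z) < d -> f w = q w) -> cdiff f z -> cdiff q z.
Proof. by move=> d0 fq [a Ha]; exists a; exact: (cderiv_near d0 fq Ha). Qed.

(** In the logarithmic coordinate the annulus is a rectangle whose horizontal sides cancel by
    periodicity; its vertical sides are the two means. *)
Lemma cmean_step q u v : u <= v ->
  (forall z, expR u <= cabs z <= expR v -> cdiff q z) ->
  cmean (expR u) q = cmean (expR v) q.
Proof.
move=> uv dq.
have H : cdiff_rect (q \o cexp) u v 0 tau.
  move=> x y /andP[ux xv] _; apply: cdiff_comp; first by eexists; exact: cderiv_cexp.
  by apply: dq; rewrite cabs_cexp /= !ler_expR ux.
have := goursat uv (ltW tau_gt0) H; rewrite /rect.
rewrite (@eq_ci _ u v _ (fun=> 0)); last first.
  by move=> t _; rewrite /= !cexp_circ circ_pi2 circ_0 subrr.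
have E : ci u v (fun=> 0) = 0 :> R[i].
  by apply: (etrans (ci_cst 0 uv)); exact: mul0r.
rewrite {}E add0r => /eqP.
rewrite mulf_eq0 -cabs_eq0 cabsi oner_eq0 /= => /eqP.
rewrite ciB; last 2 first.
- move=> y yt; apply: (rcont_vertical (h := q \o cexp)); apply: H => //.
  by rewrite lexx uv.
- move=> y yt; apply: (rcont_vertical (h := q \o cexp)); apply: H => //.
  by rewrite lexx uv.
by move=> /subr0_eq E; exact: (esym E).
Qed.

Lemma cmean_continuous q u :
  (forall z, cabs z = expR u -> ccont q z) ->
  (exists2 d, 0 < d & forall v, `|v - u| < d -> forall z, cabs z = expR v -> ccont q z) ->
  forall e, 0 < e -> exists2 d, 0 < d & forall v, `|v - u| < d ->
    cabs (cmean (expR v) q - cmean (expR u) q) <= e.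
Proof.
move=> cq [d' d'0 cq'] e e0.
have ch t : 0 <= t <= tau -> ccont (q \o cexp) (u +i* t).
  move=> _; apply: ccont_comp; first exact: cderiv_cont (cderiv_cexp _).
  by apply: cq; rewrite cabs_cexp.
have [d d0 Hd] := tube ch (e := e / (2 * tau)) ltac:(by rewrite divr_gt0// mulr_gt0).
exists (Num.min d d'); first by rewrite lt_min d0.
move=> v; rewrite lt_min => /andP[vd vd'].
rewrite /cmean -ciB; last 2 first.
- by move=> t _; apply: rcont_circle; [exact: expR_gt0|exact: cq'].
- by move=> t _; apply: rcont_circle; [exact: expR_gt0|exact: cq].
rewrite [leRHS](tauK e tau_neq0) -{3}(subr0 tau).
apply: ci_le; first exact: ltW.
  move=> t _; apply: rcontD; last apply: rcontN.
    by apply: rcont_circle; [exact: expR_gt0|exact: cq'].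
  by apply: rcont_circle; [exact: expR_gt0|exact: cq].
by move=> t tt; rewrite -!cexp_circ; apply/ltW/Hd.
Qed.

(** Differentiability may fail on the circle of radius [rho0]: the mean is constant on either side
    of it and continuous across it. This serves for difference quotients, which at their centre are
    only known to be continuous. *)
Lemma cmean_const q r rho0 : 0 < rho0 < r ->
  (forall z, 0 < cabs z < r -> ccont q z) ->
  (forall z, 0 < cabs z < r -> cabs z != rho0 -> cdiff q z) ->
  forall rho, 0 < rho < r -> cmean rho q = cmean rho0 q.
Proof.
move=> /andP[r0 r0r] cq dq rho /andP[rho_gt0 rhor].
set u0 := ln rho0; have e0 : expR u0 = rho0 by rewrite lnK.
set u := ln rho; have eu : expR u = rho by rewrite lnK.
apply/eqP; rewrite -subr_eq0 -cabs_eq0 eq_le cabs_ge0 andbT.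
apply/ler_addgt0Pr => e egt0; rewrite add0r.
have cv v : expR v < r -> forall z, cabs z = expR v -> ccont q z.
  by move=> vr z zv; apply: cq; rewrite zv expR_gt0.
have [d1 d10 Hd1] : exists2 d, 0 < d & forall v, `|v - u0| < d -> expR v < r.
  exists (ln r - u0); first by rewrite subr_gt0 -ltr_expR e0 lnK// posrE (lt_trans r0).
  move=> v vu; rewrite -[ltRHS]lnK ?posrE ?(lt_trans r0)// ltr_expR.
  have := ler_norm (v - u0); lra.
have cq0 : forall z, cabs z = expR u0 -> ccont q z by apply: cv; rewrite e0.
have cq1 : exists2 d, 0 < d & forall v, `|v - u0| < d ->
    forall z, cabs z = expR v -> ccont q z.
  by exists d1 => // v /Hd1; exact: cv.
have [d d0 Hd] := cmean_continuous cq0 cq1 egt0.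
rewrite -eu -e0.
have [uu0|u0u|->] := ltgtP u u0; last by rewrite subrr cabs0 ltW.
- pose v := Num.max u (u0 - d / 2).
  have v0 : v < u0 by rewrite /v gt_max uu0 /=; lra.
  rewrite (@cmean_step q u v).
  + by apply: Hd; rewrite ltr0_norm ?subr_lt0// opprB ltrBlDr -ltrBlDl lt_max; apply/orP; right; lra.
  + by rewrite le_max lexx.
  + move=> z /andP[z1 z2]; have z3 : cabs z < rho0 by rewrite (le_lt_trans z2)// -e0 ltr_expR.
    by apply: dq; rewrite ?lt_eqF// (lt_trans z3)// andbT (lt_le_trans _ z1)// expR_gt0.
- pose v := Num.min u (u0 + d / 2).
  have v0 : u0 < v by rewrite /v lt_min u0u /=; lra.
  rewrite -(@cmean_step q v u).
  + by apply: Hd; rewrite gtr0_norm ?subr_gt0// ltrBlDr gt_min; apply/orP; right; lra.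
  + by rewrite ge_min lexx.
  + move=> z /andP[z1 z2]; have z3 : rho0 < cabs z by rewrite (lt_le_trans _ z1)// -e0 ltr_expR.
    by apply: dq; rewrite ?gt_eqF// (le_lt_trans z2) ?eu// andbT (lt_trans r0).
Qed.

(** The mean does not depend on the radius and tends to [2 pi * q 0] as the radius shrinks. *)
Lemma cmean_vanish q r rho0 : 0 < rho0 < r -> ccont q 0 -> q 0 = 0 ->
  (forall z, 0 < cabs z < r -> ccont q z) ->
  (forall z, 0 < cabs z < r -> cabs z != rho0 -> cdiff q z) ->
  forall rho, 0 < rho < r -> cmean rho q = 0.
Proof.
move=> r0 cq0 q0 cq dq rho rr; rewrite (cmean_const r0 cq dq rr).
apply/eqP; rewrite -cabs_eq0 eq_le cabs_ge0 andbT; apply/ler_addgt0Pr => e e0; rewrite add0r.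
have [d d0 Hd] := cq0 (e / (2 * tau)) ltac:(by rewrite divr_gt0// mulr_gt0).
pose s := Num.min (d / 2) rho0.
have s0 : 0 < s by rewrite lt_min divr_gt0//=; case/andP: r0.
have sr : s < r by rewrite gt_min; case/andP: r0 => _ ->; rewrite orbT.
rewrite -(cmean_const r0 cq dq (rho := s)) ?s0//.
rewrite [leRHS](tauK e tau_neq0).
apply: cmean_le => // z zs; first by apply: cq; rewrite zs s0.
have := Hd z; rewrite subr0 q0 subr0 zs => H; apply/ltW/H.
by rewrite gt_min; apply/orP; left; lra.
Qed.

End CircleMean.

(** * Complex series and termwise differentiation of power series *)

Section ComplexSeries.
Context {R : realType}.
Implicit Types (u v : nat -> R[i]) (l z : R[i]).

Definition csum u l := forall e : R, 0 < e -> exists N, forall n, (N <= n)%N ->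
  cabs (\sum_(k < n) u k - l) < e.

Lemma csum_unique u l l' : csum u l -> csum u l' -> l = l'.
Proof.
move=> H H'; apply/eqP; rewrite -subr_eq0 -cabs_eq0 eq_le cabs_ge0 andbT.
apply/ler_addgt0Pr => e e0; rewrite add0r.
have e2 : 0 < e / 2 by rewrite divr_gt0.
have [N HN] := H _ e2; have [N' HN'] := H' _ e2.
have A := HN (maxn N N') (leq_maxl _ _); have B := HN' (maxn N N') (leq_maxr _ _).
set S := \sum_(k < _) _ in A B.
have -> : l - l' = (S - l') - (S - l) by ring.
by rewrite (le_trans (cabsB _ _))// (splitr e) ltW// ltrD.
Qed.

Lemma sum_cabs_le u n : cabs (\sum_(k < n) u k) <= \sum_(k < n) cabs (u k).
Proof.
elim: n => [|n IH]; first by rewrite !big_ord0 cabs0.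
by rewrite !big_ord_recr /= (le_trans (cabsD _ _))// lerD2r.
Qed.

Lemma csum_ex u (K : R) : (forall n, \sum_(k < n) cabs (u k) <= K) -> exists l, csum u l.
Proof.
move=> uK.
have C (f : R[i] -> R) : (forall z, `|f z| <= cabs z) -> cvgn (series (fun k => f (u k))).
  move=> fz; apply: normed_cvg; apply: (@series_le_cvg _ _ (fun k => cabs (u k))).
  - by move=> n /=.
  - by move=> n; exact: cabs_ge0.
  - by move=> n; exact: fz.
  apply: nondecreasing_is_cvgn.
    by apply/nondecreasing_seqP => n; rewrite /series /= big_nat_recr//= lerDl cabs_ge0.
  by exists K => _ [n _ <-]; rewrite /series /= big_mkord.
have /cvg_ex[/= a Ha] := C cre cre_le; have /cvg_ex[/= b Hb] := C cim cim_le.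
exists (a +i* b) => e e0; have e2 : 0 < e / 2 by rewrite divr_gt0.
move/cvgrPdist_lt: Ha => /(_ _ e2)[N _ HN].
move/cvgrPdist_lt: Hb => /(_ _ e2)[N' _ HN'].
exists (maxn N N') => n; rewrite geq_max => /andP[nN nN'].
have := HN _ nN; have := HN' _ nN'; rewrite /series /= !big_mkord => A B.
have S (f : R[i] -> R) : f 0 = 0 -> {morph f : x y / x + y} ->
    f (\sum_(k < n) u k) = \sum_(k < n) f (u k) by move=> f0 fD; apply: big_morph.
rewrite (le_lt_trans (cabs_le _))// creB cimB /= (S cre)//; last exact: creD.
rewrite (S cim)//; last exact: cimD.
by rewrite (splitr e) ltrD// distrC.
Qed.

Lemma csum_le u l (K : R) : csum u l -> (forall n, \sum_(k < n) cabs (u k) <= K) -> cabs l <= K.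
Proof.
move=> H uK; apply/ler_addgt0Pr => e e0; have [N /(_ N (leqnn N)) HN] := H _ e0.
have -> : l = \sum_(k < N) u k - (\sum_(k < N) u k - l) by ring.
by rewrite (le_trans (cabsB _ _))// lerD ?(ltW HN)// (le_trans (sum_cabs_le _ _)).
Qed.

Lemma csum_shift u l n : csum u l -> csum (fun k => u (n + k)%N) (l - \sum_(k < n) u k).
Proof.
move=> H e /H[N HN]; exists N => m Nm.
have := HN (n + m)%N (leq_trans Nm (leq_addl _ _)).
rewrite big_split_ord /=; congr (cabs _ < _); ring.
Qed.

Lemma csumD u v l l' : csum u l -> csum v l' -> csum (fun k => u k + v k) (l + l').
Proof.
move=> H H' e e0; have e2 : 0 < e / 2 by rewrite divr_gt0.
have [N HN] := H _ e2; have [N' HN'] := H' _ e2.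
exists (maxn N N') => n; rewrite geq_max => /andP[nN nN'].
rewrite big_split /= opprD addrACA (le_lt_trans (cabsD _ _))// (splitr e) ltrD//.
  exact: HN.
exact: HN'.
Qed.

Lemma csumZ u l c : csum u l -> csum (fun k => c * u k) (c * l).
Proof.
move=> H e e0; have c1 : 0 < cabs c + 1 by rewrite ltr_wpDl// cabs_ge0.
have [N HN] := H (e / (cabs c + 1)) ltac:(by rewrite divr_gt0).
exists N => n /HN; rewrite -mulr_sumr -mulrBr cabsM ltr_pdivlMr// => He.
by apply: le_lt_trans He; rewrite mulrC ler_wpM2l ?cabs_ge0// lerDl.
Qed.

Lemma eq_csum u v l : u =1 v -> csum u l -> csum v l.
Proof. by move=> /funext ->. Qed.

Definition psum (c : nat -> R[i]) z : R[i] := xget 0 [set l | csum (fun n => c n * z ^+ n) l].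

Lemma psumE c z l : csum (fun n => c n * z ^+ n) l -> psum c z = l.
Proof. move=> H; apply: (csum_unique _ H).
by rewrite /psum; case: xgetP => [? -> //|/(_ l)/(_ H)]. Qed.

Lemma psum_csum (c : nat -> R[i]) z (K : R) : (forall n, \sum_(k < n) cabs (c k * z ^+ k) <= K) ->
  csum (fun n => c n * z ^+ n) (psum c z).
Proof. by move=> H; have [l Hl] := csum_ex (u := fun k => c k * z ^+ k) H; rewrite (psumE Hl). Qed.

Lemma geo_sum_le (x : R) n : 0 <= x < 1 -> \sum_(k < n) x ^+ k <= (1 - x)^-1.
Proof.
move=> /andP[x0 x1]; rewrite -[leRHS]mul1r ler_pdivlMr ?subr_gt0//.
have E : (\sum_(k < n) x ^+ k) * (1 - x) = 1 - x ^+ n.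
  elim: n => [|n IH]; first by rewrite big_ord0 mul0r expr0 subrr.
  by rewrite big_ord_recr /= mulrDl IH exprS; ring.
by rewrite E gerBl exprn_ge0.
Qed.

Lemma geo_sum1_le (x : R) n : 0 <= x < 1 ->
  \sum_(k < n) k.+1%:R * x ^+ k <= (1 - x)^-1 ^+ 2.
Proof.
move=> x01; have /andP[x0 x1] := x01.
have E : (\sum_(k < n) k.+1%:R * x ^+ k) * (1 - x) + n%:R * x ^+ n = \sum_(k < n) x ^+ k.
  elim: n => [|n IH]; first by rewrite !big_ord0 !mul0r addr0.
  by rewrite !big_ord_recr /= -IH exprS mulrDl -natr1; ring.
have : 0 <= n%:R * x ^+ n by rewrite mulr_ge0// exprn_ge0.
have := geo_sum_le n x01; rewrite -E expr2 => A B.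
by rewrite ler_pdivlMr ?subr_gt0//; lra.
Qed.

(** Multiplication by [1 - x] lowers the degree of the weight, as
    [(k + 1)^2 - k^2 = 2 (k + 1) - 1]. *)
Lemma geo_sum2_le (x : R) n : 0 <= x < 1 ->
  \sum_(k < n) k.+1%:R ^+ 2 * x ^+ k <= 2 * (1 - x)^-1 ^+ 3.
Proof.
move=> x01; have /andP[x0 x1] := x01.
have E : (\sum_(k < n) k.+1%:R ^+ 2 * x ^+ k) * (1 - x) + n%:R ^+ 2 * x ^+ n
   = \sum_(k < n) (2 * k.+1%:R - 1) * x ^+ k.
  elim: n => [|n IH]; first by rewrite !big_ord0 expr0n /= !mul0r addr0.
  by rewrite !big_ord_recr /= -IH (exprS x) -[n.+1%:R]natr1; ring.
have : 0 <= n%:R ^+ 2 * x ^+ n by rewrite mulr_ge0 ?exprn_ge0.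
have H : \sum_(k < n) (2 * k.+1%:R - 1) * x ^+ k <= 2 * \sum_(k < n) k.+1%:R * x ^+ k.
  rewrite mulr_sumr; apply: ler_sum => k _; rewrite mulrA ler_wpM2r ?exprn_ge0//.
  by rewrite gerBl.
rewrite [_ ^+ 3]exprSr mulrA ler_pdivlMr ?subr_gt0//.
have := geo_sum1_le n x01; rewrite -E in H; lra.
Qed.

(** A geometric bound in place of a radius of convergence: the power series converges for
    [s |z| < 1], everywhere if [s = 0]. *)
Definition cbound (c : nat -> R[i]) (M s : R) := [/\ 0 <= M, 0 <= s &
  forall n, cabs (c n) <= M * s ^+ n].

Lemma cbound_csum c M s z : cbound c M s -> s * cabs z < 1 ->
  csum (fun n => c n * z ^+ n) (psum c z) /\
  forall N, cabs (psum c z - \sum_(k < N) c k * z ^+ k) <= M * (s * cabs z) ^+ N / (1 - s * cabs z).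
Proof.
move=> [M0 s0 cM] sz.
have sz0 : 0 <= s * cabs z by rewrite mulr_ge0 ?cabs_ge0.
have H n N : \sum_(k < n) cabs (c (N + k)%N * z ^+ (N + k)%N) <=
    M * (s * cabs z) ^+ N / (1 - s * cabs z).
  apply: (@le_trans _ _ (\sum_(k < n) (M * (s * cabs z) ^+ N) * (s * cabs z) ^+ k)).
    apply: ler_sum => k _; rewrite cabsM cabsX -mulrA -exprD exprMn mulrA.
    by rewrite ler_wpM2r ?exprn_ge0 ?cabs_ge0.
  rewrite -mulr_sumr ler_wpM2l ?mulr_ge0 ?exprn_ge0//.
  by apply: geo_sum_le; rewrite sz0.
have C : csum (fun n => c n * z ^+ n) (psum c z).
  apply: psum_csum => n; have := H n 0%N; under eq_bigr do rewrite add0n; exact.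
split=> // N; exact: csum_le (csum_shift N C) (fun n => H n N).
Qed.

Lemma cabs_nat m : cabs (m%:R : R[i]) = m%:R.
Proof. by rewrite -(rmorph_nat (real_complex R)) cabsR normr_nat. Qed.

(** The second-order remainder of a power, by induction on the exponent. The factor [t] on the left
    avoids [t^(n - 1)] on the right, which would be a negative power for [n = 0]. *)
Lemma expr_diff_le z (h : R[i]) (t : R) n : 0 < t -> cabs z <= t -> cabs (z + h) <= t ->
  cabs ((z + h) ^+ n.+1 - z ^+ n.+1 - n.+1%:R * z ^+ n * h) * t <=
    n.+1%:R ^+ 2 * t ^+ n * cabs h ^+ 2.
Proof.
move=> t0 zt zht; elim: n => [|n IH].
  have -> : (z + h) ^+ 1 - z ^+ 1 - 1%:R * z ^+ 0 * h = 0 by ring.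
  by rewrite cabs0 mul0r expr0 expr1n !mul1r exprn_ge0// cabs_ge0.
have -> : (z + h) ^+ n.+2 - z ^+ n.+2 - n.+2%:R * z ^+ n.+1 * h =
  (z + h) * ((z + h) ^+ n.+1 - z ^+ n.+1 - n.+1%:R * z ^+ n * h) + n.+1%:R * z ^+ n * h ^+ 2.
  by rewrite -[n.+2%:R]natr1 !exprS; ring.
apply: (@le_trans _ _ ((t * cabs ((z + h) ^+ n.+1 - z ^+ n.+1 - n.+1%:R * z ^+ n * h) +
    n.+1%:R * t ^+ n * cabs h ^+ 2) * t)).
  rewrite ler_wpM2r ?(ltW t0)//; apply: le_trans (cabsD _ _) _; rewrite !cabsM !cabsX cabs_nat.
  rewrite lerD//; first by rewrite ler_wpM2r ?cabs_ge0.
  rewrite -expr2 ler_wpM2r ?exprn_ge0 ?cabs_ge0// ler_wpM2l// lerXn2r// nnegrE ?cabs_ge0//.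
  exact: ltW.
rewrite mulrDl -mulrA.
apply: (@le_trans _ _ (t * (n.+1%:R ^+ 2 * t ^+ n * cabs h ^+ 2) + n.+1%:R * t ^+ n * cabs h ^+ 2 * t)).
  by rewrite lerD2r ler_wpM2l// ltW.
rewrite [X in X <= _](_ : _ = (n.+1%:R ^+ 2 + n.+1%:R) * (t ^+ n.+1 * cabs h ^+ 2)); last first.
  by rewrite (exprS t); ring.
rewrite -mulrA ler_wpM2r ?mulr_ge0 ?exprn_ge0 ?cabs_ge0 ?(ltW t0)//.
have : 0 <= n%:R :> R by []. rewrite -[n.+2%:R]natr1 -natr1 => n0; nra.
Qed.

(** Inside a disc of radius [t > |z|] with [s t < 1], [expr_diff_le] bounds the second-order
    remainder of each term, and these bounds add up to [K |h|^2]. *)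
Lemma psum_deriv c M s z : cbound c M s -> s * cabs z < 1 ->
  cderiv (psum c) z (psum (fun n => n.+1%:R * c n.+1) z).
Proof.
move=> cb sz; have [M0 s0 cM] := cb.
have [t [t0 zt st]] : exists t, [/\ 0 < t, cabs z < t & s * t < 1].
  have [->|sn0] := eqVneq s 0; first by exists (cabs z + 1); rewrite mul0r ltrDl ltr01 ltr_wpDl ?cabs_ge0.
  have sgt0 : 0 < s by rewrite lt_def sn0.
  exists ((cabs z + s^-1) / 2); have := cabs_ge0 z; have : 0 < s^-1 by rewrite invr_gt0.
  have : cabs z < s^-1 by rewrite -div1r ltr_pdivlMr// mulrC.
  have : s * s^-1 = 1 by rewrite divff.
  by move=> e1 e2 e3 e4; split; [lra|lra|nra].
have st0 : 0 <= s * t by rewrite mulr_ge0// ltW.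
set d := psum _ z.
have Hd : csum (fun n => n.+1%:R * c n.+1 * z ^+ n) d.
  apply: (@psum_csum _ _ (M * s * (1 - s * t)^-1 ^+ 2)) => n.
  apply: (@le_trans _ _ (\sum_(k < n) M * s * (k.+1%:R * (s * t) ^+ k))).
    apply: ler_sum => k _; rewrite !cabsM cabsX cabs_nat exprMn.
    rewrite [leRHS](_ : _ = k.+1%:R * (M * s ^+ k.+1) * t ^+ k); last by rewrite exprS; ring.
    rewrite ler_pM ?mulr_ge0 ?cabs_ge0 ?exprn_ge0 ?cabs_ge0//; first by rewrite ler_wpM2l.
    by rewrite lerXn2r ?nnegrE ?cabs_ge0 ?ltW.
  by rewrite -mulr_sumr ler_wpM2l ?mulr_ge0// geo_sum1_le// st0.
pose K := M * s * (2 * (1 - s * t)^-1 ^+ 3) / t.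
have K0 : 0 <= K by rewrite !mulr_ge0 ?exprn_ge0 ?invr_ge0 ?subr_ge0// ltW.
move=> e e0; exists (Num.min (t - cabs z) (e / (K + 1))).
  by rewrite lt_min subr_gt0 zt divr_gt0// ltr_wpDl.
move=> h; rewrite lt_min => /andP[ht he].
have zht : cabs (z + h) < t by rewrite (le_lt_trans (cabsD _ _))// -ltrBrDl.
have [C1 _] := cbound_csum cb sz.
have [C2 _] := cbound_csum (z := z + h) cb (le_lt_trans (ler_wpM2l s0 (ltW zht)) st).
have CC : csum (fun k => c k.+1 * ((z + h) ^+ k.+1 - z ^+ k.+1 - k.+1%:R * z ^+ k * h))
    (psum c (z + h) - psum c z - d * h).
  move: (psum c (z + h)) (psum c z) d Hd C1 C2 => A B d Hd C1 C2.
  have := csumD (csum_shift 1 (csumD C2 (csumZ (-1) C1))) (csumZ (- h) Hd).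
  rewrite big_ord1 !expr0.
  have -> : A + -1 * B - (c 0%N * 1 + -1 * (c 0%N * 1)) + - h * d = A - B - d * h by ring.
  by apply: eq_csum => k; rewrite add1n; ring.
apply: (@le_trans _ _ (K * cabs h ^+ 2)).
  apply: (csum_le CC) => n.
  apply: (@le_trans _ _ (\sum_(k < n) M * s / t * cabs h ^+ 2 * (k.+1%:R ^+ 2 * (s * t) ^+ k))).
    apply: ler_sum => k _.
    rewrite cabsM; have := expr_diff_le k t0 (ltW zt) (ltW zht); rewrite -ler_pdivlMr// => E.
    apply: (le_trans (ler_pM (cabs_ge0 _) (cabs_ge0 _) (cM _) E)).
    by rewrite exprMn exprS le_eqVlt; apply/orP; left; apply/eqP; ring.
  rewrite -mulr_sumr.
  rewrite [leRHS](_ : _ = M * s / t * cabs h ^+ 2 * (2 * (1 - s * t)^-1 ^+ 3)); last by rewrite /K; ring.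
  rewrite ler_wpM2l ?geo_sum2_le ?st0//.
  by rewrite !mulr_ge0 ?exprn_ge0 ?cabs_ge0 ?invr_ge0// ltW.
rewrite expr2 mulrA ler_wpM2r ?cabs_ge0//.
move: he; rewrite ltr_pdivlMr ?ltr_wpDl// => /ltW; apply: le_trans.
by rewrite mulrC ler_wpM2l ?cabs_ge0// lerDl.
Qed.

End ComplexSeries.

(** * Taylor expansion from Cauchy's theorem on circles *)

Section Taylor.
Context {R : realType}.
Implicit Types (f q : R[i] -> R[i]) (z w : R[i]) (r rho : R).
Local Notation tau := (pi *+ 2 : R).

Lemma pow_small (x e : R) : 0 <= x < 1 -> 0 < e ->
  exists N, forall n, (N <= n)%N -> x ^+ n < e.
Proof.
move=> /andP[x0 x1] e0.
have : (fun n => x ^+ n) @ \oo --> (0 : R) by apply: cvg_expr; rewrite ger0_norm.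
move/cvgrPdist_lt => /(_ _ e0)[N _ HN]; exists N => n /HN /=.
by rewrite sub0r normrN ger0_norm// exprn_ge0.
Qed.

Let tau_neq0 : tau != 0. Proof. by rewrite lt0r_neq0// mulrn_wgt0// pi_gt0. Qed.
Let ctau_neq0 : tau%:C != 0 :> R[i]. Proof. by rewrite Rc_eq0. Qed.

Lemma cabs_neq0 z (r : R) : cabs z = r -> 0 < r -> z != 0.
Proof. by move=> <-; rewrite cabs_gt0. Qed.

Lemma cdiff_Vn z n : z != 0 -> cdiff (fun w => (w^-1) ^+ n) z.
Proof. by move=> z0; apply: cdiffX; apply: cdiffV => //; exact: cdiff_id. Qed.

Lemma eq_half_pow (K : R[i]) n : K = 2^-1 ^+ n.+1 * K -> K = 0.
Proof.
move=> /(congr1 cabs); rewrite cabsM cabsX cabsV cabs_nat => H.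
apply/eqP; rewrite -cabs_eq0; apply/eqP.
have : 2^-1 ^+ n.+1 < 1 :> R by rewrite exprn_ilt1// invf_lt1// ltr1n.
move: (cabs K) (2^-1 ^+ n.+1) H => k x H x1.
have /eqP : k * (1 - x) = 0 by rewrite mulrBr mulr1 [k * x]mulrC -H subrr.
by rewrite mulf_eq0 [1 - x == 0]subr_eq0 (gt_eqF x1) orbF => /eqP.
Qed.

(** For a positive exponent [m], the mean over the radius [2 rho] equals the one over [rho], but by
    homogeneity is [2^-m] times it; so both vanish. *)
Lemma cmean_Vn rho n : 0 < rho -> cmean rho (fun w => (w^-1) ^+ n) = (n == 0)%:R * tau%:C :> R[i].
Proof.
move=> r0; case: n => [|n]; first by rewrite cmean_cst.
rewrite mul0r; set K := cmean _ _.
have c2 : cmean (2 * rho) (fun w : R[i] => (w^-1) ^+ n.+1) = K.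
  apply: (@cmean_const _ _ (3 * rho)); rewrite ?r0//=; try lra.
  - by move=> z /andP[z0 _]; apply: cdiff_cont; apply: cdiff_Vn; rewrite -cabs_gt0.
  - by move=> z /andP[z0 _] _; apply: cdiff_Vn; rewrite -cabs_gt0.
have : cmean (2 * rho) (fun w => (w^-1) ^+ n.+1) = (2^-1) ^+ n.+1 * K.
  have cq z : cabs z = rho -> ccont (fun w : R[i] => (w^-1) ^+ n.+1) z.
    by move=> zr; apply: cdiff_cont; apply: cdiff_Vn; apply: cabs_neq0 zr r0.
  apply: etrans (cmeanZ (2^-1 ^+ n.+1) r0 cq).
  apply: eq_ci => t _; rewrite /circ RcM -mulrA invfM exprMn.
  by congr (_ ^-1 ^+ _ * _); rewrite -(rmorph_nat (real_complex R)).
by rewrite c2; exact: eq_half_pow.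
Qed.

Section Expansion.
Variables (f : R[i] -> R[i]) (r : R).
Hypotheses (r0 : 0 < r) (df : forall z, cabs z < r -> cdiff f z).

Definition taylor_coef n : R[i] := tau%:C^-1 * cmean (r / 2) (fun w => f w * w^-1 ^+ n).

Let half_r : 0 < r / 2 < r.
Proof. by rewrite divr_gt0//= ltr_pdivrMr// ltr_pMr// ltr1n. Qed.

Let cdiff_fVn z n : 0 < cabs z < r -> cdiff (fun w => f w * w^-1 ^+ n) z.
Proof.
move=> /andP[z0 zr]; apply: cdiffM; first exact: df.
by apply: cdiff_Vn; rewrite -cabs_gt0.
Qed.

Lemma taylor_coefE rho n : 0 < rho < r ->
  cmean rho (fun w => f w * w^-1 ^+ n) = tau%:C * taylor_coef n.
Proof.
move=> rr; rewrite /taylor_coef mulrA divff// mul1r.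
apply: (cmean_const half_r) => // z zr; first exact: cdiff_cont (cdiff_fVn _ zr).
by move=> _; exact: cdiff_fVn.
Qed.

Lemma taylor_coef_le rho (B : R) n : 0 < rho < r ->
  (forall z, cabs z = rho -> cabs (f z) <= B) -> cabs (taylor_coef n) * rho ^+ n <= 2 * B.
Proof.
move=> rr fB; have /andP[rho0 rhor] := rr.
have tau0 : 0 < tau by rewrite mulrn_wgt0// pi_gt0.
have : cabs (cmean rho (fun w => f w * w^-1 ^+ n)) <= 2 * (B * rho^-1 ^+ n) * tau.
  apply: cmean_le => // z zr.
    by apply: cdiff_cont; apply: cdiff_fVn; rewrite zr.
  by rewrite cabsM cabsX cabsV zr ler_wpM2r ?exprn_ge0 ?invr_ge0 ?(ltW rho0)// fB.
rewrite taylor_coefE// cabsM cabsR gtr0_norm// mulrC ler_pM2r//.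
rewrite exprVn mulrA ler_pdivlMr ?exprn_gt0//.
Qed.

Lemma bounded_circle rho q : 0 < rho -> (forall z, cabs z = rho -> ccont q z) ->
  exists2 B : R, 0 <= B & forall t, 0 <= t <= tau -> cabs (q (circ rho t)) <= B.
Proof.
move=> rho0 cq.
have [_ _ [B HB]] := @rcont_bmeas R 0 tau _ (fun t _ => rcont_circle rho0 cq t).
exists `|B| => // t tt; rewrite (le_trans _ (ler_norm _))// HB//= in_itv /=; exact: tt.
Qed.

Lemma cmean_le_itv rho q (B : R) : 0 < rho -> (forall z, cabs z = rho -> ccont q z) ->
  (forall t, 0 <= t <= tau -> cabs (q (circ rho t)) <= B) -> cabs (cmean rho q) <= 2 * B * tau.
Proof.
move=> rho0 cq qB; have tau0 : 0 <= tau by rewrite mulrn_wge0// pi_ge0.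
have := @ci_le R 0 tau (fun t => q (circ rho t)) B tau0.
by rewrite subr0; apply => // t _; exact: rcont_circle.
Qed.

(** Let [phi] be the slope of [f] at [z] and [A n] the mean of [phi w * w * w^-n]. That [A 0 = 0] is
    Cauchy's formula, and the recursion [AS] unrolls it into the Taylor sum with remainder
    [z^(N+1) A (N+1)], of order [(|z| / rho)^N] on a circle with [|z| < rho]. *)
Lemma taylor_csum z : cabs z < r -> csum (fun n => taylor_coef n * z ^+ n) (f z).
Proof.
move=> zr; have [D /cderivP[phi [cphi phiz Hphi]]] := df zr.
have tau0 : 0 < tau by rewrite mulrn_wgt0// pi_gt0.
have phiE w : w != z -> phi w = (f w - f z) / (w - z).
  by move=> wz; rewrite Hphi mulfK// subr_eq0.
have dphi w : cabs w < r -> w != z -> cdiff phi w.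
  move=> wr wz; have d0 : 0 < cabs (w - z) by rewrite cabs_gt0 subr_eq0.
  apply: (cdiff_near d0 (f := fun w => (f w - f z) * (w - z)^-1)) => [v vw|].
    rewrite phiE//; apply: contraTneq vw => ->.
    by rewrite -leNgt cabs_distC.
  apply: cdiffM; first by apply: cdiffD; [exact: df|exact: cdiff_cst].
  by apply: cdiffV; [rewrite subr_eq0|apply: cdiffD; [exact: cdiff_id|exact: cdiff_cst]].
have cphi' w : cabs w < r -> ccont phi w.
  by move=> wr; have [->|wz] := eqVneq w z; [exact: cphi|exact: cdiff_cont (dphi _ wr wz)].
pose q w := phi w * w.
have cq w : cabs w < r -> ccont q w by move=> wr; apply: ccontM; [exact: cphi'|exact: ccont_id].
pose rho := (cabs z + r) / 2.
have rho0 : 0 < rho by have := cabs_ge0 z; rewrite /rho; lra.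
have rhor : rho < r by rewrite /rho; lra.
have zrho : cabs z < rho by rewrite /rho; lra.
pose A n := cmean rho (fun w => q w * w^-1 ^+ n).
have A0 : A 0%N = 0.
  have -> : A 0%N = cmean rho q by apply: eq_ci => t _; rewrite expr0 mulr1.
  (* [q] may fail to be differentiable only at [z], so the exceptional circle passes through [z]; if
     [z = 0], it lies outside the punctured disc and any circle will do. *)
  pose rho' := if z == 0 then r / 2 else cabs z.
  apply: (@cmean_vanish _ q r rho') => //.
  - by rewrite /rho'; case: ifPn => [_|z0]; [exact: half_r|rewrite cabs_gt0 z0].
  - by apply: cq; rewrite cabs0.
  - by rewrite /q mulr0.
  - by move=> w /andP[_]; exact: cq.
  - move=> w /andP[w0 wr]; rewrite /rho' => H; apply: cdiffM; last exact: cdiff_id.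
    apply: dphi => //; move: H; case: ifPn => [/eqP -> _|z0]; first by rewrite -cabs_gt0.
    by apply: contraNneq => ->.
  - by rewrite rho0.
have crho w n : cabs w = rho -> ccont (fun w => w^-1 ^+ n) w.
  by move=> wr; apply: cdiff_cont; apply: cdiff_Vn; exact: cabs_neq0 wr rho0.
have cqn w n : cabs w = rho -> ccont (fun w => q w * w^-1 ^+ n) w.
  by move=> wr; apply: ccontM; [apply: cq; rewrite wr|exact: crho].
have cfn w n : cabs w = rho -> ccont (fun w => f w * w^-1 ^+ n) w.
  by move=> wr; apply: cdiff_cont; apply: cdiff_fVn; rewrite wr rho0.
(* From [phi w * w = f w - f z + z * phi w], multiplied by [w^-n]. *)
have AS n : A n = tau%:C * taylor_coef n - f z * ((n == 0%N)%:R * tau%:C) + z * A n.+1.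
  have H1 w : cabs w = rho -> ccont (fun w => - f z * w^-1 ^+ n) w.
    by move=> wr; apply: ccontM; [exact: ccont_cst|exact: crho].
  have H2 w : cabs w = rho -> ccont (fun w => f w * w^-1 ^+ n + - f z * w^-1 ^+ n) w.
    by move=> wr; apply: ccontD; [exact: cfn|exact: H1].
  have H3 w : cabs w = rho -> ccont (fun w => z * (q w * w^-1 ^+ n.+1)) w.
    by move=> wr; apply: ccontM; [exact: ccont_cst|exact: cqn].
  have E := cmeanD rho0 H2 H3.
  rewrite (cmeanD rho0 (cfn^~ n) H1) in E.
  rewrite (cmeanZ (- f z) rho0 (crho^~ n)) (cmeanZ z rho0 (cqn^~ n.+1)) in E.
  rewrite cmean_Vn// (taylor_coefE n (rho := rho)) ?rho0// in E.
  rewrite -mulNr -E; apply: eq_cmean => // w wr.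
  have w0 := cabs_neq0 wr rho0.
  rewrite /q -mulrDl Hphi exprS; field.
  by rewrite w0.
have S N : tau%:C * (\sum_(n < N.+1) taylor_coef n * z ^+ n - f z) = - (z ^+ N.+1 * A N.+1).
  elim: N => [|N IH].
    rewrite big_ord1 /= !expr0 mulr1 expr1; apply/eqP; rewrite -addr_eq0; apply/eqP.
    by have := AS 0%N; rewrite A0 eqxx /= mul1r => E; rewrite [RHS]E; ring.
  by rewrite big_ord_recr /= addrAC mulrDr IH [A N.+1]AS /= mul0r mulr0 subr0 !exprS; ring.
have [B B0 HB] := bounded_circle rho0 (fun w wr => cq w ltac:(by rewrite wr)).
have ANB n : cabs (A n) <= 2 * (B * rho^-1 ^+ n) * tau.
  apply: cmean_le_itv => // [w wr|t tt]; first exact: cqn.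
  rewrite cabsM cabsX cabsV cabs_circ0// ler_wpM2r ?exprn_ge0 ?invr_ge0 ?(ltW rho0)//.
  exact: HB.
have SB N : cabs (\sum_(n < N.+1) taylor_coef n * z ^+ n - f z) <= 2 * B * (cabs z / rho) ^+ N.+1.
  have := ANB N.+1; move/(ler_wpM2l (exprn_ge0 N.+1 (cabs_ge0 z))).
  rewrite -cabsX -cabsM -cabsN -S cabsM cabsR gtr0_norm//.
  move=> H; rewrite -(ler_pM2l tau0); apply: (le_trans H).
  by rewrite cabsX exprMn le_eqVlt; apply/orP; left; apply/eqP; ring.
move=> e e0.
have [N HN] := @pow_small (cabs z / rho) (e / (2 * B + 1))
  ltac:(by rewrite divr_ge0 ?cabs_ge0 ?(ltW rho0)//= ltr_pdivrMr// mul1r)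
  ltac:(by rewrite divr_gt0// ltr_wpDl// mulr_ge0).
exists N.+1 => -[//|n] nN; apply: le_lt_trans (SB n) _.
have := HN n.+1 (ltnW nN); rewrite ltr_pdivlMr ?ltr_wpDl ?mulr_ge0//.
apply: le_lt_trans; rewrite mulrC ler_wpM2l ?lerDl//.
by rewrite exprn_ge0// divr_ge0 ?cabs_ge0// ltW.
Qed.

Lemma taylor_cbound rho : 0 < rho < r -> exists M, cbound taylor_coef M rho^-1.
Proof.
move=> rr; have /andP[rho0 rhor] := rr.
have tau0 : 0 < tau by rewrite mulrn_wgt0// pi_gt0.
have cf w : cabs w = rho -> ccont f w.
  by move=> wr; apply: cdiff_cont; apply: df; rewrite wr.
have [B B0 HB] := bounded_circle rho0 cf.
exists (2 * B); split; rewrite ?mulr_ge0 ?invr_ge0 ?(ltW rho0)// => n.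
have : cabs (cmean rho (fun w => f w * w^-1 ^+ n)) <= 2 * (B * rho^-1 ^+ n) * tau.
  apply: cmean_le_itv => // [z zr|t tt].
    by apply: cdiff_cont; apply: cdiff_fVn; rewrite zr.
  rewrite cabsM cabsX cabsV cabs_circ0// ler_wpM2r ?exprn_ge0 ?invr_ge0 ?(ltW rho0)//.
  exact: HB.
by rewrite taylor_coefE// cabsM cabsR gtr0_norm// mulrC ler_pM2r// mulrA.
Qed.

End Expansion.
End Taylor.

(** * The identity theorem along segments, and division by powers of z *)

Section Identity.
Context {R : realType}.
Implicit Types (f : R[i] -> R[i]) (p q v z w : R[i]) (r t : R).

Lemma cbound_half c M s z N l : cbound c M s -> s * cabs z <= 2^-1 ->
  csum (fun n => c n * z ^+ n) l ->
  cabs (l - \sum_(k < N) c k * z ^+ k) <= 2 * M * (s * cabs z) ^+ N.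
Proof.
move=> cb sz Hl; have [M0 s0 _] := cb.
have sz1 : s * cabs z < 1 by rewrite (le_lt_trans sz)// invf_lt1// ltr1n.
have [_ /(_ N)] := cbound_csum cb sz1; rewrite (psumE Hl) => /le_trans; apply.
rewrite ler_pdivrMr ?subr_gt0// -[2 * M * _]mulrA.
have : 0 <= M * (s * cabs z) ^+ N by rewrite mulr_ge0// exprn_ge0// mulr_ge0// cabs_ge0.
move: (M * _) => x x0; nra.
Qed.

Lemma cdiff_shift f p z : cdiff f (p + z) -> cdiff (fun w => f (p + w)) z.
Proof.
move=> H; apply: (@cdiff_comp R (fun w => p + w) f) => //.
by apply: cdiffD; [exact: cdiff_cst|exact: cdiff_id].
Qed.

(** All Taylor coefficients at [p] vanish, by strong induction: on the segment of zeros the first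
    remaining term [c n * w^n] is compensated by a remainder of order [|w|^(n+1)], so that [|c n|]
    is at most a multiple of [t], which is arbitrarily small. *)
Lemma isolated_zero f p v r t0 : 0 < r -> (forall z, cabs (z - p) < r -> cdiff f z) ->
  v != 0 -> 0 < t0 -> (forall t, 0 < t < t0 -> f (p + t%:C * v) = 0) ->
  forall z, cabs (z - p) < r -> f z = 0.
Proof.
move=> r0 df v0 t00 fz z zr.
pose g w := f (p + w).
have dg w : cabs w < r -> cdiff g w.
  by move=> wr; apply: cdiff_shift; apply: df; rewrite addrAC subrr add0r.
have [M cb] := taylor_cbound r0 dg (rho := r / 2) ltac:(by rewrite divr_gt0//= ltr_pdivrMr// ltr_pMr// ltr1n).
have [M0 s0 _] := cb; set s := (r / 2)^-1 in cb s0.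
have spos : 0 < s by rewrite invr_gt0 divr_gt0.
have c0 n : taylor_coef g r n = 0.
  elim/ltn_ind: n => n IH.
  apply/eqP; rewrite -cabs_eq0 eq_le cabs_ge0 andbT; apply/ler_addgt0Pr => e e0; rewrite add0r.
  have vpos : 0 < cabs v by rewrite cabs_gt0.
  pose K := 2 * M * s ^+ n.+1.
  have K0 : 0 <= K by rewrite !mulr_ge0 ?exprn_ge0.
  have den : 0 < K * cabs v + 1 by rewrite ltr_wpDl// mulr_ge0 ?(ltW vpos).
  (* In turn: [w] lies on the segment of zeros, [cbound_half] applies, [w] lies in the disc, and the
     resulting bound for [|c n|] is at most [e]. *)
  pose t := Num.min (t0 / 2) (Num.min (2^-1 / (s * cabs v)) (Num.min (r / 2 / cabs v) (e / (K * cabs v + 1)))).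
  have t_gt0 : 0 < t by rewrite !lt_min !divr_gt0// ?invr_gt0// ?mulr_gt0.
  have tt0 : t <= t0 / 2 by rewrite ge_min lexx.
  have ts : t * (s * cabs v) <= 2^-1.
    by rewrite -ler_pdivlMr ?mulr_gt0// !ge_min lexx !orbT.
  have tr : t * cabs v <= r / 2 by rewrite -ler_pdivlMr// !ge_min lexx !orbT.
  have te : t * (K * cabs v + 1) <= e by rewrite -ler_pdivlMr// !ge_min lexx !orbT.
  pose w := t%:C * v.
  have wE : cabs w = t * cabs v by rewrite cabsM cabsR gtr0_norm.
  have wpos : 0 < cabs w by rewrite wE mulr_gt0.
  have Hw := taylor_csum r0 dg (z := w) ltac:(by rewrite wE; lra).
  have := @cbound_half _ _ s w n.+1 _ cb ltac:(by rewrite wE mulrCA) Hw.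
  rewrite {1}/g fz ?t_gt0/=; last by lra.
  rewrite big_ord_recr /= big1 ?add0r; last by move=> k _; rewrite IH ?mul0r.
  rewrite cabsN cabsM cabsX exprMn mulrA -/K exprS mulrA ler_pM2r ?exprn_gt0//.
  move=> /le_trans; apply; apply: le_trans te.
  by rewrite wE mulrCA ler_wpM2l ?(ltW t_gt0)// lerDl.
have := taylor_csum r0 dg zr; rewrite /g [p + _]addrC subrK => H.
apply: (csum_unique H) => e e0; exists 0%N => n _.
by rewrite big1 ?subrr ?cabs0// => k _; rewrite c0 mul0r.
Qed.

(** Let [T] be the supremum of the parameters up to which [f] vanishes; [isolated_zero], applied
    backwards from the point of parameter [T], makes [f] vanish on a whole disc around it, so that
    [T] cannot be less than 1. *)
Lemma segment_zero f p q t0 : 0 < t0 ->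
  (forall t, 0 <= t <= 1 -> exists2 r, 0 < r &
     forall z, cabs (z - (p + t%:C * (q - p))) < r -> cdiff f z) ->
  (forall t, 0 < t < t0 -> f (p + t%:C * (q - p)) = 0) -> f q = 0.
Proof.
move=> t00 df fz.
pose g t := p + t%:C * (q - p).
have g1 : g 1 = q by rewrite /g mul1r addrC subrK.
have [pq|pq] := eqVneq q p.
  have := fz (t0 / 2) ltac:(by rewrite divr_gt0//= ltr_pdivrMr// ltr_pMr// ltr1n).
  by rewrite pq subrr mulr0 addr0.
have v0 : q - p != 0 by rewrite subr_eq0.
pose S := [set t : R | 0 <= t <= 1 /\ forall s, 0 < s <= t -> f (g s) = 0].
have S0 : S 0 by split; rewrite ?lexx ?ler01// => s /andP[s0]; rewrite leNgt s0.
have Sub : ubound S 1 by move=> t [/andP[_ ->]].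
have hS : has_sup S by split; [exists 0|exists 1].
set T := sup S.
have T1 : T <= 1 by apply: ge_sup => //; exists 0.
have Tle t : S t -> t <= T by move=> St; apply: ub_le_sup => //; exists 1.
have T0 : 0 < T.
  have St : S (Num.min 1 (t0 / 2)).
    split; first by rewrite le_min ler01 ge_min lexx /= divr_ge0// ltW.
    move=> s /andP[s0]; rewrite le_min => /andP[s1 st]; apply: fz; rewrite s0 /=; lra.
  by apply: lt_le_trans (Tle _ St); rewrite lt_min ltr01 divr_gt0.
have belowT s : 0 < s < T -> f (g s) = 0.
  move=> /andP[s0 sT]; have [t [_ Ht] st] := sup_adherent (eps := T - s) ltac:(by rewrite subr_gt0) hS.
  by apply: Ht; rewrite s0 /= ltW//; move: st; rewrite -/T; lra.
have [r r0 Hr] := df T ltac:(by rewrite ltW).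
have zr : forall z, cabs (z - g T) < r -> f z = 0.
  apply: (@isolated_zero f (g T) (- (q - p)) r T r0 Hr) => //; first by rewrite oppr_eq0.
  move=> t /andP[t0' tT]; have -> : g T + t%:C * - (q - p) = g (T - t).
    by rewrite /g rmorphB /=; ring.
  by apply: belowT; rewrite subr_gt0 tT /= ltrBlDr ltrDl.
have vpos : 0 < cabs (q - p) by rewrite cabs_gt0.
have gd s t : cabs (g s - g t) = `|s - t| * cabs (q - p).
  have -> : g s - g t = (s - t)%:C * (q - p) by rewrite /g rmorphB /=; ring.
  by rewrite cabsM cabsR.
have [TT|TT] := ltP T 1; last first.
  have Te : T = 1 by apply/eqP; rewrite eq_le T1.
  by rewrite -g1; apply: zr; rewrite Te gd subrr normr0 mul0r.
pose d := Num.min (1 - T) (r / 2 / cabs (q - p)).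
have d0 : 0 < d by rewrite lt_min subr_gt0 TT !divr_gt0.
have : S (T + d).
  split.
    apply/andP; split; first by rewrite addr_ge0// ltW.
    by rewrite -lerBrDl ge_min lexx.
  move=> s /andP[s0 sTd]; have [sT|sT] := ltP s T; first by apply: belowT; rewrite s0.
  apply: zr; rewrite gd ger0_norm ?subr_ge0//.
  apply: (@le_lt_trans _ _ (d * cabs (q - p))).
    by rewrite ler_wpM2r ?cabs_ge0// lerBlDl.
  apply: (@le_lt_trans _ _ (r / 2)); first by rewrite -ler_pdivlMr// ge_min lexx orbT.
  by rewrite ltr_pdivrMr// ltr_pMr// ltr1n.
by move/Tle; rewrite gerDl leNgt d0.
Qed.

(** The coefficients of [k] are those of [f] shifted by two. If [f 0 = 0] and the linear coefficient
    is 1, then [1 / f - 1 / z = - k / (1 + z k)], in which the pole at 0 has disappeared. *)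
Lemma taylor_quot f r : 0 < r -> (forall z, cabs z < r -> cdiff f z) ->
  exists k, (forall z, cabs z < r -> cdiff k z) /\
    forall z, cabs z < r -> f z = f 0 + taylor_coef f r 1 * z + z ^+ 2 * k z.
Proof.
move=> r0 df; pose c := taylor_coef f r.
have cb rho : 0 < rho < r -> exists M, cbound c M rho^-1 := taylor_cbound r0 df (rho := rho).
pose c2 n := c n.+2.
have cb2 rho : 0 < rho < r -> exists M, cbound c2 M rho^-1.
  move=> /cb[M [M0 s0 H]]; exists (M * rho^-1 ^+ 2); split=> //.
    by rewrite mulr_ge0// exprn_ge0.
  by move=> n; rewrite (le_trans (H _))// -mulrA -exprD add2n.
have rho_ex z : cabs z < r -> exists2 rho, 0 < rho < r & rho^-1 * cabs z < 1.
  move=> zr; exists ((cabs z + r) / 2); first by have := cabs_ge0 z; lra.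
  by rewrite mulrC ltr_pdivrMr; have := cabs_ge0 z; lra.
have c0 : f 0 = c 0%N.
  have := taylor_csum r0 df (z := 0) ltac:(by rewrite cabs0) => H.
  apply: (csum_unique H) => e e0; exists 1%N => -[//|n] _.
  by rewrite big_ord_recl /= expr0 mulr1 big1 ?addr0 ?subrr ?cabs0// => i _; rewrite exprS mul0r mulr0.
exists (psum c2); split => z zr.
  have [rho /cb2[M cM] rz] := rho_ex _ zr; eexists; exact: psum_deriv cM rz.
have [rho /cb2[M cM] rz] := rho_ex _ zr.
have [H _] := cbound_csum cM rz.
have := csum_shift 2 (taylor_csum r0 df zr).
have E : csum (fun k => c (2 + k)%N * z ^+ (2 + k)) (z ^+ 2 * psum c2 z).
  apply: eq_csum (csumZ (z ^+ 2) H) => k; rewrite add2n /c2 !exprS; ring.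
move=> /(csum_unique E) ->; rewrite c0 !big_ord_recr big_ord0 /= expr0 expr1 -/c; ring.
Qed.

Lemma taylor_coef1 g r : 0 < r -> (forall z, cabs z < r -> cdiff g z) ->
  g 0 = 0 -> cderiv g 0 1 -> taylor_coef g r 1 = 1.
Proof.
move=> r0 dg g0 g1; have [k [dk gk]] := taylor_quot r0 dg.
set c1 := taylor_coef g r 1 in gk *.
apply/eqP; rewrite -subr_eq0 -cabs_eq0 eq_le cabs_ge0 andbT; apply/ler_addgt0Pr => e e0; rewrite add0r.
have e2 : 0 < e / 2 by rewrite divr_gt0.
have [d d0 Hd] := g1 _ e2.
have [d' d'0 Hd'] := cdiff_cont (dk 0 ltac:(by rewrite cabs0)) ltr01.
pose K := cabs (k 0) + 1.
have K0 : 0 < K by rewrite ltr_wpDl// cabs_ge0.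
pose t := Num.min (r / 2) (Num.min (d / 2) (Num.min (d' / 2) (e / 2 / K))).
have t0 : 0 < t by rewrite !lt_min !divr_gt0.
have tr : t <= r / 2 by rewrite ge_min lexx.
have td : t <= d / 2 by rewrite !ge_min lexx !orbT.
have td' : t <= d' / 2 by rewrite !ge_min lexx !orbT.
have tK : t * K <= e / 2 by rewrite -ler_pdivlMr// !ge_min lexx !orbT.
have tt : cabs (t%:C : R[i]) = t by rewrite cabsR gtr0_norm.
have t1 : cabs (t%:C : R[i]) < d by rewrite tt; lra.
have t2 : cabs (t%:C : R[i]) < r by rewrite tt; lra.
have := Hd _ t1; rewrite add0r gk// g0 subr0 add0r.
have -> : c1 * t%:C + t%:C ^+ 2 * k t%:C - 1 * t%:C = t%:C * ((c1 - 1) + t%:C * k t%:C) by ring.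
rewrite cabsM mulrC tt ler_pM2r// => H.
have kb : cabs (k t%:C) <= K.
  have := Hd' t%:C; rewrite subr0 tt => /(_ ltac:(lra)).
  have := cabsB_ge (k t%:C) (k 0); rewrite /K; lra.
have -> : c1 - 1 = (c1 - 1 + t%:C * k t%:C) - t%:C * k t%:C by ring.
rewrite (le_trans (cabsB _ _))// (splitr e) lerD// cabsM tt (le_trans _ tK)//.
by rewrite ler_wpM2l// ltW.
Qed.

End Identity.

(** * Local inverses *)

Section LocalInverse.
Context {R : realType}.
Implicit Types (f g h k : R[i] -> R[i]) (z w u : R[i]) (r : R).

Lemma cdiff_on_disc r f : analytic_on (disc r) f <-> forall z, cabs z < r -> cdiff f z.
Proof. by split=> H z zr; apply/derivable_cderiv; exact: H. Qed.

Lemma reciprocal_continuation g r : 0 < r -> (forall z, cabs z < r -> cdiff g z) ->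
  g 0 = 0 -> cderiv g 0 1 -> (forall z, cabs z < r -> z != 0 -> g z != 0) ->
  exists h, (forall z, cabs z < r -> cdiff h z) /\
    forall z, cabs z < r -> z != 0 -> h z = (g z)^-1 - z^-1.
Proof.
move=> r0 dg g0 g1 gn0.
have [k [dk gk]] := taylor_quot r0 dg.
have c11 := taylor_coef1 r0 dg g0 g1.
have gE z : cabs z < r -> g z = z * (1 + z * k z).
  by move=> zr; rewrite gk// g0 c11; ring.
have n0 z : cabs z < r -> 1 + z * k z != 0.
  move=> zr; have [->|z0] := eqVneq z 0; first by rewrite mul0r addr0 oner_neq0.
  by have := gn0 _ zr z0; rewrite gE// mulf_eq0 negb_or => /andP[].
exists (fun z => - k z * (1 + z * k z)^-1); split => z zr.
  apply: cdiffM; first exact: cdiffN (dk _ zr).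
  apply: cdiffV; first exact: n0.
  apply: cdiffD; first exact: cdiff_cst.
  by apply: cdiffM; [exact: cdiff_id|exact: dk].
move=> z0; rewrite gE//; have := n0 _ zr => nz; field.
by rewrite nz z0.
Qed.

(** If [h] is [1 / g - 1 / z], then [z / (1 + z h)] is [g]: this is the way back from
    [reciprocal_continuation]. *)
Lemma reciprocal_transform_cdiff h z : cdiff h z -> 1 + z * h z != 0 ->
  cdiff (fun w => w * (1 + w * h w)^-1) z.
Proof.
move=> dh n0; apply: cdiffM; first exact: cdiff_id.
apply: cdiffV => //; apply: cdiffD; first exact: cdiff_cst.
by apply: cdiffM; [exact: cdiff_id|].
Qed.

Lemma reciprocal_transform_deriv0 h : cdiff h 0 ->
  cderiv (fun w => w * (1 + w * h w)^-1) 0 1.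
Proof.
move=> [D dh]; have n0 : 1 + 0 * h 0 != 0 by rewrite mul0r addr0 oner_neq0.
have d1 := cderivM (cderiv_id 0) dh.
have d2 := cderivD (cderiv_cst 1 0) d1.
have d3 := cderivM (cderiv_id 0) (@cderivV _ (fun w => 1 + w * h w) 0 _ n0 d2).
by move: d3; rewrite /= !mul0r !addr0 invr1 mul1r.
Qed.

Lemma near_nonzero_mul h r : 0 < r -> (forall z, cabs z < r -> cdiff h z) ->
  exists2 d, 0 < d <= r & forall z, cabs z < d -> 1 + z * h z != 0.
Proof.
move=> r0 dh.
have c : ccont (fun z => 1 + z * h z) 0.
  apply: cdiff_cont; apply: cdiffD; first exact: cdiff_cst.
  by apply: cdiffM; [exact: cdiff_id|apply: dh; rewrite cabs0].
have [d d0 Hd] := c _ ltr01.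
exists (Num.min d r); first by rewrite lt_min d0 r0 ge_min lexx orbT.
move=> z; rewrite lt_min => /andP[zd _]; have := Hd z; rewrite subr0 => /(_ zd).
by rewrite mul0r addr0; apply: contraTneq => ->; rewrite sub0r cabsN cabs1 ltxx.
Qed.

Lemma near_nonzero g : g 0 = 0 -> cderiv g 0 1 ->
  exists2 d, 0 < d & forall z, cabs z < d -> z != 0 -> g z != 0.
Proof.
move=> g0 g1; have [d d0 Hd] := g1 (2^-1) ltac:(by rewrite invr_gt0).
exists d => // z zd z0; apply: contraTneq (Hd _ zd) => gz.
rewrite add0r gz g0 subrr sub0r mul1r cabsN -ltNge gtr_pMl ?cabs_gt0//.
by rewrite invf_lt1// ltr1n.
Qed.

(** [f] minus the identity is 1/2-Lipschitz. Hence [f] is injective, and [f z = u] is solved by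
    iterating [z - f z + u]. *)
Definition contracts f (e : R) := forall z w, cabs z <= e -> cabs w <= e ->
  cabs (f z - f w - (z - w)) <= 2^-1 * cabs (z - w).

Lemma exprB_le z w (t : R) n : cabs z <= t -> cabs w <= t ->
  cabs (z ^+ n.+1 - w ^+ n.+1) <= n.+1%:R * t ^+ n * cabs (z - w).
Proof.
move=> zt wt; have t0 : 0 <= t := le_trans (cabs_ge0 _) zt.
elim: n => [|n IH]; first by rewrite !expr1 expr0 !mul1r.
have -> : z ^+ n.+2 - w ^+ n.+2 = z * (z ^+ n.+1 - w ^+ n.+1) + w ^+ n.+1 * (z - w).
  by rewrite !exprS; ring.
apply: le_trans (cabsD _ _) _; rewrite !cabsM -[n.+2%:R]natr1.
have H1 : cabs z * cabs (z ^+ n.+1 - w ^+ n.+1) <= t * (n.+1%:R * t ^+ n * cabs (z - w)).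
  by rewrite ler_pM ?cabs_ge0.
have H2 : cabs (w ^+ n.+1) * cabs (z - w) <= t ^+ n.+1 * cabs (z - w).
  by rewrite ler_wpM2r ?cabs_ge0// cabsX lerXn2r// nnegrE cabs_ge0.
apply: le_trans (lerD H1 H2) _; rewrite le_eqVlt; apply/orP; left; apply/eqP.
by rewrite exprS; ring.
Qed.

Lemma contracts_near f r : 0 < r -> (forall z, cabs z < r -> cdiff f z) ->
  f 0 = 0 -> cderiv f 0 1 -> exists2 e, 0 < e < r & contracts f e.
Proof.
move=> r0 df f0 f1.
have [M cb] := taylor_cbound r0 df (rho := r / 2) ltac:(by rewrite divr_gt0//= ltr_pdivrMr// ltr_pMr// ltr1n).
have c11 := taylor_coef1 r0 df f0 f1.
set c := taylor_coef f r in cb c11; set s := (r / 2)^-1 in cb.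
have [M0 s0 cM] := cb; have spos : 0 < s by rewrite invr_gt0 divr_gt0.
(* The first bound gives [(1 - s e)^-2 <= 4], the second [8 M s^2 e <= 1/2]; together they bound the
   Lipschitz constant of the nonlinear part by 1/2. *)
pose e := Num.min (2^-1 / s) ((16 * (M * s ^+ 2 + 1))^-1).
have Ms0 : 0 <= M * s ^+ 2 by rewrite mulr_ge0 ?exprn_ge0.
have e0 : 0 < e by rewrite lt_min divr_gt0// ?invr_gt0// mulr_gt0// ltr_wpDl.
have se : s * e <= 2^-1 by rewrite mulrC -ler_pdivlMr// ge_min lexx.
have e16 : e * (16 * (M * s ^+ 2 + 1)) <= 1.
  by rewrite -ler_pdivlMr ?mul1r ?ge_min ?lexx ?orbT// mulr_gt0// ltr_wpDl.
have er : e < r.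
  have : s * r = 2 by rewrite /s invfM invrK mulrAC mulVf ?mul1r// gt_eqF.
  by move=> sr; rewrite -(ltr_pM2l spos) sr; lra.
exists e; first by rewrite e0.
move=> z w ze we.
have zr : cabs z < r by rewrite (le_lt_trans ze).
have wr : cabs w < r by rewrite (le_lt_trans we).
have H := csum_shift 2 (csumD (taylor_csum r0 df zr) (csumZ (-1) (taylor_csum r0 df wr))).
have {}H : csum (fun n => c n.+2 * (z ^+ n.+2 - w ^+ n.+2)) (f z - f w - (z - w)).
  move: H; rewrite !big_ord_recr big_ord0 /= -/c !expr0 !expr1 c11.
  have -> : f z + -1 * f w - (0 + (c 0%N * 1 + -1 * (c 0%N * 1)) + (1 * z + -1 * (1 * w))) =
    f z - f w - (z - w) by ring.
  by apply: eq_csum => k; rewrite add2n; ring.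
have se0 : 0 <= s * e < 1 by rewrite mulr_ge0 ?(ltW e0)//=; lra.
have inv2 : (1 - s * e)^-1 <= 2 by rewrite -[leRHS]invrK lef_pV2 ?posrE ?invr_gt0//; lra.
have bnd : 2 * M * s ^+ 2 * e * (1 - s * e)^-1 ^+ 2 <= 2^-1.
  have : (1 - s * e)^-1 ^+ 2 <= 2 ^+ 2.
    by rewrite lerXn2r// nnegrE// invr_ge0; lra.
  have : 0 <= 2 * M * s ^+ 2 * e by rewrite !mulr_ge0// ?exprn_ge0// ltW.
  move=> /ler_wpM2l X /X /le_trans; apply; lra.
apply: (csum_le H) => n.
apply: (@le_trans _ _ (2 * M * s ^+ 2 * e * cabs (z - w) * \sum_(k < n) k.+1%:R * (s * e) ^+ k)).
  rewrite mulr_sumr; apply: ler_sum => k _; rewrite cabsM.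
  have E := exprB_le k.+1 ze we.
  apply: (le_trans (ler_pM (cabs_ge0 _) (cabs_ge0 _) (cM _) E)).
  have k2 : k.+2%:R <= 2 * k.+1%:R :> R by rewrite -natrM ler_nat mul2n -addnn addSn ltnS leq_addl.
  rewrite [leLHS](_ : _ = k.+2%:R * (M * s ^+ 2 * e * cabs (z - w) * (s * e) ^+ k)); last first.
    by rewrite !exprS exprMn; ring.
  rewrite [leRHS](_ : _ = 2 * k.+1%:R * (M * s ^+ 2 * e * cabs (z - w) * (s * e) ^+ k)); last by ring.
  by rewrite ler_wpM2r// !mulr_ge0 ?exprn_ge0 ?cabs_ge0 ?(ltW e0)// mulr_ge0// ltW.
have := geo_sum1_le n se0.
have P0 : 0 <= 2 * M * s ^+ 2 * e * cabs (z - w) by rewrite !mulr_ge0 ?exprn_ge0 ?cabs_ge0// ltW.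
move=> /(ler_wpM2l P0) /le_trans; apply.
by rewrite mulrAC ler_wpM2r ?cabs_ge0.
Qed.

Lemma contracts_inj f e z w : contracts f e -> cabs z <= e -> cabs w <= e ->
  cabs (z - w) <= 2 * cabs (f z - f w).
Proof.
move=> cf ze we; have := cf _ _ ze we; rewrite cabs_distC.
have := cabsB_ge (z - w) (f z - f w); lra.
Qed.

(** Banach's iteration from 0 stays in the disc of radius [2 |u|], where it contracts; its limit is
    the sum of its increments, which are at most [|u| / 2^n]. *)
Lemma contracts_surj f e u : contracts f e -> f 0 = 0 -> cabs u < e / 2 ->
  (forall z, cabs z < e -> ccont f z) -> exists2 z, cabs z <= 2 * cabs u & f z = u.
Proof.
move=> cf f0 ue cont.
have u0 := cabs_ge0 u.
pose step z := z - f z + u.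
pose s n := iter n step 0.
have step_contr z w : cabs z <= e -> cabs w <= e -> cabs (step z - step w) <= 2^-1 * cabs (z - w).
  move=> ze we; have -> : step z - step w = - (f z - f w - (z - w)) by rewrite /step; ring.
  by rewrite cabsN cf.
have e0 : 0 <= e by lra.
have sb n : cabs (s n) <= 2 * cabs u.
  elim: n => [|n IH]; first by rewrite cabs0 mulr_ge0.
  have := step_contr (s n) 0 ltac:(lra) ltac:(by rewrite cabs0).
  rewrite subr0 => H.
  have -> : s n.+1 = (step (s n) - step 0) + u.
    by change (step (s n) = (step (s n) - step 0) + u); rewrite /step f0; ring.
  by rewrite (le_trans (cabsD _ _))//; lra.
have sd n : cabs (s n.+1 - s n) <= cabs u * 2^-1 ^+ n.
  elim: n => [|n IH].
    by rewrite [s 1%N]/(step 0) /step f0 !subr0 add0r expr0 mulr1.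
  have := step_contr (s n.+1) (s n) ltac:(have := sb n.+1; lra) ltac:(have := sb n; lra).
  move=> /le_trans; apply; rewrite exprS mulrCA ler_wpM2l ?invr_ge0//.
have half01 : 0 <= (2^-1 : R) < 1 by rewrite invr_ge0 ler0n /= invf_lt1// ltr1n.
have [l Hl] : exists l, csum (fun n => s n.+1 - s n) l.
  apply: (@csum_ex _ _ (cabs u * (1 - 2^-1)^-1)) => n.
  apply: (@le_trans _ _ (cabs u * \sum_(k < n) 2^-1 ^+ k)).
    by rewrite mulr_sumr; apply: ler_sum => k _.
  by rewrite ler_wpM2l// geo_sum_le.
have Ss n : \sum_(k < n) (s k.+1 - s k) = s n.
  elim: n => [|n IH]; first by rewrite big_ord0.
  by rewrite big_ord_recr /= IH addrC subrK.
have lb : cabs l <= 2 * cabs u.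
  apply/ler_addgt0Pr => d d0; have [N /(_ N (leqnn N))] := Hl _ d0.
  rewrite Ss => H; have := sb N; have := cabsB_ge l (s N); rewrite cabs_distC in H; lra.
exists l => //.
apply/eqP; rewrite -subr_eq0 -cabs_eq0 eq_le cabs_ge0 andbT; apply/ler_addgt0Pr => d d0; rewrite add0r.
have d2 : 0 < d / 2 by rewrite divr_gt0.
have [d' d'0 Hd'] := cont l ltac:(lra) _ d2.
have [N HN] := Hl _ d'0.
have [N' HN'] := pow_small half01 (e := d / 2 / (cabs u + 1)) ltac:(by rewrite divr_gt0// ltr_wpDl).
pose n := maxn N N'.
have A := Hd' (s n); have B := HN n (leq_maxl _ _); rewrite Ss in B.
have C := sd n; have D := HN' n (leq_maxr _ _).
have {}A := A B.
have E : cabs u * 2^-1 ^+ n < d / 2.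
  rewrite ltr_pdivlMr ?ltr_wpDl// in D; apply: le_lt_trans D.
  by rewrite mulrC ler_wpM2l ?lerDl// exprn_ge0// invr_ge0.
have -> : f l - u = - (f (s n) - f l) - (s n.+1 - s n).
  by rewrite [s n.+1]/(step (s n)) /step; ring.
rewrite (le_trans (cabsB _ _))// cabsN; lra.
Qed.

Lemma cderiv_caratheodory f z d phi (r : R) : 0 < r -> ccont phi z -> phi z = d ->
  (forall w, cabs (w - z) < r -> f w - f z = phi w * (w - z)) -> cderiv f z d.
Proof.
move=> r0 cphi <- Hphi e e0; have [r' r'0 Hr] := cphi _ e0.
exists (Num.min r r'); first by rewrite lt_min r0.
move=> h; rewrite lt_min => /andP[hr hr'].
have zh : z + h - z = h by rewrite [z + h]addrC addrK.
rewrite Hphi zh// -mulrBl cabsM ler_wpM2r ?cabs_ge0// ltW//.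
by apply: Hr; rewrite zh.
Qed.

(** On the disc of radius [e] the function is injective and covers the disc of radius [e / 2]; the
    inverse is 2-Lipschitz, hence continuous, and its slopes are the inverses of those of [f]. *)
Lemma local_inverse f r : 0 < r -> (forall z, cabs z < r -> cdiff f z) ->
  f 0 = 0 -> cderiv f 0 1 ->
  exists e d g, [/\ 0 < e < r, 0 < d & [/\ forall u, cabs u < d -> cdiff g u,
    g 0 = 0, cderiv g 0 1,
    forall u, cabs u < d -> cabs (g u) < e /\ f (g u) = u &
    forall z, cabs z < e -> cabs (f z) < d -> g (f z) = z]].
Proof.
move=> r0 df f0 f1; have [e /andP[e0 er] cf] := contracts_near r0 df f0 f1.
pose d := e / 2; have d0 : 0 < d by rewrite divr_gt0.
pose g u := xget 0 [set z | cabs z < e /\ f z = u].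
have cont z : cabs z < e -> ccont f z.
  by move=> ze; apply: cdiff_cont; apply: df; rewrite (lt_trans ze).
have gP u : cabs u < d -> cabs (g u) < e /\ f (g u) = u.
  move=> ud; have [z zu fz] := contracts_surj cf f0 ud cont.
  rewrite /g; case: xgetP => [? -> //|/(_ z)[]]; split => //.
  by rewrite (le_lt_trans zu)//; move: ud; rewrite /d; lra.
have inj z w : cabs z < e -> cabs w < e -> f z = f w -> z = w.
  move=> ze we fzw; apply/eqP; rewrite -subr_eq0 -cabs_eq0 eq_le cabs_ge0 andbT.
  by have := contracts_inj cf (ltW ze) (ltW we); rewrite fzw subrr cabs0 mulr0.
have gK z : cabs z < e -> cabs (f z) < d -> g (f z) = z.
  by move=> ze /gP[ge]; exact: inj.
have glip u v : cabs u < d -> cabs v < d -> cabs (g u - g v) <= 2 * cabs (u - v).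
  move=> /gP[gu fgu] /gP[gv fgv].
  by have := contracts_inj cf (ltW gu) (ltW gv); rewrite fgu fgv.
have dg u D : cabs u < d -> cderiv f (g u) D -> cderiv g u D^-1.
  move=> ud /cderivP[phi [cphi phiD Hphi]].
  have [gu fgu] := gP _ ud.
  have cg : ccont g u.
    move=> a a0; exists (Num.min (d - cabs u) (a / 2)).
      by rewrite lt_min subr_gt0 ud divr_gt0.
    move=> v; rewrite lt_min => /andP[v1 v2].
    have vd : cabs v < d by have := cabsB_ge v u; lra.
    by rewrite (le_lt_trans (glip _ _ vd ud))//; lra.
  have lower w : cabs w < e -> w != g u -> 2^-1 <= cabs (phi w).
    move=> we wn; have := contracts_inj cf (ltW we) (ltW gu).
    rewrite Hphi cabsM mulrA -[X in X <= _]mul1r ler_pM2r ?cabs_gt0 ?subr_eq0//; lra.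
  (* The slopes of [f] at [g u] are at least 1/2 in modulus, and they tend to [D]. *)
  have Dn0 : D != 0.
    have [b b0 Hb] := cphi (2^-1) ltac:(by rewrite invr_gt0).
    pose t := Num.min (b / 2) ((e - cabs (g u)) / 2).
    have t0 : 0 < t by rewrite lt_min !divr_gt0// subr_gt0.
    have tb : t <= b / 2 by rewrite ge_min lexx.
    have te : t <= (e - cabs (g u)) / 2 by rewrite ge_min lexx orbT.
    have tt : cabs (t%:C : R[i]) = t by rewrite cabsR gtr0_norm.
    pose w := g u + t%:C.
    have wt : w - g u = t%:C by rewrite /w addrC addKr.
    have we : cabs w < e by have := cabsD (g u) t%:C; rewrite tt -/w; lra.
    have wn : w != g u by rewrite -subr_eq0 wt Rc_eq0 gt_eqF.
    have := Hb w; rewrite wt tt phiD => /(_ ltac:(lra)).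
    by apply: contraTneq => ->; rewrite subr0 -leNgt; exact: lower.
  have r1 : 0 < d - cabs u by rewrite subr_gt0.
  apply: (@cderiv_caratheodory g u _ (fun v => (phi (g v))^-1) _ r1).
  - apply: ccontV; first by rewrite phiD.
    by apply: (ccont_comp cg).
  - by rewrite phiD.
  - move=> v vu; have vd : cabs v < d by have := cabsB_ge v u; lra.
    have [gv fgv] := gP _ vd.
    have := Hphi (g v); rewrite fgu fgv => ->.
    have [->|gn] := eqVneq (g v) (g u); first by rewrite subrr !mulr0.
    rewrite mulrA mulVf ?mul1r// -cabs_gt0.
    by apply: lt_le_trans (lower _ gv gn); rewrite invr_gt0.
exists e, d, g; split; rewrite ?e0//; split=> //.
- move=> u ud; have [D HD] := df (g u) ltac:(by have [ge _] := gP _ ud; rewrite (lt_trans ge)).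
  by exists D^-1; exact: dg.
- by rewrite -{1}f0 gK ?f0 ?cabs0.
- have g0 : g 0 = 0 by rewrite -{1}f0 gK ?f0 ?cabs0.
  by rewrite -invr1; apply: dg; rewrite ?cabs0 ?g0.
Qed.

End LocalInverse.

(** * The Cauchy transform *)

Section ParameterIntegral.
Context {R : realType} d (T : measurableType d) (m : {measure set T -> \bar R}).
Implicit Types (D E : set T).

(** A quadratic remainder that is uniform in [x] is simply integrated over a finite measure. *)
Lemma cint_deriv D (F : R[i] -> T -> R[i]) (F' : T -> R[i]) w (r K : R) :
  measurable D -> (m D < +oo)%E -> 0 < r -> 0 <= K ->
  (forall z, cabs (z - w) < r -> bmeas D (F z)) -> bmeas D F' ->
  (forall h, cabs h < r -> forall x, D x ->
     cabs (F (w + h) x - F w x - F' x * h) <= K * cabs h ^+ 2) ->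
  cderiv (fun z => cint m D (F z)) w (cint m D F').
Proof.
move=> mD Doo r0 K0 bF bF' H e e0.
pose c := 2 * K * fine (m D) + 1.
have c0 : 0 < c by rewrite ltr_wpDl// !mulr_ge0// fine_ge0.
exists (Num.min r (e / c)); first by rewrite lt_min r0 divr_gt0.
move=> h; rewrite lt_min => /andP[hr he].
have b1 : bmeas D (F (w + h)) by apply: bF; rewrite [w + h]addrC addrK.
have b2 : bmeas D (F w) by apply: bF; rewrite subrr cabs0.
have b3 : bmeas D (fun x => h * F' x) := bmeasZ h bF'.
have b12 : bmeas D (fun x => F (w + h) x - F w x) := bmeasD b1 (bmeasN b2).
have -> : cint m D (F (w + h)) - cint m D (F w) - cint m D F' * h =
    cint m D (fun x => F (w + h) x - F w x - h * F' x).
  by rewrite (cintB mD Doo b12 b3) (cintB mD Doo b1 b2) (cintZ h mD Doo bF') [h * _]mulrC.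
have := @cint_le _ _ _ m D _ (K * cabs h ^+ 2) mD Doo (bmeasD b12 (bmeasN b3)).
move=> /(_ _)/le_trans; apply=> [x Dx|].
  by rewrite [h * _]mulrC; exact: H.
rewrite expr2 !mulrA [leLHS](_ : _ = 2 * K * fine (m D) * cabs h * cabs h); last by ring.
rewrite ler_wpM2r ?cabs_ge0//; move: he; rewrite ltr_pdivlMr// => /ltW.
by apply: le_trans; rewrite mulrC ler_wpM2l ?cabs_ge0// lerDl.
Qed.

(** Applied with [E] a set of large [x]: a crude bound weighted by a small mass, and a fine bound
    elsewhere. *)
Lemma cint_le_split D E f (A B : R) : measurable D -> measurable E -> (m D < +oo)%E ->
  bmeas D f -> (forall x, D x -> E x -> cabs (f x) <= A) ->
  (forall x, D x -> ~ E x -> cabs (f x) <= B) ->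
  cabs (cint m D f) <= 2 * A * fine (m (D `&` E)) + 2 * B * fine (m (D `\` E)).
Proof.
move=> mD mE Doo bf HA HB.
have mDE : measurable (D `&` E) by exact: measurableI.
have mDE' : measurable (D `\` E) by exact: measurableD.
have U : (D `&` E) `|` (D `\` E) = D .
  apply/seteqP; split => x; first by case=> -[].
  by move=> Dx; have [Ex|nEx] := pselect (E x); [left|right].
have oo1 : (m (D `&` E) < +oo)%E by rewrite (le_lt_trans _ Doo)// le_measure ?inE.
have oo2 : (m (D `\` E) < +oo)%E by rewrite (le_lt_trans _ Doo)// le_measure ?inE//; exact: subDsetl.
have -> : cint m D f = cint m (D `&` E) f + cint m (D `\` E) f.
  rewrite -cint_setU ?U//.
  by apply/disj_setPS => x [[_ Ex] [_ /(_ Ex)]].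
rewrite (le_trans (cabsD _ _))// lerD//; apply: cint_le => //.
- by apply: bmeasS bf.
- by move=> x [Dx Ex]; exact: HA.
- by apply: bmeasS bf => //; exact: subDsetl.
- by move=> x [Dx Ex]; exact: HB.
Qed.

End ParameterIntegral.

Section CauchyTransform.
Context {R : realType}.
Variable mu : probability (measurableTypeR R) R.
Implicit Types (z w : R[i]) (x y t : R).

Lemma rcont_bmeasT (F : R -> R[i]) (B : R) (D : set (measurableTypeR R)) :
  measurable D -> (forall t, rcont F t) -> (forall t, D t -> cabs (F t) <= B) ->
  bmeas D F.
Proof.
move=> mD cF FB; split; last by exists B.
- apply: (@measurable_funTS _ _ (measurableTypeR R)).
  by apply: continuous_measurable_fun => t; have [] := cF t.
- apply: (@measurable_funTS _ _ (measurableTypeR R)).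
  by apply: continuous_measurable_fun => t; have [] := cF t.
Qed.

Lemma mu_fin (A : set (measurableTypeR R)) : measurable A -> (mu A < +oo)%E.
Proof. by move=> mA; rewrite (le_lt_trans (probability_le1 mu mA))// ltry. Qed.

Lemma mu_le1 (A : set (measurableTypeR R)) : measurable A -> 0 <= fine (mu A) <= 1.
Proof.
move=> mA; rewrite fine_ge0//= -lee_fin fineK ?probability_le1//.
by rewrite ge0_fin_numE// mu_fin.
Qed.

Lemma mu_setT1 : fine (mu setT) = 1.
Proof. by rewrite probability_setT. Qed.

Lemma measurable_abs_gt x : measurable ([set y | x < `|y|] : set (measurableTypeR R)).
Proof.
have -> : [set y | x < `|y|] = ~` (`[- x, x]%classic : set (measurableTypeR R)).
  apply/seteqP; split => y /=; rewrite in_itv /= -ler_norml; first by rewrite ltNge => /negP.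
  by rewrite ltNge => /negP.
by apply: measurableC; exact: measurable_itv.
Qed.

Lemma tight (e : R) : 0 < e -> exists2 L, 0 < L & fine (mu [set x | L < `|x|]) < e.
Proof.
move=> e0; pose F n := [set x | n.+1%:R < `|x|] : set (measurableTypeR R).
have mF n : measurable (F n) by exact: measurable_abs_gt.
have cF : \bigcap_n F n = set0.
  apply/seteqP; split => // x H.
  have := H (Num.truncn `|x|) I; rewrite /F /= ltNge => /negP; apply.
  by rewrite ltW// truncnS_gt.
have nF : nonincreasing_seq F.
  move=> n k nk; apply/subsetPset => x /=; apply: le_lt_trans.
  by rewrite ler_nat.
have := @nonincreasing_cvg_mu _ _ _ mu F (mu_fin (mF 0%N)) mF.
rewrite cF measure0 => /(_ measurable0 nF) C.
have : fine \o (mu \o F) @ \oo --> (0 : R) by apply: fine_cvg.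
move/cvgrPdist_lt => /(_ _ e0)[N _ /(_ N (leqnn N))].
rewrite sub0r normrN ger0_norm ?fine_ge0// => H.
by exists N.+1%:R.
Qed.

Lemma subRC_im w x : cim (w - x%:C) = cim w.
Proof. by rewrite cimB cimR subr0. Qed.

Lemma subRC_neq0 w x : cim w != 0 -> w - x%:C != 0.
Proof. by move=> w0; apply: contraNneq w0 => /(congr1 cim); rewrite subRC_im => ->. Qed.

Lemma resolvent_le w x : cim w != 0 -> cabs (w - x%:C)^-1 <= `|cim w|^-1.
Proof.
move=> w0; rewrite cabsV lef_pV2 ?posrE ?cabs_gt0 ?subRC_neq0 ?normr_gt0//.
by rewrite -(subRC_im w x) cim_le.
Qed.

Lemma rcont_resolvent w t : cim w != 0 -> rcont (fun x => (w - x%:C)^-1) t.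
Proof.
move=> w0; apply: rcontV; first exact: subRC_neq0.
by apply: rcontD; [exact: rcont_cst|apply: rcontN; apply: rcontR; exact: cvg_id].
Qed.

Lemma bmeas_resolvent w : cim w != 0 -> bmeas (setT : set (measurableTypeR R)) (fun x => (w - x%:C)^-1).
Proof.
move=> w0; apply: (@rcont_bmeasT _ (`|cim w|^-1)) => // t; first exact: rcont_resolvent.
by move=> _; exact: resolvent_le.
Qed.

Lemma cauchy_cdiff w : cim w != 0 -> cdiff (cauchy_transform mu) w.
Proof.
move=> w0; set b := `|cim w|; have b0 : 0 < b by rewrite normr_gt0.
have near z : cabs (z - w) < b / 2 -> cim z != 0 /\ b / 2 <= `|cim z|.
  move=> zw; have := le_lt_trans (cim_le (z - w)) zw; rewrite cimB => H.
  have : b - `|cim z - cim w| <= `|cim z|.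
    rewrite /b lerBlDr {1}(_ : cim w = cim z - (cim z - cim w)); last by ring.
    exact: ler_normB.
  move=> H2; have H3 : b / 2 <= `|cim z| by lra.
  by rewrite -normr_gt0; split => //; lra.
have bm : bmeas (setT : set (measurableTypeR R)) (fun x => - ((w - x%:C)^-1 * (w - x%:C)^-1)).
  by apply: bmeasN; apply: bmeasM; exact: bmeas_resolvent.
exists (cint mu setT (fun x => - ((w - x%:C)^-1 * (w - x%:C)^-1))).
apply: (@cint_deriv _ _ _ mu setT (fun w x => (w - x%:C)^-1) _ w (b / 2) (2 / b ^+ 3)) => //.
- by rewrite mu_fin.
- by rewrite divr_gt0.
- by rewrite divr_ge0// exprn_ge0// ltW.
- by move=> z /near[z0 _]; exact: bmeas_resolvent.
- move=> h hb x _; have [z0 zb] := near (w + h) ltac:(by rewrite [w + h]addrC addrK).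
  have n1 := subRC_neq0 x w0; have n2 := subRC_neq0 x z0.
  have -> : (w + h - x%:C)^-1 - (w - x%:C)^-1 - - ((w - x%:C)^-1 * (w - x%:C)^-1) * h =
     (w - x%:C)^-1 * (w - x%:C)^-1 * (w + h - x%:C)^-1 * h ^+ 2.
    by field; rewrite n1 n2.
  rewrite cabsM [cabs (h ^+ 2)]cabsX ler_wpM2r ?exprn_ge0 ?cabs_ge0// !cabsM.
  have r1 := resolvent_le x w0; have r2 := resolvent_le x z0.
  have r3 : `|cim (w + h)|^-1 <= 2 / b.
    by rewrite -[2 / b]invrK lef_pV2 ?posrE ?invf_div ?normr_gt0// divr_gt0.
  have -> : 2 / b ^+ 3 = b^-1 * b^-1 * (2 / b) by field; rewrite gt_eqF.
  rewrite ler_pM ?mulr_ge0 ?cabs_ge0//; first by rewrite ler_pM ?cabs_ge0.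
  by rewrite (le_trans r2).
Qed.

Lemma cim_inv_neq0 z : cim z != 0 -> cim z^-1 != 0.
Proof.
move=> z0; rewrite cimV mulf_neq0 ?oppr_eq0// invr_eq0 expf_neq0// cabs_eq0.
by apply: contraNneq z0 => ->.
Qed.

Lemma G_at_inv_cdiff z : cim z != 0 -> cdiff (G_at_inv mu) z.
Proof.
move=> z0; apply: (@cdiff_comp _ (fun z => z^-1) (cauchy_transform mu)).
  by apply: cdiffV; [apply: contraNneq z0 => ->|exact: cdiff_id].
by apply: cauchy_cdiff; exact: cim_inv_neq0.
Qed.

Lemma G_at_inv_axis (e : R) : 0 < e -> exists2 d, 0 < d & forall t, 0 < t < d ->
  cabs (G_at_inv mu (0 +i* t) - (0 +i* t)) <= e * t.
Proof.
move=> e0; have [L L0 HL] := tight (e := e / 4) ltac:(by rewrite divr_gt0).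
exists (e / (4 * L)); first by rewrite divr_gt0// mulr_gt0.
move=> t /andP[t0]; rewrite ltr_pdivlMr ?mulr_gt0// => te.
pose z : R[i] := 0 +i* t.
have z0 : z != 0 by apply/eqP => /(congr1 cim) /= tz; move: t0; rewrite tz ltxx.
have imz : cim z^-1 != 0 by apply: cim_inv_neq0; rewrite gt_eqF.
have bz := bmeas_resolvent imz.
have E x : (z^-1 - x%:C)^-1 - z = z * (z * x%:C * (1 - z * x%:C)^-1).
  have n1 : 1 - z * x%:C != 0.
    by apply/eqP => /(congr1 cre); rewrite !creimE /= mul0r mulr0 !subr0 => /eqP; rewrite oner_eq0.
  have -> : z^-1 - x%:C = z^-1 * (1 - z * x%:C) by rewrite mulrBr mulr1 mulrA mulVf ?mul1r.
  by rewrite invfM invrK; field.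
have fin1 := mu_fin (measurableT : measurable (setT : set (measurableTypeR R))).
have -> : G_at_inv mu z - z = cint mu setT (fun x => (z^-1 - x%:C)^-1 - z).
  rewrite (cintB measurableT fin1 bz (bmeas_cst _ z)) cint_cst//.
  by rewrite mu_setT1 mulr1.
have cz : cabs z = t by rewrite /z /cabs /= expr0n add0r sqrtr_sqr gtr0_norm.
have bnd x : cabs ((z^-1 - x%:C)^-1 - z) = t * (t * `|x| / cabs (1 - z * x%:C)).
  by rewrite E !cabsM cz cabsV cabsR.
have den1 x : 1 <= cabs (1 - z * x%:C).
  by have := cre_le (1 - z * x%:C); rewrite !creimE /= mul0r mulr0 !subr0 normr1.
have den2 x : t * `|x| <= cabs (1 - z * x%:C).
  have := cim_le (1 - z * x%:C); rewrite !creimE /= mul0r !add0r normrN.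
  by rewrite normrM (gtr0_norm t0).
have dpos x : 0 < cabs (1 - z * x%:C) by apply: lt_le_trans (den1 x).
apply: le_trans (@cint_le_split _ _ _ mu setT [set x | L < `|x|] _ t (t * (t * L)) _ _ _ _ _ _) _ => //.
- exact: measurable_abs_gt.
- by apply: bmeasD => //; exact: bmeas_cst.
- by move=> x _ _; rewrite bnd ler_piMr ?(ltW t0)// ler_pdivrMr// mul1r.
- move=> x _ /negP; rewrite -leNgt => xL; rewrite bnd ler_wpM2l ?(ltW t0)// ler_pdivrMr//.
  apply: (@le_trans _ _ (t * L)); first by rewrite ler_wpM2l// ltW.
  by rewrite ler_peMr// mulr_ge0// ltW.
have /andP[p0 p1] := mu_le1 (measurableD (measurableT : measurable (setT : set (measurableTypeR R))) (measurable_abs_gt L)).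
rewrite setTI; move: HL p0 p1; move: (fine _) (fine _) => a b ae b0 b1.
have te' : t * (t * L) <= t * (e / 4) by rewrite ler_wpM2l ?(ltW t0)//; lra.
have : 2 * t * b <= 2 * t * (e / 4) by rewrite ler_wpM2l ?mulr_ge0 ?(ltW t0)// ltW.
have : 2 * (t * (t * L)) * a <= 2 * (t * (e / 4)) * 1.
  by rewrite ler_pM// ?mulr_ge0 ?(ltW t0) ?(ltW L0)// ler_wpM2l.
lra.
Qed.

(** As [g] is differentiable at 0, its value and derivative there can be read off along the
    imaginary axis, where [G_at_inv_axis] compares it with [z]. *)
Lemma continuation_at0 (r : R) g : 0 < r -> continuation upper_half (G_at_inv mu) r g ->
  [/\ forall z, cabs z < r -> cdiff g z, g 0 = 0 & cderiv g 0 1].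
Proof.
move=> r0 [ag gG]; have dg := (cdiff_on_disc r g).1 ag.
have [D HD] := dg 0 ltac:(by rewrite cabs0).
have key (e : R) : 0 < e -> exists2 t, 0 < t < e & [/\ cabs (g (0 +i* t) - (0 +i* t)) <= e * t,
    cabs (g (0 +i* t) - g 0) < e & cabs (g (0 +i* t) - g 0 - D * (0 +i* t)) <= e * t].
  move=> e0; have [d d0 Hd] := G_at_inv_axis e0.
  have [d' d'0 Hd'] := cderiv_cont HD e0.
  have [d2 d20 Hd2] := HD _ e0.
  pose t := Num.min (Num.min (r / 2) (e / 2)) (Num.min (d / 2) (Num.min (d' / 2) (d2 / 2))).
  have t0 : 0 < t by rewrite !lt_min !divr_gt0.
  have tr : t <= r / 2 by rewrite !ge_min lexx.
  have te : t <= e / 2 by rewrite !ge_min lexx !orbT.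
  have td : t <= d / 2 by rewrite !ge_min lexx !orbT.
  have td' : t <= d' / 2 by rewrite !ge_min lexx !orbT.
  have td2 : t <= d2 / 2 by rewrite !ge_min lexx !orbT.
  have cz : cabs (0 +i* t) = t by rewrite /cabs /= expr0n add0r sqrtr_sqr gtr0_norm.
  exists t; first by rewrite t0 /=; lra.
  split.
  - rewrite gG; [|exact: t0|by rewrite /disc /= cz; lra].
    by apply: Hd; rewrite t0 /=; lra.
  - by apply: Hd'; rewrite subr0 cz; lra.
  - by have := Hd2 (0 +i* t); rewrite cz add0r; apply; lra.
have g0 : g 0 = 0.
  apply/eqP; rewrite -cabs_eq0 eq_le cabs_ge0 andbT; apply/ler_addgt0Pr => e e0; rewrite add0r.
  pose e' := Num.min 1 (e / 3); have e'0 : 0 < e' by rewrite lt_min ltr01 divr_gt0.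
  have e1 : e' <= 1 by rewrite ge_min lexx.
  have e3 : e' <= e / 3 by rewrite ge_min lexx orbT.
  have [t /andP[t0 te] [H1 H2 _]] := key _ e'0.
  have cz : cabs (0 +i* t) = t by rewrite /cabs /= expr0n add0r sqrtr_sqr gtr0_norm.
  have -> : g 0 = (g (0 +i* t) - (0 +i* t)) - (g (0 +i* t) - g 0) + 0 +i* t by ring.
  apply: le_trans (cabsD _ _) _; rewrite cz; have := cabsB (g (0 +i* t) - 0 +i* t) (g (0 +i* t) - g 0).
  have : e' * t <= e' * 1 by rewrite ler_wpM2l// ltW//; lra.
  lra.
split=> //; suff <- : D = 1 by [].
apply/eqP; rewrite -subr_eq0 -cabs_eq0 eq_le cabs_ge0 andbT; apply/ler_addgt0Pr => e e0; rewrite add0r.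
have [t /andP[t0 te] [H1 _ H2]] := key (e / 2) ltac:(by rewrite divr_gt0).
have cz : cabs (0 +i* t) = t by rewrite /cabs /= expr0n add0r sqrtr_sqr gtr0_norm.
rewrite -(ler_pM2r t0) -[in leLHS]cz -cabsM.
have -> : (D - 1) * (0 +i* t) = (g (0 +i* t) - 0 +i* t) - (g (0 +i* t) - g 0 - D * (0 +i* t)).
  by rewrite g0; ring.
rewrite (le_trans (cabsB _ _))//; lra.
Qed.

End CauchyTransform.

(** * Passing between the Cauchy transform, its reciprocal and the right inverse *)

Section ReciprocalAndInverse.
Context {R : realType}.
Variable mu : probability (measurableTypeR R) R.
Implicit Types (z w u : R[i]) (r : R) (g h : R[i] -> R[i]) (beta : R -> R).

Lemma continuationS U f r r' g : r' <= r -> continuation U f r g -> continuation U f r' g.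
Proof.
move=> rr [ag gf]; split=> [z zr|z Uz zr]; first by apply: ag; exact: lt_le_trans rr.
by apply: gf => //; exact: lt_le_trans rr.
Qed.

Lemma upper_half_neq0 z : upper_half z -> z != 0.
Proof. by apply: contraPneq => ->; rewrite /upper_half /= ltxx. Qed.

Lemma continuation_F_of_G r g : 0 < r -> continuation upper_half (G_at_inv mu) r g ->
  (forall z, cabs z < r -> z != 0 -> g z != 0) ->
  has_continuation upper_half (F_at_inv_sub mu) r.
Proof.
move=> r0 cg gn0; have [dg g0 g1] := continuation_at0 r0 cg.
have [h [dh hE]] := reciprocal_continuation r0 dg g0 g1 gn0.
exists h; split; first exact/cdiff_on_disc.
move=> z Uz zr; rewrite hE ?upper_half_neq0//.
by case: cg => _ ->.
Qed.

Lemma continuation_G_of_F r h : 0 < r -> continuation upper_half (F_at_inv_sub mu) r h ->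
  (forall z, cabs z < r -> 1 + z * h z != 0) ->
  has_continuation upper_half (G_at_inv mu) r.
Proof.
move=> r0 [/cdiff_on_disc dh hF] n0.
exists (fun z => z * (1 + z * h z)^-1); split.
  by apply/cdiff_on_disc => z zr; apply: reciprocal_transform_cdiff; [exact: dh|exact: n0].
move=> z Uz zr; have z0 := upper_half_neq0 Uz.
rewrite hF// /F_at_inv_sub mulrBr mulfV// addrC subrK invfM mulrA mulfV// mul1r.
by rewrite /recip_cauchy invrK.
Qed.

(** The radius is shrunk until the zeros that would become poles of the other function are outside
    the disc; so this says nothing about the largest radii. *)
Lemma G_iff_F : (exists r, 0 < r /\ has_continuation upper_half (G_at_inv mu) r) <->
  (exists r, 0 < r /\ has_continuation upper_half (F_at_inv_sub mu) r).
Proof.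
split=> [[r [r0 [g cg]]]|[r [r0 [h ch]]]].
  have [dg g0 g1] := continuation_at0 r0 cg.
  have [d d0 gn0] := near_nonzero g0 g1.
  have m0 : 0 < Num.min r d by rewrite lt_min r0.
  exists (Num.min r d); split => //; apply: (@continuation_F_of_G _ g) => //.
    by apply: continuationS cg; rewrite ge_min lexx.
  by move=> z; rewrite lt_min => /andP[_]; exact: gn0.
have [/cdiff_on_disc dh _] := ch.
have [d /andP[d0 dr] n0] := near_nonzero_mul r0 dh.
exists d; split => //; apply: (@continuation_G_of_F _ h) => //.
exact: continuationS ch.
Qed.

Lemma cone_open (a b : R) z : 0 < a -> cone a b z ->
  exists2 d, 0 < d & forall w, cabs (w - z) < d -> cone a b w.
Proof.
move=> a0 [z1 [z2 z3]].
(* One bound for each of the three inequalities of the cone; for the slope, a move of length [l]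
   costs at most [l] in [|Re|] and [a l] in [a |Im|]. *)
pose d := Num.min (- cim z) (Num.min ((a * `|cim z| - `|cre z|) / (a + 1)) (- b - cim z)).
have a1 : 0 < a + 1 by rewrite addr_gt0.
exists d.
  by rewrite !lt_min oppr_gt0 z1 divr_gt0 ?subr_gt0//= ltrNr opprK.
move=> w; rewrite !lt_min => /andP[w1 /andP[w2 w3]].
have c1 := le_lt_trans (cim_le _) w1; have c2 := le_lt_trans (cim_le _) w3.
have c3 := cim_le (w - z); have c4 := cre_le (w - z).
rewrite !cimB !creB in c1 c2 c3 c4.
have e1 := ler_norm (cim w - cim z).
have iw : cim w < 0 by lra.
split=> //; split; last by lra.
rewrite ltr_pdivlMr// in w2.
rewrite (ltr0_norm iw); rewrite (ltr0_norm z1) in w2.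
have f1 : `|cre w| <= `|cre z| + cabs (w - z).
  have := ler_normD (cre z) (cre w - cre z); rewrite addrC subrK; lra.
have f2 : a * (cim w - cim z) <= a * cabs (w - z) by rewrite ler_wpM2l ?(ltW a0)//; lra.
lra.
Qed.

Lemma cone_union_open beta z : cone_union beta z ->
  exists2 d, 0 < d & forall w, cabs (w - z) < d -> cone_union beta w.
Proof.
move=> [a /= a0 /(cone_open a0)[d d0 Hd]]; exists d => // w /Hd Hw.
by exists a.
Qed.

Lemma cone_scale (a b t : R) z : 1 <= t -> 0 < b -> cone a b z -> cone a b (t%:C * z).
Proof.
move=> t1 b0 [z1 [z2 z3]]; have t0 : 0 < t by rewrite (lt_le_trans ltr01).
rewrite /cone /= !creM !cimM /= !mul0r subr0 addr0 !normrM (gtr0_norm t0).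
split; first by rewrite pmulr_rlt0.
split; first by rewrite mulrCA ltr_pM2l.
by nra.
Qed.

Section RightInverse.
Variables (beta : R -> R) (Finv : R[i] -> R[i]).
Hypothesis ri : right_inverse mu beta Finv.
Let U := cone_union_inv beta.

Let beta_gt0 a : 0 < a -> 0 < beta a := @right_inverse_beta _ _ _ _ ri a.

Lemma cone_union_lower z : cone_union beta z -> cim z < 0.
Proof. by move=> [a _ []]. Qed.

Lemma U_upper z : U z -> upper_half z.
Proof.
move=> /cone_union_lower H.
have z0 : z != 0 by apply: contraTneq H => ->; rewrite invr0 ltxx.
by move: H; rewrite cimV pmulr_llt0 ?oppr_lt0// invr_gt0 exprn_gt0// cabs_gt0.
Qed.

Lemma U_open z : U z -> exists2 d, 0 < d & forall w, cabs (w - z) < d -> U w.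
Proof.
move=> Uz; have z0 := upper_half_neq0 (U_upper Uz).
have [d d0 Hd] := cone_union_open Uz.
have [e e0 He] := ccontV z0 (ccont_id z) d0.
by exists e => // w /He/Hd.
Qed.

(** Cones are stable under dilations of ratio at least 1, so the inverted domain contains the
    segment from each of its points towards 0; the identity theorem is applied along it. *)
Lemma U_scale z (t : R) : 0 < t <= 1 -> U z -> U (t%:C * z).
Proof.
move=> /andP[t0 t1] [a /= a0 ca]; exists a => //.
rewrite invfM -fmorphV; apply: cone_scale => //; last exact: beta_gt0.
by rewrite invr_ge1// unitf_gt0.
Qed.

Lemma U_axis : exists2 s0 : R, 0 < s0 & forall s, 0 < s < s0 -> U (0 +i* s).
Proof.
have b0 := beta_gt0 ltr01; exists (beta 1)^-1; first by rewrite invr_gt0.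
move=> s /andP[s0 sb]; exists 1 => //=.
have cs : cabs (0 +i* s) = s by rewrite /cabs /= expr0n add0r sqrtr_sqr gtr0_norm.
have E1 : cre (0 +i* s)^-1 = 0 by rewrite creV /= mul0r.
have E2 : cim (0 +i* s)^-1 = - s^-1 by rewrite cimV cs /=; field; rewrite gt_eqF.
split; first by rewrite E2 oppr_lt0 invr_gt0.
rewrite E1 E2 normr0 mul1r normrN normr_gt0 invr_eq0 gt_eqF//; split=> //.
by rewrite ltrN2 -[beta 1]invrK ltf_pV2 ?posrE ?invr_gt0.
Qed.

Lemma Finv_cdiff z : U z -> cdiff (Finv_at_inv_sub Finv) z.
Proof.
move=> Uz; have z0 := upper_half_neq0 (U_upper Uz).
have dV : cdiff (fun z => z^-1) z by apply: cdiffV => //; exact: cdiff_id.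
apply: cdiffD; last exact: cdiffN.
apply: (@cdiff_comp _ (fun z => z^-1) Finv) => //.
by apply/derivable_cderiv; apply: (right_inverse_analytic ri).
Qed.

Lemma Finv_neq0 z : U z -> Finv z^-1 != 0.
Proof.
move=> Uz; apply/eqP => /(congr1 cim) /eqP; rewrite lt_eqF//.
exact: (right_inverse_lower ri).
Qed.

Lemma Finv_upper z : U z -> upper_half (Finv z^-1)^-1.
Proof.
move=> Uz; rewrite /upper_half /= cimV divr_gt0//.
  by rewrite oppr_gt0; exact: (right_inverse_lower ri).
by rewrite exprn_gt0// cabs_gt0 Finv_neq0.
Qed.

Lemma G_Finv z : U z -> G_at_inv mu (Finv z^-1)^-1 = z.
Proof.
move=> Uz; rewrite /G_at_inv invrK.
by have := right_inverseK ri Uz; rewrite /recip_cauchy => /(congr1 GRing.inv); rewrite !invrK.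
Qed.

(** Let [k] be the local inverse of [g]; the continuation [H] is that of [1 / k - 1 / z]. Near 0 on
    the ray through [z0], the non-tangential asymptotics put [1 / Finv (1 / z)] into the small disc
    where [g] is inverted, so that it equals [k z] there; the identity then spreads along the ray up
    to [z0]. *)
Lemma Finv_of_G r g : 0 < r -> continuation upper_half (G_at_inv mu) r g ->
  exists r', 0 < r' /\ has_continuation U (Finv_at_inv_sub Finv) r'.
Proof.
move=> r0 cg; have [dg g0 g1] := continuation_at0 r0 cg; have [_ gG] := cg.
have [e [d [k [/andP[e0 er] d0 [dk k0 k1 kg gk]]]]] := local_inverse r0 dg g0 g1.
have [d1 d10 kn0] := near_nonzero k0 k1.
pose rho := Num.min d d1.
have rho0 : 0 < rho by rewrite lt_min d0.
have rd : rho <= d by rewrite ge_min lexx.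
have rd1 : rho <= d1 by rewrite ge_min lexx orbT.
have [H [dH HE]] := reciprocal_continuation rho0
  (fun z zr => dk z (lt_le_trans zr rd)) k0 k1 (fun z zr => kn0 z (lt_le_trans zr rd1)).
exists rho; split=> //; exists H; split; first exact/cdiff_on_disc.
move=> z0 Uz0 zr0; rewrite /disc /= in zr0.
have z00 := upper_half_neq0 (U_upper Uz0).
pose D z := H z - Finv_at_inv_sub Finv z.
apply/eqP; rewrite -subr_eq0; apply/eqP; rewrite -/(D z0).
have [a a0 [z1 [z2 z3]]] := Uz0.
have [M HM] := right_inverse_nontangential ri a0 (eps := 2^-1) ltac:(by rewrite invr_gt0).
(* For [z = t z0] with [t < tau], [1 / z] is beyond the threshold [M], and then
   [|1 / Finv (1 / z)| <= 2 |z| < e]. [M] may be negative, hence [|M| + 1]. *)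
pose tau := Num.min 1 (Num.min (e / (2 * cabs z0)) (((`|M| + 1) * cabs z0)^-1)).
have cz0 : 0 < cabs z0 by rewrite cabs_gt0.
have M1 : 0 < `|M| + 1 by rewrite ltr_wpDl.
have tau0 : 0 < tau by rewrite !lt_min ltr01 divr_gt0 ?invr_gt0 ?mulr_gt0.
have tau1 : tau <= 1 by rewrite ge_min lexx.
have taue : tau * (2 * cabs z0) <= e by rewrite -ler_pdivlMr ?mulr_gt0// !ge_min lexx !orbT.
have tauM : tau * ((`|M| + 1) * cabs z0) <= 1.
  by rewrite -ler_pdivlMr ?mulr_gt0// mul1r !ge_min lexx !orbT.
have Dt t : 0 < t < tau -> D (t%:C * z0) = 0.
  move=> /andP[t0 tt]; set z := t%:C * z0.
  have Uz : U z by apply: U_scale => //; rewrite t0 /=; lra.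
  have cz : cabs z = t * cabs z0 by rewrite cabsM cabsR gtr0_norm.
  have zn0 : z != 0 := upper_half_neq0 (U_upper Uz).
  have zrho : cabs z < rho.
    by rewrite cz; apply: le_lt_trans zr0; rewrite ler_piMl ?cabs_ge0//; lra.
  have nt : `|cre z^-1| < a * `|cim z^-1|.
    rewrite invfM -fmorphV creM cimM /= !mul0r subr0 addr0 !normrM mulrCA ltr_pM2l//.
    by rewrite normr_gt0 invr_eq0 gt_eqF.
  have Mz : M < cabs z^-1.
    rewrite cabsV cz; apply: (le_lt_trans (ler_norm M)).
    rewrite -[ltRHS]div1r ltr_pdivlMr ?mulr_gt0//.
    have : t * ((`|M| + 1) * cabs z0) < 1.
      by apply: lt_le_trans tauM; rewrite ltr_pM2r// mulr_gt0.
    have : 0 < t * cabs z0 by rewrite mulr_gt0.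
    lra.
  have := HM _ Uz nt Mz.
  set f := Finv z^-1 => fz.
  have fn0 : f != 0 := Finv_neq0 Uz.
  have vb : cabs f^-1 <= 2 * cabs z.
    rewrite cabsV -div1r ler_pdivrMr ?cabs_gt0//.
    move: fz; rewrite invrK cabs_distC; have := cabsB_ge 1 (f * z); rewrite cabs1 cabsM; lra.
  have ve : cabs f^-1 < e.
    by rewrite (le_lt_trans vb)// cz; nra.
  have gv : g f^-1 = z.
    by rewrite gG ?G_Finv//; [exact: Finv_upper|rewrite /disc /= (lt_trans ve)].
  have kz : k z = f^-1 by rewrite -gv gk// gv (lt_le_trans zrho).
  by rewrite /D HE// kz invrK /Finv_at_inv_sub subrr.
(* The segment starts at [(tau / 2) z0], as 0 is not in the domain. *)
have in01 s : 0 <= s <= 1 -> 0 < tau / 2 + s * (1 - tau / 2) <= 1.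
  by move=> /andP[s0 s1]; apply/andP; split; nra.
have ptE (s : R) : (tau / 2)%:C * z0 + s%:C * (z0 - (tau / 2)%:C * z0) =
   (tau / 2 + s * (1 - tau / 2))%:C * z0.
  by rewrite !(RcD, RcM, rmorphB) rmorph1; ring.
apply: (@segment_zero _ D ((tau / 2)%:C * z0) z0 (tau / 2)); first by rewrite divr_gt0.
  move=> s s01; rewrite ptE; set c := _ + _ * _.
  have c01 := in01 _ s01; rewrite -/c in c01.
  have Uc := U_scale c01 Uz0.
  have crho : cabs (c%:C * z0) < rho.
    case/andP: c01 => c0 c1; rewrite cabsM cabsR gtr0_norm//.
    by apply: le_lt_trans zr0; rewrite ler_piMl ?cabs_ge0.
  have [b b0 Hb] := U_open Uc.
  exists (Num.min b (rho - cabs (c%:C * z0))); first by rewrite lt_min b0 subr_gt0.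
  move=> w; rewrite lt_min => /andP[w1 w2].
  apply: cdiffD; last by apply: cdiffN; apply: Finv_cdiff; exact: Hb.
  by apply: dH; have := cabsB_ge w (c%:C * z0); lra.
move=> s /andP[s0 st]; rewrite ptE; apply: Dt; apply/andP; split; nra.
Qed.

(** [psi] continues [1 / Finv (1 / z)], and its local inverse [k] is the continuation sought. Around
    [u0 = psi z0], with [z0] on the imaginary axis, [k w] stays in the domain of [Finv], so that
    [G (1 / w) = k w] by the right inverse property; the upper half of the disc is convex, so the
    identity spreads from [u0] along segments. *)
Lemma G_of_Finv r : 0 < r -> has_continuation U (Finv_at_inv_sub Finv) r ->
  exists r', 0 < r' /\ has_continuation upper_half (G_at_inv mu) r'.
Proof.
move=> r0 [H [/cdiff_on_disc dH HF]].
have [rho /andP[rho0 rhor] n0] := near_nonzero_mul r0 dH.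
pose psi z := z * (1 + z * H z)^-1.
have dpsi z : cabs z < rho -> cdiff psi z.
  by move=> zr; apply: reciprocal_transform_cdiff; [apply: dH; exact: lt_le_trans rhor|exact: n0].
have psi0 : psi 0 = 0 by rewrite /psi mul0r.
have psi1 : cderiv psi 0 1 by apply: reciprocal_transform_deriv0; apply: dH; rewrite cabs0.
have [e [d [k [/andP[e0 er] d0 [dk k0 k1 kp pk]]]]] := local_inverse rho0 dpsi psi0 psi1.
have psiE z : U z -> cabs z < rho -> psi z = (Finv z^-1)^-1.
  move=> Uz zr; have z0 := upper_half_neq0 (U_upper Uz).
  rewrite /psi HF//; last exact: lt_le_trans rhor.
  by rewrite /Finv_at_inv_sub mulrBr mulfV// addrC subrK invfM mulrA mulfV// mul1r.
have kG z : U z -> cabs z < e -> G_at_inv mu (psi z) = z.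
  by move=> Uz ze; rewrite psiE ?G_Finv// (lt_trans ze).
have [s0 s00 Us] := U_axis.
have [d' d'0 Hd'] := cdiff_cont (dpsi 0 ltac:(by rewrite cabs0)) d0.
pose s := Num.min (s0 / 2) (Num.min (e / 2) (d' / 2)).
have sgt0 : 0 < s by rewrite !lt_min !divr_gt0.
have ss0 : s <= s0 / 2 by rewrite ge_min lexx.
have se : s <= e / 2 by rewrite !ge_min lexx !orbT.
have sd' : s <= d' / 2 by rewrite !ge_min lexx !orbT.
pose z0 : R[i] := 0 +i* s.
have cz0 : cabs z0 = s by rewrite /cabs /= expr0n add0r sqrtr_sqr gtr0_norm.
have Uz0 : U z0 by apply: Us; rewrite sgt0 /=; lra.
have z0e : cabs z0 < e by rewrite cz0; lra.
have [u0 u0E] : exists u0, u0 = psi z0 by exists (psi z0).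
have u0d : cabs u0 < d by have := Hd' z0; rewrite psi0 !subr0 cz0 u0E; apply; lra.
have ku0 : k u0 = z0 by rewrite u0E pk// -u0E.
have u0up : upper_half u0 by rewrite u0E psiE ?(lt_trans z0e)//; exact: Finv_upper.
exists d; split=> //; exists k; split; first exact/cdiff_on_disc.
move=> u Uu ud; rewrite /disc /= in ud.
pose D w := k w - G_at_inv mu w.
apply/eqP; rewrite -subr_eq0; apply/eqP; rewrite -/(D u).
have [b b0 Hb] := U_open Uz0.
have [b' b'0 Hb'] := cdiff_cont (dk _ u0d) b0; rewrite ku0 in Hb'.
have D0 w : cabs (w - u0) < b' -> cabs w < d -> D w = 0.
  move=> wb wd; have [kwe kpw] := kp _ wd.
  have Ukw : U (k w) by apply: Hb; exact: Hb'.
  by rewrite /D -{2}kpw kG// subrr.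
have [->|uu0] := eqVneq u u0; first by apply: D0; rewrite ?subrr ?cabs0.
have vpos : 0 < cabs (u - u0) by rewrite cabs_gt0 subr_eq0.
have segd t : 0 <= t <= 1 -> cabs (u0 + t%:C * (u - u0)) < d.
  move=> /andP[t0 t1].
  have -> : u0 + t%:C * (u - u0) = (1 - t)%:C * u0 + t%:C * u by rewrite rmorphB rmorph1 /=; ring.
  rewrite (le_lt_trans (cabsD _ _))// !cabsM !cabsR !ger0_norm ?subr_ge0//.
  have [u0u|u0u] := leP (cabs u0) (cabs u).
    have t1' : 0 <= 1 - t by rewrite subr_ge0.
    apply: le_lt_trans ud; have := ler_wpM2l t1' u0u; lra.
  apply: le_lt_trans u0d; have := ler_wpM2l t0 (ltW u0u); lra.
have segU t : 0 <= t <= 1 -> 0 < cim (u0 + t%:C * (u - u0)).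
  move=> /andP[t0 t1]; rewrite cimD cimM /= mul0r addr0 cimB.
  move: u0up Uu; rewrite /upper_half /=; nra.
apply: (@segment_zero _ D u0 u (Num.min 1 (b' / cabs (u - u0)))).
- by rewrite lt_min ltr01 divr_gt0.
- move=> t t01; set c := u0 + _.
  have cd := segd _ t01; have cU := segU _ t01; rewrite -/c in cd cU.
  exists (Num.min (d - cabs c) (cim c)); first by rewrite lt_min subr_gt0 cd.
  move=> w; rewrite lt_min => /andP[w1 w2]; apply: cdiffD.
    by apply: dk; have := cabsB_ge w c; lra.
  apply: cdiffN; apply: G_at_inv_cdiff; rewrite gt_eqF//.
  by have := le_lt_trans (cim_le _) w2; rewrite cimB ltr_norml => /andP[]; lra.
- move=> t /andP[t0]; rewrite lt_min => /andP[t1]; rewrite ltr_pdivlMr// => tb.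
  apply: D0; last by apply: segd; rewrite !ltW.
  by rewrite addrC addKr cabsM cabsR gtr0_norm.
Qed.

End RightInverse.
End ReciprocalAndInverse.

(** * From an entire extension of the Fourier transform to a continuation *)

Section ExponentialSeries.
Context {R : realType}.
Implicit Types (z w : R[i]) (x y t s : R).

Lemma exp_series_le x n : 0 <= x -> \sum_(k < n) x ^+ k / k`!%:R <= expR x.
Proof.
move=> x0; have := @nondecreasing_cvgn_le _ (series (exp_coeff x)) _ (is_cvg_series_exp_coeff x) n.
rewrite /series /= big_mkord; apply.
apply/nondecreasing_seqP => k; rewrite /series /= big_nat_recr//= lerDl.
exact: exp_coeff_ge0.
Qed.

Lemma exp_term_le x n : 0 <= x -> x ^+ n / n`!%:R <= expR x.
Proof.
move=> x0; apply: le_trans (exp_series_le n.+1 x0).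
rewrite big_ord_recr /= lerDr sumr_ge0// => k _.
by rewrite divr_ge0// exprn_ge0.
Qed.

(** A Stirling bound [m! <= e m (m / e)^m] for [m = n + 1], by induction from
    [(1 + 1/m)^(m+1) >= e]. *)
Lemma fact_exp_le n : n.+1`!%:R * expR n.+1%:R <= expR 1 * n.+1%:R ^+ n.+2 :> R.
Proof.
elim: n => [|n IH]; first by rewrite (_ : 1`! = 1)%N// mul1r expr1n mulr1.
set m : R := n.+1%:R in IH *.
have m0 : 0 < m by [].
have m1E : n.+2%:R = m + 1 :> R by rewrite natr1.
have step : expR 1 * m ^+ n.+2 <= (m + 1) ^+ n.+2.
  have e1 : m / (m + 1) <= expR (- (m + 1)^-1).
    apply: le_trans (expR_ge1Dx _); rewrite le_eqVlt; apply/orP; left; apply/eqP.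
    by field; rewrite gt_eqF// addr_gt0.
  have : (m / (m + 1)) ^+ n.+2 <= expR (- (m + 1)^-1) ^+ n.+2.
    by rewrite lerXn2r// nnegrE ?expR_ge0// divr_ge0// ltW// addr_gt0.
  rewrite -expRM_natl m1E mulrN mulfV ?gt_eqF ?addr_gt0// => H.
  have p0 : 0 < (m + 1) ^+ n.+2 by rewrite exprn_gt0// addr_gt0.
  move: H; rewrite expRN exprMn exprVn ler_pdivrMr// mulrC ler_pdivlMr ?expR_gt0//.
  by rewrite mulrC.
rewrite factS natrM m1E expRD.
have k0 : 0 <= (m + 1) * expR 1.
  by apply: mulr_ge0; [rewrite addr_ge0// ltW|exact: expR_ge0].
have H2 : (m + 1) * n.+1`!%:R * (expR m * expR 1) <= (m + 1) * expR 1 * (expR 1 * m ^+ n.+2).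
  have := ler_wpM2l k0 IH; apply: le_trans; rewrite le_eqVlt; apply/orP; left; apply/eqP; ring.
apply: (le_trans H2); rewrite [(m + 1) ^+ n.+3]exprS.
have := ler_wpM2l k0 step; move=> /le_trans; apply; rewrite le_eqVlt; apply/orP; left; apply/eqP; ring.
Qed.

(** Entire once [a] is geometrically bounded, and of exponential growth with the same rate;
    differentiation shifts [a], so that recurrences become differential equations. *)
Definition egf (a : nat -> R[i]) z := psum (fun n => a n / n`!%:R) z.

Lemma fact_neq0 n : n`!%:R != 0 :> R[i].
Proof. by rewrite -cabs_gt0 cabs_nat ltr0n fact_gt0. Qed.

Section Egf.
Variables (a : nat -> R[i]) (M T : R).
Hypothesis ab : cbound a M T.

Lemma egf_cbound s : 0 < s -> cbound (fun n => a n / n`!%:R) (M * expR (T / s)) s.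
Proof.
move=> s0; have [M0 T0 aM] := ab; split; [by rewrite mulr_ge0 ?expR_ge0|exact: ltW|].
move=> n; rewrite cabsM cabsV cabs_nat.
have Ts : 0 <= T / s by rewrite divr_ge0// ltW.
have := exp_term_le n Ts; rewrite exprMn exprVn mulrAC ler_pdivrMr ?exprn_gt0// => H.
apply: (@le_trans _ _ (M * (T ^+ n / n`!%:R))).
  by rewrite mulrA ler_wpM2r// invr_ge0.
by rewrite -mulrA ler_wpM2l.
Qed.

Lemma egf_csum z : csum (fun n => a n / n`!%:R * z ^+ n) (egf a z).
Proof.
have s0 : 0 < (cabs z + 1)^-1 by rewrite invr_gt0 ltr_wpDl// cabs_ge0.
have [] // := cbound_csum (z := z) (egf_cbound s0) _.
by rewrite mulrC ltr_pdivrMr ?mul1r ?ltrDl// ltr_wpDl// cabs_ge0.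
Qed.

Lemma egf_le z : cabs (egf a z) <= M * expR (T * cabs z).
Proof.
have [M0 T0 aM] := ab.
apply: (csum_le (egf_csum z)) => n.
apply: (@le_trans _ _ (M * \sum_(k < n) (T * cabs z) ^+ k / k`!%:R)).
  rewrite mulr_sumr; apply: ler_sum => k _.
  rewrite !cabsM cabsV cabs_nat cabsX exprMn.
  rewrite [leRHS](_ : _ = M * T ^+ k / k`!%:R * cabs z ^+ k); last by ring.
  by rewrite ler_wpM2r ?exprn_ge0 ?cabs_ge0// ler_wpM2r ?invr_ge0.
by rewrite ler_wpM2l// exp_series_le// mulr_ge0 ?cabs_ge0.
Qed.

Lemma egf_cderiv z : cderiv (egf a) z (egf (fun n => a n.+1) z).
Proof.
have s0 : 0 < (cabs z + 1)^-1 by rewrite invr_gt0 ltr_wpDl// cabs_ge0.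
have := @psum_deriv _ _ _ _ z (egf_cbound s0).
rewrite mulrC ltr_pdivrMr ?mul1r ?ltrDl ?ltr_wpDl ?cabs_ge0// => /(_ (ltr01)).
have -> // : (fun n => n.+1%:R * (a n.+1 / n.+1`!%:R)) = (fun n => a n.+1 / n`!%:R).
apply/funext => n; rewrite factS natrM; field.
by rewrite fact_neq0 -cabs_gt0 nat1r cabs_nat ltr0n.
Qed.

End Egf.

Lemma real_is_derive (u : R -> R) t d : (forall e, 0 < e -> exists2 r, 0 < r &
    forall h, `|h| < r -> `|u (t + h) - u t - d * h| <= e * `|h|) ->
  is_derive t 1 u d.
Proof.
move=> H.
have C : (fun h : R => h^-1 *: ((u \o shift t) (h *: (1 : R)) - u t)) @ 0^' --> d.
  apply/cvgrPdist_le => e e0; have [r r0 Hr] := H _ e0.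
  rewrite /dnbhs /within /=; apply/nbhs_ballP; exists r => //= h.
  rewrite /ball /= sub0r normrN => hr hn0.
  have := Hr _ hr; rewrite -ler_pdivrMr ?normr_gt0// -normfV -normrM.
  apply: le_trans; rewrite distrC /GRing.scale /= mulr1 [h + t]addrC.
  by rewrite mulrBl mulfK// mulrC lexx.
by apply: DeriveDef; [apply/cvg_ex; exists d|apply: cvg_lim C].
Qed.

(** [expR (- s * t) * u t] is constant and tends to 0 at infinity, as [T < s]. *)
Lemma ode_zero (u : R -> R) s T C : T < s ->
  (forall t, 0 < t -> is_derive t 1 u (s * u t)) ->
  (forall t, 0 < t -> `|u t| <= C * expR (T * t)) -> forall t, 0 < t -> u t = 0.
Proof.
move=> Ts du ub t t0.
pose v x := expR (- s * x) * u x.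
have dv x : 0 < x -> is_derive x 1 v 0.
  move=> x0; have := du _ x0 => dux.
  have de : is_derive x 1 (fun x => expR (- s * x)) (- s * expR (- s * x)).
    have d1 : is_derive x 1 (fun y => - s * y) (- s).
      apply: real_is_derive => e e0; exists 1 => // h _.
      have -> : - s * (x + h) - - s * x - - s * h = 0 by ring.
      by rewrite normr0 mulr_ge0// ltW.
    by rewrite mulrC; exact: (is_derive1_comp (is_derive_expR _) d1).
  apply: (is_derive_eq (is_deriveM de dux)).
  rewrite /GRing.scale /=; ring.
have vc a b : 0 < a -> a < b -> v a = v b.
  move=> a0 ab.
  have cv : {within `[a, b], continuous v}.
    apply: continuous_in_subspaceT => x /set_mem /=; rewrite in_itv /= => /andP[ax _].
    apply: differentiable_continuous; apply/derivable1_diffP.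
    by have [] := dv x (lt_le_trans a0 ax).
  have dv' x : x \in `]a, b[ -> is_derive x 1 v 0.
    by rewrite in_itv /= => /andP[ax _]; apply: dv; exact: lt_trans ax.
  have [x _] := MVT_segment (ltW ab) dv' cv.
  by rewrite mul0r => /eqP; rewrite subr_eq0 => /eqP.
have C0 : 0 <= C.
  by have := le_trans (normr_ge0 _) (ub 1 ltr01); rewrite pmulr_lge0 ?expR_gt0.
suff : v t = 0 by move=> /eqP; rewrite mulf_eq0 gt_eqF ?expR_gt0//= => /eqP.
apply/eqP; rewrite -normr_eq0 eq_le normr_ge0 andbT; apply/ler_addgt0Pr => e e0; rewrite add0r.
(* So far out that [exp ((s - T) b) >= 1 + (s - T) b >= C / e]. *)
pose b := t + 1 + C / (e * (s - T)).
have st : 0 < s - T by rewrite subr_gt0.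
have Cb : 0 <= C / (e * (s - T)) by rewrite divr_ge0// mulr_ge0// ltW.
rewrite (vc t b) //; last by rewrite /b -addrA ltrDl ltr_pwDl.
have b0 : 0 < b by rewrite /b -addrA addr_gt0// ltr_pwDl.
rewrite normrM ger0_norm ?expR_ge0//.
have := ler_wpM2l (expR_ge0 (- s * b)) (ub _ b0) => /le_trans; apply.
rewrite mulrCA -expRD.
have -> : - s * b + T * b = - ((s - T) * b) by ring.
rewrite expRN ler_pdivrMr ?expR_gt0//.
apply: le_trans (ler_wpM2l (ltW e0) (expR_ge1Dx _)).
have : (s - T) * (C / (e * (s - T))) * e = C by field; rewrite !gt_eqF.
have t1 : 0 < t + 1 by rewrite addr_gt0.
have := mulr_gt0 e0 (mulr_gt0 st t1).
rewrite /b; lra.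
Qed.

End ExponentialSeries.

(** * The Borel sum of an entire extension as a Cauchy transform *)

Section BorelTransform.
Context {R : realType}.
Variable mu : probability (measurableTypeR R) R.
Implicit Types (z w : R[i]) (x t s : R).

Local Notation phase x t := (cos (x * t) +i* sin (x * t)).

Lemma cabs_phase x t : cabs (phase x t) = 1 :> R.
Proof. by rewrite /cabs /= cos2Dsin2 sqrtr1. Qed.

Lemma phaseE x t : phase x t = cexp (0 +i* (x * t)).
Proof. by rewrite /cexp /= expR0 mul1r. Qed.

Lemma phaseD x t h : phase x (t + h) = phase x t * phase x h.
Proof. by rewrite !phaseE -cexpD; congr cexp; apply: ceqP; rewrite !creimE /= ?addr0// mulrDr. Qed.

Lemma phaseB1_le x h : cabs (phase x h - 1) <= 2 * (`|x| * `|h|).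
Proof.
rewrite (le_trans (cabs_le _))// creB cimB /= subr0 -normrM.
have A : `|cos (x * h) - 1| <= `|x * h|.
  have := @mvt_bound _ cos (fun x => - sin x) 1 (x * h) (fun x => is_derive_cos x).
  rewrite cos0 mul1r; apply => u _; rewrite normrN ler_norml.
  by rewrite sin_geN1 sin_le1.
by have := norm_sin_le (x * h); lra.
Qed.

Lemma phase_approx x h : `|x| * `|h| <= 1 ->
  cabs (phase x h - 1 - 0 +i* (x * h)) <= 15 * (`|x| * `|h|) ^+ 2.
Proof.
have c : cabs (0 +i* (x * h)) = `|x| * `|h|.
  by rewrite /cabs /= expr0n add0r sqrtr_sqr normrM.
by rewrite phaseE -c => H; exact: cexp_approx.
Qed.

Lemma rcont_phase t x : rcont (fun x => phase x t) x.
Proof.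
have E : (fun x => phase x t) = cexp \o (fun x => 0 +i* (x * t)).
  by apply/funext => y; rewrite phaseE.
rewrite E; apply: rcont_comp; last exact: cderiv_cont (cderiv_cexp _).
split; first exact: cvg_cst.
by apply: cvgM; [exact: cvg_id|exact: cvg_cst].
Qed.

Section Resolvent.
Variable s : R.
Hypothesis s0 : 0 < s.

Local Notation den x := (s%:C - 'i%C * x%:C : R[i]).

Lemma den_ge x : s <= cabs (den x).
Proof.
have := cre_le (den x); rewrite !creimE /= !mul0r !mulr0 subr0 oppr0 addr0.
by rewrite gtr0_norm.
Qed.

Lemma den_gex x : `|x| <= cabs (den x).
Proof.
have := cim_le (den x); rewrite !creimE /= mul0r mul1r !add0r.
by rewrite normrN.
Qed.

Lemma den_gt0 x : 0 < cabs (den x). Proof. exact: lt_le_trans s0 (den_ge x). Qed.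

Lemma den_neq0 x : den x != 0. Proof. by rewrite -cabs_gt0 den_gt0. Qed.

Lemma denV_le x : cabs (den x)^-1 <= s^-1.
Proof. by rewrite cabsV lef_pV2 ?posrE ?den_gt0// den_ge. Qed.

Lemma rcont_denV x : rcont (fun x => (den x)^-1) x.
Proof.
apply: rcontV; first exact: den_neq0.
apply: rcontD; first exact: rcont_cst.
apply: rcontN; apply: rcontM; first exact: rcont_cst.
by apply: rcontR; exact: cvg_id.
Qed.

Let T := (setT : set (measurableTypeR R)).
Let mT : measurable T. Proof. exact: measurableT. Qed.
Let finT : (mu T < +oo)%E. Proof. exact: mu_fin. Qed.

Lemma bmeas_phase t : bmeas T (fun x => phase x t).
Proof.
apply: (@rcont_bmeasT _ _ 1) => // x; first exact: rcont_phase.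
by move=> _; rewrite cabs_phase.
Qed.

Lemma bmeas_denV : bmeas T (fun x => (den x)^-1).
Proof.
apply: (@rcont_bmeasT _ _ s^-1) => // x; first exact: rcont_denV.
by move=> _; exact: denV_le.
Qed.

(** This is the integral over [u > t] of [exp (- s (u - t)) * fourier mu u], with the integration in
    [u] already carried out under [mu]. *)
Definition laplace_tail t : R[i] := cint mu T (fun x => (den x)^-1 * phase x t).

Let bmP t : bmeas T (fun x => (den x)^-1 * phase x t).
Proof. by apply: bmeasM; [exact: bmeas_denV|exact: bmeas_phase]. Qed.

Lemma laplace_tail_le t : cabs (laplace_tail t) <= 2 * s^-1.
Proof.
have := @cint_le _ _ _ mu T _ s^-1 mT finT (bmP t).
rewrite mu_setT1 mulr1; apply => x _.
by rewrite cabsM cabs_phase mulr1 denV_le.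
Qed.

(** The equation comes from [i x / (s - i x) = s / (s - i x) - 1]. As [|x| <= |s - i x|], the
    first-order error is at most [3 |h|] even for large [x], where it is weighted by a small mass;
    for [|x| <= L] it is quadratic in [h]. *)
Lemma laplace_tail_deriv t (e : R) : 0 < e -> exists2 d, 0 < d & forall h, `|h| < d ->
  cabs (laplace_tail (t + h) - laplace_tail t - (s%:C * laplace_tail t - fourier mu t) * h%:C)
    <= e * `|h|.
Proof.
move=> e0; have [L L0 HL] := tight mu (e := e / 20) ltac:(by rewrite divr_gt0).
(* The first bound gives [|x h| <= 1], as [phase_approx] requires; the second gives
   [15 (L |h|)^2 / s <= (e / 4) |h|]. *)
pose d := Num.min L^-1 (e * s / (60 * L ^+ 2)).
exists d; first by rewrite lt_min invr_gt0 L0 !divr_gt0 ?mulr_gt0// exprn_gt0.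
move=> h; rewrite lt_min => /andP[h1 h2].
have hL : L * `|h| <= 1 by move: h1; rewrite -div1r ltr_pdivlMr// => /ltW; rewrite mulrC.
have he : `|h| * (60 * L ^+ 2) <= e * s.
  by move: h2; rewrite ltr_pdivlMr ?mulr_gt0 ?exprn_gt0// => /ltW.
pose F x := (den x)^-1 * phase x (t + h) - (den x)^-1 * phase x t -
   h%:C * (s%:C * ((den x)^-1 * phase x t) - phase x t).
have b1 := bmP (t + h); have b2 := bmP t; have b3 := bmeas_phase t.
have b4 : bmeas T (fun x => s%:C * ((den x)^-1 * phase x t)) := bmeasZ s%:C b2.
have b5 : bmeas T (fun x => s%:C * ((den x)^-1 * phase x t) - phase x t) := bmeasD b4 (bmeasN b3).
have b6 := bmeasZ h%:C b5.
have b7 : bmeas T (fun x => (den x)^-1 * phase x (t + h) - (den x)^-1 * phase x t) := bmeasD b1 (bmeasN b2).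
have -> : laplace_tail (t + h) - laplace_tail t - (s%:C * laplace_tail t - fourier mu t) * h%:C =
   cint mu T F.
  rewrite /F (cintB mT finT b7 b6) (cintB mT finT b1 b2) (cintZ _ mT finT b5).
  by rewrite (cintB mT finT b4 b3) (cintZ _ mT finT b2) [_ * h%:C]mulrC.
have FE x : F x = (den x)^-1 * phase x t * (phase x h - 1 - 0 +i* (x * h)).
  have -> : 0 +i* (x * h) = 'i%C * x%:C * h%:C by apply: ceqP; rewrite !creimE /=; ring.
  rewrite /F phaseD; have dn := den_neq0 x; move: (phase x t) (phase x h) => p q.
  by field.
have c1 x : cabs (F x) = (cabs (den x))^-1 * cabs (phase x h - 1 - 0 +i* (x * h)).
  by rewrite FE !cabsM cabs_phase mulr1 cabsV.
have bF : bmeas T F := bmeasD b7 (bmeasN b6).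
apply: le_trans (@cint_le_split _ _ _ mu T [set x | L < `|x|] _ (3 * `|h|) (e / 4 * `|h|) _ _ _ bF _ _) _ => //.
- exact: measurable_abs_gt.
- move=> x _ _; rewrite c1 mulrC ler_pdivrMr ?den_gt0//.
  apply: (@le_trans _ _ (3 * `|h| * `|x|)); last by rewrite ler_wpM2l ?den_gex// mulr_ge0.
  rewrite (le_trans (cabsB _ _))//.
  have -> : cabs (0 +i* (x * h)) = `|x| * `|h|.
    by rewrite /cabs /= expr0n add0r sqrtr_sqr normrM.
  by have := phaseB1_le x h; lra.
- move=> x _ /negP; rewrite -leNgt => xL.
  have xh : `|x| * `|h| <= 1 by apply: le_trans hL; rewrite ler_wpM2r.
  rewrite c1 mulrC ler_pdivrMr ?den_gt0//.
  apply: (@le_trans _ _ (e / 4 * `|h| * s)); last by rewrite ler_wpM2l ?den_ge// mulr_ge0// divr_ge0// ltW.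
  apply: le_trans (phase_approx xh) _.
  have : (`|x| * `|h|) ^+ 2 <= (L * `|h|) ^+ 2.
    by rewrite lerXn2r// ?nnegrE ?mulr_ge0// ?(ltW L0)// ler_wpM2r.
  have := ler_wpM2r (normr_ge0 h) he; rewrite exprMn; lra.
have /andP[p0 p1] := mu_le1 mu (measurableD mT (measurable_abs_gt L)).
rewrite [T `&` _]setTI.
set a := fine (mu (T `\` _)) in p0 p1 *; set b := fine (mu [set x | _]) in HL *.
have h0 := normr_ge0 h.
have : 2 * (3 * `|h|) * b <= 2 * (3 * `|h|) * (e / 20) by rewrite ler_wpM2l ?mulr_ge0// ltW.
have : 2 * (e / 4 * `|h|) * a <= 2 * (e / 4 * `|h|) * 1.
  by rewrite ler_wpM2l// !mulr_ge0// ?divr_ge0// ltW.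
by have := mulr_ge0 (ltW e0) h0; lra.
Qed.

Lemma G_laplace_tail0 : G_at_inv mu (0 +i* s^-1) = 'i%C * laplace_tail 0.
Proof.
rewrite /laplace_tail -(cintZ 'i%C mT finT (bmP 0)); apply: eq_cint => x _.
rewrite mulr0 cos0 sin0 mulr1.
have i0 : 'i%C != 0 :> R[i] by rewrite -cabs_gt0 cabsi.
have -> : (0 +i* s^-1)^-1 - x%:C = den x / 'i%C.
  have sn : s != 0 by rewrite gt_eqF.
  apply: ceqP; rewrite !creimE ?creV ?cimV ?cabsi /= /cabs /= ?expr0n /= ?add0r ?sqrtr_sqr.
    by rewrite gtr0_norm ?invr_gt0//; field.
  by rewrite gtr0_norm ?invr_gt0//; field.
by rewrite invf_div.
Qed.

End Resolvent.

Section Extension.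
Variables (f : R[i] -> R[i]) (C T : R).
Hypotheses (T0 : 0 < T) (df : forall z, cdiff f z)
  (fT : forall z, cabs (f z) <= C * expR (T * cabs z))
  (fF : forall t, 0 < t -> f t%:C = fourier mu t).

Let c := taylor_coef f 1.

Lemma entire_coef r : 1 <= r -> taylor_coef f r = c.
Proof.
move=> r1; apply/funext => n; rewrite /c {2}/taylor_coef.
have r0 : 0 < r by apply: lt_le_trans r1.
have := @taylor_coefE _ f r r0 (fun z _ => df z) (1 / 2) n.
move=> ->; last by apply/andP; split; lra.
rewrite mulrA mulVf ?mul1r// Rc_eq0.
by rewrite lt0r_neq0// mulrn_wgt0// pi_gt0.
Qed.

Lemma entire_csum z : csum (fun n => c n * z ^+ n) (f z).
Proof.
have c0 := cabs_ge0 z.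
rewrite -(@entire_coef (cabs z + 1)) ?lerDr//.
by apply: taylor_csum => //; rewrite ?ltrDl// ltr_wpDl.
Qed.

Lemma entire_coef_le n (a : R) : 0 < a -> cabs (c n) * a ^+ n <= 2 * (C * expR (T * a)).
Proof.
move=> a0; rewrite -(@entire_coef (a + 1)) ?lerDr ?(ltW a0)//.
apply: taylor_coef_le => //; first by rewrite addr_gt0.
  by rewrite a0 ltrDl ltr01.
by move=> z <-; exact: fT.
Qed.

(** The derivatives of [f] at 0, so that the Laplace transform of [f] at [s] is formally the sum of
    the [gam n / s^(n+1)]. *)
Let gam n : R[i] := n`!%:R * c n.

Let C0 : 0 <= C.
Proof.
have := fT 0; rewrite cabs0 mulr0 expR0 mulr1; exact: le_trans (cabs_ge0 _).
Qed.

(** Cauchy's estimate at the best radius, combined with [fact_exp_le], loses only the factor [n + 1]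
    against [T^(n+1)]. *)
Lemma borel_coef_le n : cabs (gam n.+1) <= 2 * C * expR 1 * n.+1%:R * T ^+ n.+1.
Proof.
rewrite /gam cabsM cabs_nat.
set m : R := n.+1%:R; have m0 : 0 < m by [].
(* The radius [m / T] minimises [exp (T a) / a^m]. *)
have := @entire_coef_le n.+1 (m / T) ltac:(by rewrite divr_gt0).
have -> : T * (m / T) = m by rewrite mulrCA mulfV ?mulr1// gt_eqF.
rewrite exprMn exprVn => H; rewrite [leLHS]mulrA ler_pdivrMr ?exprn_gt0// in H.
have H2 := ler_wpM2l (ler0n R n.+1`!) H.
have p0 : 0 < m ^+ n.+1 by rewrite exprn_gt0.
rewrite -(ler_pM2r p0) -[leLHS]mulrA; apply: (le_trans H2).
have K0 : 0 <= 2 * C * T ^+ n.+1 by rewrite !mulr_ge0// exprn_ge0// ltW.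
have := ler_wpM2l K0 (@fact_exp_le R n); rewrite -/m [m ^+ n.+2]exprS => H3.
rewrite [leLHS](_ : _ = 2 * C * T ^+ n.+1 * (n.+1`!%:R * expR m)); last by ring.
by apply: (le_trans H3); rewrite le_eqVlt; apply/orP; left; apply/eqP; ring.
Qed.

(** The factor [n + 1] is absorbed by the passage from [T] to [T1]: one term of the sum of
    [(k + 1) (T / T1)^k] is at most the whole sum. *)
Lemma borel_cbound T1 : T < T1 -> exists M, cbound gam M T1.
Proof.
move=> TT1; have T10 : 0 < T1 := lt_trans T0 TT1.
pose K := cabs (gam 0%N) + 2 * C * expR 1 * (1 - T / T1)^-1 ^+ 2.
have q01 : 0 <= T / T1 < 1.
  by rewrite divr_ge0 ?(ltW T0) ?(ltW T10)//= ltr_pdivrMr// mul1r.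
have iq0 : 0 <= (1 - T / T1)^-1 by rewrite invr_ge0 subr_ge0 ltW//; case/andP: q01.
have Ce0 : 0 <= 2 * C * expR 1 by rewrite !mulr_ge0// expR_ge0.
have K0 : 0 <= 2 * C * expR 1 * (1 - T / T1)^-1 ^+ 2 by rewrite mulr_ge0// exprn_ge0.
exists K; split; [by rewrite addr_ge0 ?cabs_ge0|exact: ltW|].
case=> [|n]; first by rewrite expr0 mulr1 lerDl.
apply: (le_trans (borel_coef_le n)).
have : n.+2%:R * (T / T1) ^+ n.+1 <= (1 - T / T1)^-1 ^+ 2.
  apply: le_trans (geo_sum1_le n.+2 q01); rewrite big_ord_recr /= lerDr sumr_ge0// => k _.
  by rewrite mulr_ge0// exprn_ge0; case/andP: q01.
have nn : n.+1%:R * (T / T1) ^+ n.+1 <= n.+2%:R * (T / T1) ^+ n.+1.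
  by rewrite ler_wpM2r ?ler_nat// exprn_ge0//; case/andP: q01.
move=> /(le_trans nn) /(ler_wpM2l Ce0) H.
have T1n : 0 < T1 ^+ n.+1 by rewrite exprn_gt0.
rewrite exprMn (exprVn T1) !mulrA ler_pdivrMr// in H.
apply: (le_trans H); rewrite ler_wpM2r ?(ltW T1n)//.
by rewrite -[leLHS]mulrA -expr2 /K lerDr cabs_ge0.
Qed.

Let i_neq0 : 'i%C != 0 :> R[i]. Proof. by rewrite -cabs_gt0 cabsi. Qed.

(** [i] times the sum of the [gam n / s^(n+1)] at [s = i / z]. *)
Definition borel_sum z := z * psum (fun n => gam n * (- 'i%C) ^+ n) z.

Lemma borel_cboundi T1 : T < T1 -> exists M, cbound (fun n => gam n * (- 'i%C) ^+ n) M T1.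
Proof.
move=> /borel_cbound[M [M0 T10 H]]; exists M; split=> // n.
by rewrite cabsM cabsX cabsN cabsi expr1n mulr1.
Qed.

Lemma between_radius z : cabs z < T^-1 -> exists2 T1, T < T1 & T1 * cabs z < 1.
Proof.
move=> zT; have z0 := cabs_ge0 z.
have Tz : T * cabs z < 1 by rewrite mulrC -ltr_pdivlMr ?div1r.
exists (T + (1 - T * cabs z) / (cabs z + 1)).
  by rewrite ltrDl divr_gt0 ?subr_gt0// ltr_wpDl.
have : (1 - T * cabs z) / (cabs z + 1) * cabs z < 1 - T * cabs z.
  by rewrite -mulrA gtr_pMr ?subr_gt0// mulrC ltr_pdivrMr ?mul1r ?ltrDl// ltr_wpDl.
lra.
Qed.

Lemma borel_sum_cdiff z : cabs z < T^-1 -> cdiff (borel_sum) z.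
Proof.
move=> /between_radius[T1 /borel_cboundi[M cM] Tz].
by apply: cdiffM; [exact: cdiff_id|eexists; exact: psum_deriv cM Tz].
Qed.

(* [b n] is the tail of the Borel sum of [gam] at [s], so that its exponential
   generating function solves [E' = s E - f], like [laplace_tail]. *)
Lemma borel_tail s : T < s -> exists b T1 M, [/\ T1 < s, cbound b M T1,
  b 0%N = s%:C^-1 * psum gam s%:C^-1 & forall n, b n.+1 = s%:C * b n - gam n].
Proof.
move=> Ts; pose T1 := (T + s) / 2.
have s0 : 0 < s := lt_trans T0 Ts.
have T1s : T1 < s by rewrite /T1; lra.
have TT1 : T < T1 by rewrite /T1; lra.
have T10 : 0 <= T1 by apply: ltW; exact: lt_trans TT1.
have [M cM] := borel_cbound TT1; have [M0 _ gM] := cM.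
have cs : cabs (s%:C^-1 : R[i]) = s^-1 by rewrite cabsV cabsR gtr0_norm.
have sn0 : s%:C != 0 :> R[i] by rewrite Rc_eq0 gt_eqF.
have q1 : T1 * cabs (s%:C^-1 : R[i]) < 1 by rewrite cs ltr_pdivrMr// mul1r.
have [_ tailb] := cbound_csum cM q1.
pose S n : R[i] := \sum_(k < n) gam k * s%:C^-1 ^+ k.
pose b n : R[i] := s%:C ^+ n * (s%:C^-1 * (psum gam s%:C^-1 - S n)).
exists b, T1, (s^-1 * (M / (1 - T1 / s))); split => //.
- split=> //.
    by rewrite !mulr_ge0 ?invr_ge0 ?(ltW s0)// subr_ge0 ler_pdivrMr// mul1r ltW.
  move=> n; rewrite /b !cabsM cabsX cabsR gtr0_norm// cs.
  have := tailb n; rewrite cs => H.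
  have p0 : 0 <= s ^+ n * s^-1 by rewrite mulr_ge0 ?exprn_ge0 ?invr_ge0// ltW.
  have := ler_wpM2l p0 H; rewrite mulrA => /le_trans; apply.
  rewrite exprMn exprVn le_eqVlt; apply/orP; left; apply/eqP; field.
  by rewrite gt_eqF// subr_eq0 gt_eqF//= expf_neq0// gt_eqF.
- by rewrite /b /S big_ord0 expr0 mul1r subr0.
- move=> n; rewrite /b /S big_ord_recr /= exprS exprVn; field.
  by rewrite sn0 expf_neq0.
Qed.

(** The difference [D] of [laplace_tail s] and [egf b] satisfies [D' = s D] on [t > 0], where [f] is
    the Fourier transform, and grows at most like [exp (T1 t)] with [T1 < s]. So it vanishes for
    [t > 0], and at 0 by continuity. *)
Lemma laplace_tail0 s : T < s -> laplace_tail s 0 = s%:C^-1 * psum gam s%:C^-1.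
Proof.
move=> Ts; have s0 : 0 < s := lt_trans T0 Ts.
have [b [T1 [M [T1s cb b0 bS]]]] := borel_tail Ts.
have [M0 T10 _] := cb.
pose D t : R[i] := laplace_tail s t - egf b t%:C.
have E0 : egf b 0 = b 0%N.
  apply: (csum_unique (egf_csum cb 0)) => e e0; exists 1%N => -[//|n] _.
  rewrite big_ord_recl /= expr0 fact0 divr1 mulr1 big1 ?addr0 ?subrr ?cabs0// => i _.
  by rewrite exprS mul0r mulr0.
have bE z : egf (fun n => b n.+1) z = s%:C * egf b z - f z.
  apply: psumE; have := csumD (csumZ s%:C (egf_csum cb z)) (csumZ (-1) (entire_csum z)).
  rewrite mulN1r; apply: eq_csum => n; rewrite bS /gam; field.
  exact: fact_neq0.
have dD t (e : R) : 0 < e -> exists2 d, 0 < d & forall h, `|h| < d ->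
    cabs (D (t + h) - D t - (s%:C * D t - (fourier mu t - f t%:C)) * h%:C) <= e * `|h|.
  move=> e0; have e2 : 0 < e / 2 by rewrite divr_gt0.
  have [d1 d10 H1] := laplace_tail_deriv s0 t e2.
  have [d2 d20 H2] := egf_cderiv cb t%:C e2.
  exists (Num.min d1 d2); first by rewrite lt_min d10.
  move=> h; rewrite lt_min => /andP[/H1 {}H1 hd2].
  have := H2 h%:C; rewrite cabsR => /(_ hd2); rewrite bE -rmorphD /= => {}H2.
  have K (L1 L0 E1 E2 F1 f1 hh S : R[i]) : (L1 - E1) - (L0 - E2) - (S * (L0 - E2) - (F1 - f1)) * hh =
     (L1 - L0 - (S * L0 - F1) * hh) - (E1 - E2 - (S * E2 - f1) * hh) by ring.
  rewrite /D K.
  rewrite (le_trans (cabsB _ _))//; lra.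
have Db t : 0 < t -> cabs (D t) <= (2 * s^-1 + M) * expR (T1 * t).
  move=> t0; rewrite (le_trans (cabsB _ _))// mulrDl lerD//.
    apply: (le_trans (laplace_tail_le s0 t)); rewrite ler_peMr ?mulr_ge0 ?invr_ge0 ?(ltW s0)//.
    by rewrite -expR0 ler_expR mulr_ge0// ltW.
  by have := egf_le cb t%:C; rewrite cabsR gtr0_norm.
have D00 : D 0 = laplace_tail s 0 - egf b 0 by [].
clearbody D.
(* As [s] is real, the equation is solved for the real and the imaginary part separately. *)
have comp (g : R[i] -> R) : {morph g : z w / z - w} -> (forall x z, g (x%:C * z) = x * g z) ->
    (forall z, `|g z| <= cabs z) -> forall t, 0 < t -> g (D t) = 0.
  move=> gB gZ gle; apply: (@ode_zero _ (fun t => g (D t)) s T1 (2 * s^-1 + M) T1s) => t t0; last first.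
    by apply: le_trans (Db t t0).
  apply: real_is_derive => e e0; have [d d0 Hd] := dD t e e0; exists d => // h /Hd.
  rewrite fF// subrr subr0; apply: le_trans; apply: le_trans (gle _).
  by rewrite !gB [_ * h%:C]mulrC !gZ [h * _]mulrC.
have Dz t : 0 < t -> D t = 0.
  move=> t0; apply: ceqP.
    apply: (comp cre) => //; [exact: creB|by move=> x z; rewrite creM /= mul0r subr0|exact: cre_le].
  apply: (comp cim) => //; [exact: cimB|by move=> x z; rewrite cimM /= mul0r addr0|exact: cim_le].
suff : D 0 = 0 by rewrite D00 E0 b0 => /subr0_eq.
apply/eqP; rewrite -cabs_eq0 eq_le cabs_ge0 andbT; apply/ler_addgt0Pr => e e0; rewrite add0r.
have [d d0 Hd] := dD 0 1 ltr01.
(* The differentiability estimate at 0 together with [D h = 0] gives [|D 0| <= K h] for small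
   [h > 0]. *)
pose K := cabs (s%:C * D 0 - (fourier mu 0 - f 0)) + 1.
have K0 : 0 < K by rewrite ltr_wpDl// cabs_ge0.
pose h := Num.min (d / 2) (e / K).
have h0 : 0 < h by rewrite lt_min !divr_gt0.
have hd : h <= d / 2 by rewrite ge_min lexx.
have hK : h * K <= e by rewrite -ler_pdivlMr// ge_min lexx orbT.
have := Hd h; rewrite gtr0_norm// => /(_ ltac:(lra)).
rewrite add0r Dz// sub0r mul1r => H.
rewrite -cabsN; set Z := _ * h%:C in H.
have -> : - D 0 = (- D 0 - Z) + Z by ring.
apply: le_trans (cabsD _ _) _; apply: le_trans hK.
have -> : cabs Z = (K - 1) * h by rewrite /Z cabsM cabsR gtr0_norm// /K addrK.
lra.
Qed.

Lemma borel_sum_axis y : 0 < y < T^-1 -> G_at_inv mu (0 +i* y) = borel_sum (0 +i* y).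
Proof.
move=> /andP[y0 yT]; have s0 : 0 < y^-1 by rewrite invr_gt0.
have Ts : T < y^-1 by rewrite -[T]invrK ltf_pV2 ?posrE// invr_gt0.
have := @G_laplace_tail0 _ s0; rewrite invrK => ->.
rewrite laplace_tail0// -fmorphV invrK.
have [T1 T1s Tz] := @between_radius y%:C ltac:(by rewrite cabsR gtr0_norm).
have [M cM] := borel_cbound T1s.
have [H _] := cbound_csum cM Tz.
have iy : 0 +i* y = 'i%C * y%:C :> R[i] by apply: ceqP; rewrite !creimE /=; ring.
have P : psum (fun n => gam n * (- 'i%C) ^+ n) ('i%C * y%:C) = psum gam y%:C.
  apply: psumE; apply: eq_csum H => n.
  rewrite -mulrA -exprMn; congr (_ * _ ^+ _).
  by rewrite mulrA mulNr -expr2 sqr_i opprK mul1r.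
by rewrite /borel_sum iy P mulrA.
Qed.

(** Agreement on the imaginary axis spreads to a disc around the point [p] of it, and from [p] along
    segments, as the upper half of the disc is convex. *)
Lemma continuation_G_of_entire : has_continuation upper_half (G_at_inv mu) T^-1.
Proof.
have Ti : 0 < T^-1 by rewrite invr_gt0.
exists borel_sum; split; first by apply/cdiff_on_disc => z; exact: borel_sum_cdiff.
move=> z Uz zT; rewrite /disc /= in zT.
pose D w := borel_sum w - G_at_inv mu w.
apply/eqP; rewrite -subr_eq0; apply/eqP; rewrite -/(D z).
pose y0 := T^-1 / 2; pose p : R[i] := 0 +i* y0.
have y00 : 0 < y0 by rewrite divr_gt0.
have y0T : y0 < T^-1 by rewrite /y0; lra.
have cy (y : R) : 0 < y -> cabs (0 +i* y) = y.
  by move=> ygt0; rewrite /cabs /= expr0n add0r sqrtr_sqr gtr0_norm.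
have dD w : 0 < cim w -> cabs w < T^-1 -> cdiff D w.
  move=> w0 wT; apply: cdiffD; first exact: borel_sum_cdiff.
  by apply: cdiffN; apply: G_at_inv_cdiff; rewrite gt_eqF.
pose r := Num.min y0 (T^-1 - y0).
have r0 : 0 < r by rewrite lt_min y00 subr_gt0.
have near w : cabs (w - p) < r -> 0 < cim w /\ cabs w < T^-1.
  rewrite lt_min => /andP[w1 w2]; have := le_lt_trans (cim_le _) w1.
  rewrite cimB ltr_norml /= => /andP[w3 _]; have := cabsB_ge w p; rewrite cy//; lra.
have Dp w : cabs (w - p) < r -> D w = 0.
  apply: (@isolated_zero _ D p 'i%C r (T^-1 - y0) r0) => //.
  - by move=> v /near[]; exact: dD.
  - by rewrite subr_gt0.
  - move=> t /andP[t0 tT]; have -> : p + t%:C * 'i%C = 0 +i* (y0 + t).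
      by apply: ceqP; rewrite !creimE /=; ring.
    by rewrite /D borel_sum_axis ?subrr//; apply/andP; split; lra.
have [->|zp] := eqVneq z p; first by apply: Dp; rewrite subrr cabs0.
have vpos : 0 < cabs (z - p) by rewrite cabs_gt0 subr_eq0.
have segd t : 0 <= t <= 1 -> cabs (p + t%:C * (z - p)) < T^-1.
  move=> /andP[t0 t1].
  have -> : p + t%:C * (z - p) = (1 - t)%:C * p + t%:C * z by rewrite rmorphB rmorph1 /=; ring.
  rewrite (le_lt_trans (cabsD _ _))// !cabsM !cabsR !ger0_norm ?subr_ge0// cy//.
  have t1' : 0 <= 1 - t by rewrite subr_ge0.
  have [pz|zp'] := leP y0 (cabs z).
    by apply: le_lt_trans zT; have := ler_wpM2l t1' pz; lra.
  by apply: le_lt_trans y0T; have := ler_wpM2l t0 (ltW zp'); lra.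
have segU t : 0 <= t <= 1 -> 0 < cim (p + t%:C * (z - p)).
  move=> /andP[t0 t1]; rewrite cimD cimM /= mul0r addr0 cimB /=.
  move: Uz; rewrite /upper_half /=; nra.
apply: (@segment_zero _ D p z (Num.min 1 (r / cabs (z - p)))).
- by rewrite lt_min ltr01 divr_gt0.
- move=> t t01; set q := p + _.
  have qd := segd _ t01; have qU := segU _ t01; rewrite -/q in qd qU.
  exists (Num.min (T^-1 - cabs q) (cim q)); first by rewrite lt_min subr_gt0 qd.
  move=> w; rewrite lt_min => /andP[w1 w2]; apply: dD.
    by have := le_lt_trans (cim_le _) w2; rewrite cimB ltr_norml => /andP[]; lra.
  by have := cabsB_ge w q; lra.
- move=> t /andP[t0]; rewrite lt_min => /andP[t1]; rewrite ltr_pdivlMr// => tb.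
  by apply: Dp; rewrite addrC addKr cabsM cabsR gtr0_norm.
Qed.

End Extension.
End BorelTransform.

(** * Stieltjes inversion *)

Section StieltjesInversion.
Context {R : realType}.
Variable mu : probability (measurableTypeR R) R.
Implicit Types (v k x y t a b c d e : R).

(** The derivative of [atan] is 1-Lipschitz, which makes the error uniform in [v]; so it can be
    integrated over [mu]. *)
Lemma atan_approx v k : `|atan (v + k) - atan v - k * (1 + v ^+ 2)^-1| <= k ^+ 2.
Proof.
pose f := fun h : R => atan (v + h) - h * (1 + v ^+ 2)^-1.
pose df h := (1 + (v + h) ^+ 2)^-1 - (1 + v ^+ 2)^-1.
have fd (h : R) : is_derive h 1 f (df h).
  apply: is_deriveB.
    have D : is_derive h 1 (fun h => v + h) (0 + 1) by apply: is_deriveD.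
    rewrite -[X in is_derive _ _ _ X]mulr1 -[X in _ * X]add0r.
    exact: (@is_derive1_comp _ atan _ h _ _ (is_derive1_atan (v + h)) D).
  rewrite (_ : (fun h => h * _) = (fun h => (1 + v ^+ 2)^-1 *: (h : R^o))); last first.
    by apply/funext => u; rewrite /= [LHS]mulrC.
  by rewrite -[X in is_derive _ _ _ X]mulr1; apply: is_deriveZ.
have dfk h : `|h| <= `|k| -> `|df h| <= `|k|.
  move=> hk; apply: le_trans hk; rewrite /df.
  set p := v + h.
  have p0 : 0 < 1 + p ^+ 2 by rewrite ltr_pwDl// sqr_ge0.
  have v0 : 0 < 1 + v ^+ 2 by rewrite ltr_pwDl// sqr_ge0.
  have -> : (1 + p ^+ 2)^-1 - (1 + v ^+ 2)^-1 = - h * ((p + v) / ((1 + p ^+ 2) * (1 + v ^+ 2))).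
    have -> : h = p - v by rewrite /p addrC addKr.
    by field; rewrite !gt_eqF.
  rewrite normrM normrN ler_piMr// normf_div (gtr0_norm (mulr_gt0 p0 v0)).
  rewrite ler_pdivrMr ?mulr_gt0// mul1r ler_norml.
  have := sqr_ge0 (p - 1); have := sqr_ge0 (v - 1); have := sqr_ge0 (p + 1); have := sqr_ge0 (v + 1).
  have := mulr_ge0 (sqr_ge0 p) (sqr_ge0 v); have := sqr_ge0 p; have := sqr_ge0 v.
  by move=> *; apply/andP; split; lra.
have := mvt_bound fd dfk.
by rewrite /f addr0 mul0r subr0 -normrM -expr2 ger0_norm ?sqr_ge0// addrAC.
Qed.


Local Notation cc a b := (`[a, b]%classic : set (measurableTypeR R)).
Let T := (setT : set (measurableTypeR R)).
Let mT : measurable T. Proof. exact: measurableT. Qed.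
Let finT : (mu T < +oo)%E. Proof. exact: mu_fin. Qed.

Lemma continuous_atan_affine b y x : {for x, continuous (fun x => atan ((b - x) / y))}.
Proof.
apply: (@continuous_comp _ _ _ (fun x => (b - x) / y) atan).
  by apply: cvgM; [apply: cvgB; [exact: cvg_cst|exact: cvg_id]|exact: cvg_cst].
exact: continuous_atan.
Qed.

Lemma norm_atan_le x : `|atan x| <= pi / 2.
Proof. by rewrite ler_norml -mulNr !ltW// ?mulNr ?atan_gtNpi2 ?atan_ltpi2. Qed.

Lemma bmeas_atan b y : bmeas T (fun x => (atan ((b - x) / y))%:C).
Proof.
apply: (@rcont_bmeasT _ _ (pi / 2)) => // x.
  by apply: rcontR; exact: continuous_atan_affine.
by move=> _; rewrite cabsR norm_atan_le.
Qed.

(* A primitive, in [b], of the imaginary part of the Cauchy transform on the line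
   [Im = - y]; as [y] tends to 0, it tends to [pi] times a distribution function
   of [mu], up to a constant. *)
Definition atan_mass y b : R := \int[mu]_x atan ((b - x) / y).

Lemma poisson_kernel b y x : 0 < y ->
  cim (b -i* y - x%:C)^-1 = y^-1 * (1 + ((b - x) / y) ^+ 2)^-1.
Proof.
move=> y0; rewrite cimV sqr_cabs !creimE /= subr0 opprK.
have ? : 0 < y ^+ 2 + (b - x) ^+ 2 by rewrite ltr_pwDl ?exprn_gt0// sqr_ge0.
by field; rewrite ?gt_eqF//= sqrrN addrC gt_eqF.
Qed.

Lemma is_derive_atan_mass y b : 0 < y ->
  is_derive b 1 (atan_mass y) (cim (cauchy_transform mu (b -i* y))).
Proof.
move=> y0; apply: real_is_derive => e e0.
exists (e * y ^+ 2 / 2); first by rewrite !mulr_gt0 ?exprn_gt0.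
move=> h; rewrite ltr_pdivlMr// => hd.
pose F x := (atan ((b + h - x) / y))%:C - (atan ((b - x) / y))%:C
   - h%:C * (cim (b -i* y - x%:C)^-1)%:C : R[i].
have b1 := bmeas_atan (b + h) y; have b2 := bmeas_atan b y.
have b3 : bmeas T (fun x => (cim (b -i* y - x%:C)^-1)%:C).
  have bn : cim (b -i* y) != 0 by rewrite /= oppr_eq0 gt_eqF.
  have [m1 m2 [B HB]] := bmeas_resolvent bn.
  split; [exact: m2|exact: measurable_cst|exists B => x _; rewrite cabsR].
  by rewrite (le_trans (cim_le _))// HB.
have b4 := bmeasZ h%:C b3.
have b5 : bmeas T (fun x => (atan ((b + h - x) / y))%:C - (atan ((b - x) / y))%:C) :=
  bmeasD b1 (bmeasN b2).
have bF : bmeas T F := bmeasD b5 (bmeasN b4).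
have -> : atan_mass y (b + h) - atan_mass y b - cim (cauchy_transform mu (b -i* y)) * h =
   cre (cint mu T F).
  rewrite /F (cintB mT finT b5 b4) (cintB mT finT b1 b2) (cintZ _ mT finT b3).
  rewrite !creB creM creR cimR mul0r subr0; congr (_ - _).
  by rewrite mulrC.
apply: le_trans (cre_le _) _.
have : cabs (cint mu T F) <= 2 * (h / y) ^+ 2 * fine (mu T).
  apply: cint_le => // x _.
  rewrite /F -rmorphM -!rmorphB poisson_kernel// cabsR.
  have -> : (b + h - x) / y = (b - x) / y + h / y by rewrite addrAC mulrDl.
  by have := atan_approx ((b - x) / y) (h / y); rewrite mulrA.
move/le_trans; apply; rewrite mu_setT1 mulr1.
rewrite exprMn exprVn mulrA ler_pdivrMr ?exprn_gt0//.
rewrite -(real_normK (num_real h)) [leRHS]mulrAC expr2 mulrA ler_wpM2r//.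
by rewrite mulrC ltW.
Qed.

Lemma atan_ge_lim e : 0 < e -> exists2 M : R, 0 < M & forall x, M <= x -> pi / 2 - e <= atan x.
Proof.
move=> e0; have /cvgrPdist_lt/(_ e e0)[M [_ HM]] := @cvgy_atan R.
exists (Num.max 1 (M + 1)); first by rewrite lt_max ltr01.
move=> x; rewrite ge_max => /andP[_ xM].
have := HM x ltac:(lra); rewrite ltr_norml => /andP[_]; lra.
Qed.

Lemma Rintegral_cst_indic (I : set (measurableTypeR R)) c : measurable I ->
  mu.-integrable T (EFin \o (fun x => c * \1_I x)) /\
  \int[mu]_x (c * \1_I x) = c * fine (mu I).
Proof.
move=> mI.
have i1 : mu.-integrable T (EFin \o \1_I).
  exact: integrable_indic.
split; first by rewrite (_ : _ \o _ = fun x => c%:E * (\1_I x)%:E)%E//; exact: integrableZl.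
by rewrite RintegralZl// /Rintegral integral_indic// setIT.
Qed.

Let K y a b x := atan ((b - x) / y) - atan ((a - x) / y).

Let atan_massB y a b : mu.-integrable T (EFin \o K y a b) /\
  atan_mass y b - atan_mass y a = \int[mu]_x K y a b x.
Proof.
have [ia _] := bmeas_integrable mT finT (bmeas_atan a y).
have [ib _] := bmeas_integrable mT finT (bmeas_atan b y).
split; first exact: (integrableB mT ib ia).
by rewrite -(RintegralB mT ib ia).
Qed.

(** The kernel [K] is nonnegative, and on [[a + d, b - d]] its two arguments are beyond [d / y] and
    [- d / y]. *)
Lemma atan_mass_ge y a b d e : 0 < y -> a <= b -> 0 < d -> pi / 2 - e <= atan (d / y) ->
  (pi - 2 * e) * fine (mu (cc (a + d) (b - d))) <= atan_mass y b - atan_mass y a.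
Proof.
move=> y0 ab d0 He; have [iK ->] := atan_massB y a b.
have mI : measurable (cc (a + d) (b - d)) by exact: measurable_itv.
have [i1 <-] := Rintegral_cst_indic (pi - 2 * e) mI.
apply: le_Rintegral => // x _.
have le_at u v : u <= v -> atan (u / y) <= atan (v / y).
  by move=> uv; rewrite le_atan// ler_pM2r ?invr_gt0.
rewrite indicE; case: (boolP (x \in _)) => [/set_mem|_]; last first.
  by rewrite mulr0 subr_ge0; apply: le_at; lra.
rewrite /= in_itv /= => /andP[x1 x2]; rewrite mulr1 /K.
have := le_at d (b - x) ltac:(lra); have := le_at (a - x) (- d) ltac:(lra).
by rewrite mulNr atanN; lra.
Qed.

(** Outside [[a - d, b + d]] both values of [atan] are within [e] of the same limit, [pi / 2] or
    [- pi / 2]; inside, [K] is at most [pi]. *)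
Lemma atan_mass_le y a b d e : 0 < y -> a <= b -> 0 < d -> 0 < e -> pi / 2 - e <= atan (d / y) ->
  atan_mass y b - atan_mass y a <= pi * fine (mu (cc (a - d) (b + d))) + e.
Proof.
move=> y0 ab d0 e0 He; have [iK ->] := atan_massB y a b.
have mI : measurable (cc (a - d) (b + d)) by exact: measurable_itv.
have [i1 <-] := Rintegral_cst_indic pi mI.
have [i2 E2] := Rintegral_cst_indic e mT.
have <- : \int[mu]_x (e * \1_T x) = e by rewrite E2 mu_setT1 mulr1.
rewrite -RintegralD//.
apply: le_Rintegral => //; first exact: (integrableD mT i1 i2).
have le_at u v : u <= v -> atan (u / y) <= atan (v / y).
  by move=> uv; rewrite le_atan// ler_pM2r ?invr_gt0.
move=> x _; have := norm_atan_le ((b - x) / y); have := norm_atan_le ((a - x) / y).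
rewrite !ler_norml => /andP[a1 a2] /andP[b1 b2].
rewrite /= /K !indicE in_setT mulr1; case: (boolP (x \in _)) => [_|/negP xI].
  by rewrite mulr1; lra.
rewrite mulr0 add0r; have [xa|ax] := ltP x (a - d).
  by have := le_at d (a - x) ltac:(lra); lra.
have [xb|bx] := leP x (b + d).
  by case: xI; apply: mem_set; rewrite /= in_itv /= ax.
by have := le_at (b - x) (- d) ltac:(lra); rewrite mulNr atanN; lra.
Qed.

Lemma mvt_segment_le (f df : R -> R) a b (B : R) : a <= b ->
  (forall x, a <= x <= b -> is_derive x 1 f (df x)) ->
  (forall x, a <= x <= b -> `|df x| <= B) -> `|f b - f a| <= B * (b - a).
Proof.
move=> ab fd fB.
have cf : {within `[a, b], continuous f}.
  apply: continuous_in_subspaceT => x /set_mem /=; rewrite in_itv /= => /fd[fx _].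
  by apply: differentiable_continuous; apply/derivable1_diffP.
have fd' x : x \in `]a, b[ -> is_derive x 1 f (df x).
  by rewrite in_itv /= => /andP[/ltW ax /ltW xb]; apply: fd; rewrite ax.
have [x] := MVT_segment ab fd' cf.
by rewrite in_itv /= => xab ->; rewrite normrM (@ger0_norm _ (b - a)) ?subr_ge0// ler_wpM2r ?subr_ge0 ?fB.
Qed.

Section BoundaryDensity.
Variables (w : R -> R) (c d : R).
Hypothesis cw : forall x, c <= x <= d -> {for x, continuous w}.
Hypothesis wG : forall e, 0 < e -> exists2 r, 0 < r & forall y x, 0 < y < r -> c <= x <= d ->
  `|cim (cauchy_transform mu (x -i* y)) - w x| <= e.

Let W x : R := \int[lebesgue_measure]_(t in `[c, x]) w t.

Let rcw x : c <= x <= d -> rcont (fun x => (w x)%:C) x.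
Proof. by move=> /cw; exact: rcontR. Qed.

Let W_derive x : c < x < d -> is_derive x 1 W (w x).
Proof.
move=> /andP[cx xd].
have mcd : measurable (cc c d) by exact: measurable_itv.
have [iw _] := bmeas_integrable mcd (leb_itv_fin c d) (rcont_bmeas rcw).
have [] := @continuous_FTC1_closed _ w c x d xd iw cx.
  by apply: cw; rewrite !ltW.
by move=> D; rewrite derive1E => E; exact: DeriveDef.
Qed.

Let W_itv a b : c <= a -> a <= b -> b <= d ->
  \int[lebesgue_measure]_(t in `[a, b]) w t = W b - W a.
Proof.
move=> ca ab bd.
have rc t : c <= t <= b -> rcont (fun x => (w x)%:C) t.
  by move=> /andP[ct tb]; apply: rcw; rewrite ct (le_trans tb).
by rewrite -[W b]/(cre (ci c b (fun x => (w x)%:C))) (ci_split ca ab rc) creD addrC addKr.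
Qed.

(** [atan_mass y - W] has the derivative [Im G - w], which is uniformly small, so that the mean
    value inequality suffices. *)
Let atan_W e : 0 < e -> exists2 r, 0 < r & forall y a b, 0 < y < r -> c < a -> a <= b -> b < d ->
  `|atan_mass y b - atan_mass y a - (W b - W a)| <= e * (b - a).
Proof.
move=> /wG[r r0 Hr]; exists r => // y a b /[dup] yr /andP[y0 _] ca ab bd.
have -> : atan_mass y b - atan_mass y a - (W b - W a) =
  (atan_mass y \- W) b - (atan_mass y \- W) a by rewrite /=; ring.
apply: (mvt_segment_le (df := fun x => cim (cauchy_transform mu (x -i* y)) - w x)) => // x /andP[ax xb].
  apply: is_deriveB; first exact: is_derive_atan_mass.
  by apply: W_derive; rewrite (lt_le_trans ca)// (le_lt_trans xb).
by apply: Hr => //; rewrite (le_trans (ltW ca))// (le_trans xb)// ltW.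
Qed.

(** Here and in [mass_ge], the interval is shrunk or enlarged by [h], so that possible atoms at the
    end points do not disturb the limit; [y] is then chosen so small that [h / y] is large and
    [atan_W] applies. *)
Let mass_le a b h : c < a -> a <= b -> b < d -> 0 < h ->
  pi * fine (mu (cc (a + h) (b - h))) <= W b - W a.
Proof.
move=> ca ab bd h0; apply/ler_addgt0Pr => e e0.
have /andP[m0 m1] := mu_le1 mu (@measurable_itv R `[a + h, b - h]).
set m := fine _ in m0 m1 *.
pose e' := e / (2 + (b - a)).
have D0 : 0 < 2 + (b - a) by lra.
have e'0 : 0 < e' by rewrite divr_gt0.
have [M M0 HM] := atan_ge_lim e'0; have [r r0 Hr] := atan_W e'0.
pose y := Num.min r (h / M) / 2.
have m0' : 0 < Num.min r (h / M) by rewrite lt_min r0 divr_gt0.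
have y0 : 0 < y by rewrite divr_gt0.
have [y1 y2] : y < r /\ y < h / M.
  have : Num.min r (h / M) <= r by rewrite ge_min lexx.
  have : Num.min r (h / M) <= h / M by rewrite ge_min lexx orbT.
  by rewrite /y; lra.
have Mh : M <= h / y by rewrite ler_pdivlMr// mulrC -ler_pdivlMr// ltW.
have := atan_mass_ge y0 ab h0 (HM _ Mh).
have := Hr y a b; rewrite y0 y1 => /(_ isT ca ab bd); rewrite ler_norml => /andP[_ H2] H1.
have E : e = 2 * e' + e' * (b - a) by rewrite /e'; field; rewrite gt_eqF.
have : e' * m <= e' by rewrite ler_piMr// ltW.
by rewrite -/m in H1; rewrite E; lra.
Qed.

Let mass_ge a b h : c < a -> a <= b -> b < d -> 0 < h ->
  W b - W a <= pi * fine (mu (cc (a - h) (b + h))).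
Proof.
move=> ca ab bd h0; apply/ler_addgt0Pr => e e0.
pose e' := e / (1 + (b - a)).
have D0 : 0 < 1 + (b - a) by lra.
have e'0 : 0 < e' by rewrite divr_gt0.
have [M M0 HM] := atan_ge_lim e'0; have [r r0 Hr] := atan_W e'0.
pose y := Num.min r (h / M) / 2.
have m0' : 0 < Num.min r (h / M) by rewrite lt_min r0 divr_gt0.
have y0 : 0 < y by rewrite divr_gt0.
have [y1 y2] : y < r /\ y < h / M.
  have : Num.min r (h / M) <= r by rewrite ge_min lexx.
  have : Num.min r (h / M) <= h / M by rewrite ge_min lexx orbT.
  by rewrite /y; lra.
have Mh : M <= h / y by rewrite ler_pdivlMr// mulrC -ler_pdivlMr// ltW.
have := atan_mass_le y0 ab h0 e'0 (HM _ Mh).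
have := Hr y a b; rewrite y0 y1 => /(_ isT ca ab bd); rewrite ler_norml => /andP[H2 _] H1.
have E : e = e' + e' * (b - a) by rewrite /e'; field; rewrite gt_eqF.
by rewrite E; lra.
Qed.

(** [W] is Lipschitz with constant [B], so moving both end points by [h] costs at most [2 B h]. In
    the lower bound for the mass the interval is first shrunk, hence the separate case [a = b]. *)
Lemma interval_mass a b : c < a -> a <= b -> b < d ->
  pi * fine (mu (cc a b)) = \int[lebesgue_measure]_(t in `[a, b]) w t.
Proof.
move=> ca ab bd; rewrite (W_itv (ltW ca) ab (ltW bd)).
have [_ _ [B HB]] := rcont_bmeas rcw.
have wB x : c <= x <= d -> `|w x| <= B.
  by move=> xcd; rewrite -cabsR; apply: HB; rewrite /= in_itv.
have WB x y : c < x -> x <= y -> y < d -> `|W y - W x| <= B * (y - x).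
  move=> cx xy yd; apply: (mvt_segment_le (df := w)) => // t /andP[xt ty].
    by apply: W_derive; rewrite (lt_le_trans cx)// (le_lt_trans ty).
  by apply: wB; rewrite (le_trans (ltW cx))// (le_trans ty)// ltW.
have B0 : 0 <= B by apply: le_trans (wB a _) => //; rewrite !ltW// (le_lt_trans ab).
have md : 0 < Num.min (a - c) (d - b) by rewrite lt_min !subr_gt0 ca.
have pick e h0 : 0 < e -> 0 < h0 -> exists h, [/\ 0 < h, h < h0, c < a - h, b + h < d & 2 * B * h <= e].
  move=> e0 h00; pose m := Num.min (Num.min (a - c) (d - b)) (Num.min h0 (e / (2 * B + 1))).
  have D0 : 0 < 2 * B + 1 by lra.
  have m0 : 0 < m by rewrite lt_min md lt_min h00 divr_gt0.
  have : m <= a - c by rewrite /m !ge_min lexx.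
  have : m <= d - b by rewrite /m !ge_min lexx orbT.
  have : m <= h0 by rewrite /m !ge_min lexx !orbT.
  have : m <= e / (2 * B + 1) by rewrite /m !ge_min lexx !orbT.
  rewrite ler_pdivlMr// => m1 m2 m3 m4; exists (m / 2); split; try lra.
apply/eqP; rewrite eq_le; apply/andP; split; apply/ler_addgt0Pr => e e0.
  have [h [h0 _ ch hd hB]] := pick e 1 e0 ltr01.
  have := @mass_le (a - h) (b + h) h ch ltac:(lra) hd h0.
  rewrite addrNK addrK => /le_trans; apply.
  have := WB b (b + h) ltac:(lra) ltac:(lra) hd; have := WB (a - h) a ch ltac:(lra) ltac:(lra).
  by rewrite !ler_norml => /andP[_ H1] /andP[_ H2]; lra.
have [->|nab] := eqVneq a b.
  rewrite subrr addr_ge0 ?(ltW e0)// mulr_ge0 ?pi_ge0//.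
  by have /andP[] := mu_le1 mu (@measurable_itv R `[b, b]).
have ab' : a < b by rewrite lt_neqAle nab.
have [h [h0 hab ch hd hB]] := pick e ((b - a) / 2) e0 ltac:(lra).
have := @mass_ge (a + h) (b - h) h ltac:(lra) ltac:(lra) ltac:(lra) h0.
rewrite addrK addrNK => H.
have := WB (b - h) b ltac:(lra) ltac:(lra) bd; have := WB a (a + h) ca ltac:(lra) ltac:(lra).
by rewrite !ler_norml => /andP[_ H1] /andP[_ H2]; lra.
Qed.

End BoundaryDensity.

End StieltjesInversion.

(** * Measures on a tail are determined by compact intervals *)

Section TailMeasure.
Context {R : realType}.
Local Notation mR := (measurableTypeR R).
Local Notation leb := (@lebesgue_measure R).
Local Notation cc a b := (`[a, b]%classic : set mR).
Implicit Types (a b c d x T : R) (A : set mR).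

Lemma density_measure (f : mR -> \bar R) : measurable_fun setT f ->
  (forall x, (0 <= f x)%E) ->
  exists m : {measure set mR -> \bar R}, forall A, m A = (\int[leb]_(x in A) f x)%E.
Proof.
move=> mf f0; pose nu A := (\int[leb]_(x in A) f x)%E.
have nu0 : nu set0 = 0%E by rewrite /nu integral_set0.
have nu_ge0 A : (0 <= nu A)%E by apply: integral_ge0.
have nuS : semi_sigma_additive nu := semi_sigma_additive_nng_induced mf f0.
pose m := isMeasure.Build _ _ _ nu nu0 nu_ge0 nuS.
pose M : {measure set mR -> \bar R} := HB.pack nu m.
by exists M.
Qed.

(** The half-lines [[x, +oo[] form a generating class stable under intersection; cut down to
    [[c, d]] they are the intervals that end at [d]. *)
Lemma eq_measure_itv (m1 m2 : {measure set mR -> \bar R}) c d :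
  (m1 (cc c d) < +oo)%E -> (forall a, c <= a -> a <= d -> m1 (cc a d) = m2 (cc a d)) ->
  forall A, measurable A -> m1 (A `&` cc c d) = m2 (A `&` cc c d).
Proof.
move=> foo E A mA; have mcd : measurable (cc c d) by exact: measurable_itv.
pose n1 : {measure set mR -> \bar R} := mrestr m1 mcd.
pose n2 : {measure set mR -> \bar R} := mrestr m2 mcd.
have H := @measure_unique _ R mR (@RGenCInfty.G R) (fun n => `[- n%:R, +oo[%classic).
apply: (H (@RGenCInfty.measurableE R) _ _ _ n1 n2) => //.
- move=> _ _ [x ->] [y ->]; exists (Num.max x y); apply/seteqP; split => z /=;
    rewrite !in_itv /= !andbT ge_max.
    by move=> [-> ->].
  by move=> /andP[].
- by move=> n; exists (- n%:R).
- apply/seteqP; split => x // _; exists (Num.truncn `|x|).+1 => //.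
  rewrite /= in_itv /= andbT lerNl; apply: le_trans (ltW (truncnS_gt _)).
  by rewrite -normrN ler_norm.
- move=> _ [x ->]; rewrite /n1 /n2 /= /mrestr.
  have -> : `[x, +oo[%classic `&` cc c d = cc (Num.max x c) d.
    apply/seteqP; split => z /=; rewrite !in_itv /= andbT ge_max.
      by move=> [-> /andP[-> ->]].
    by move=> /andP[/andP[-> ->] ->].
  have [h|h] := leP (Num.max x c) d; first by rewrite E// le_max lexx orbT.
  by rewrite set_itv_ge ?measure0// bnd_simp -ltNge.
- move=> n; rewrite /n1 /= /mrestr; apply: le_lt_trans foo.
  by apply: le_measure; rewrite ?inE//; apply: measurableI => //; exact: measurable_itv.
Qed.

Lemma measurable_tail T : measurable (tail T : set mR).
Proof.
have -> : (tail T : set mR) = ~` `]- T, T[%classic.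
  apply/seteqP; split => x; rewrite /tail /= in_itv /= -ltr_norml leNgt.
    by move=> /negP.
  by move=> /negP.
by apply: measurableC; exact: measurable_itv.
Qed.

Lemma tail_itv_cover T A : 0 < T ->
  A `&` tail T = \bigcup_n (A `&` (cc (- (T + n%:R)) (- T) `|` cc T (T + n%:R))).
Proof.
move=> T0; apply/seteqP; split => x.
  move=> [Ax]; rewrite /tail /= => Tx; exists (Num.truncn `|x|).+1 => //; split => //.
  have xn := ltW (truncnS_gt `|x|).
  have [x0|x0] := leP 0 x; [right|left]; rewrite /= in_itv /=.
    by move: Tx xn; rewrite ger0_norm// => -> xn /=; rewrite ler_wpDl// ltW.
  move: Tx xn; rewrite ltr0_norm// => Tx xn; rewrite lerNr Tx lerNl.
  by rewrite ler_wpDl// ltW.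
move=> [n _ [Ax xn]]; split => //; rewrite /tail /=.
by case: xn; rewrite /= in_itv /= => /andP[h1 h2]; rewrite ler_normr ?h1 // lerNr h2 orbT.
Qed.

(** The tail is exhausted by pairs of compact intervals, on which [eq_measure_itv] applies;
    continuity from below does the rest. *)
Lemma eq_measure_tail (m1 m2 : {measure set mR -> \bar R}) T : 0 < T ->
  (forall a b, a <= b -> T <= a \/ b <= - T -> (m1 (cc a b) < +oo)%E /\ m1 (cc a b) = m2 (cc a b)) ->
  forall A, measurable A -> m1 (A `&` tail T) = m2 (A `&` tail T).
Proof.
move=> T0 E A mA; rewrite tail_itv_cover//; set F := fun n : nat => _.
have mF n : measurable (F n).
  by apply: measurableI => //; apply: measurableU; exact: measurable_itv.
have mUF : measurable (\bigcup_n F n) by exact: bigcup_measurable.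
have hF : {homo F : n m / (n <= m)%N >-> (n <= m)%O}.
  move=> n m nm; have nm' : n%:R <= m%:R :> R by rewrite ler_nat.
  apply/subsetPset; apply: setIS; apply: setUSS => x; rewrite /= !in_itv /= => /andP[h1 h2].
    by rewrite h2 andbT; apply: le_trans h1; rewrite lerN2 lerD2l.
  by rewrite h1 (le_trans h2)// lerD2l.
have c1 := nondecreasing_cvg_mu (mu := m1) mF mUF hF.
have c2 := nondecreasing_cvg_mu (mu := m2) mF mUF hF.
suff E12 : m1 \o F = m2 \o F.
  by move: c1; rewrite E12 => c1; apply: (@cvg_unique _ (@ereal_hausdorff R) _ _ _ _ c1 c2).
apply/funext => n /=.
have D : [disjoint A `&` cc (- (T + n%:R)) (- T) & A `&` cc T (T + n%:R)]%classic.
  apply/disj_setPS => x [[_ +] [_ +]]; rewrite /= !in_itv /= => /andP[_ h1] /andP[h2 _].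
  by have := le_trans h2 h1; lra.
have n0 : 0 <= n%:R :> R by [].
rewrite /F setIUr !measureU ?(eqP D)//; try by apply: measurableI => //; exact: measurable_itv.
congr (_ + _)%E; apply: eq_measure_itv => //.
- by apply: (E _ _ _ _).1; [lra|right].
- by move=> a h1 h2; apply: (E _ _ _ _).2; [|right].
- by apply: (E _ _ _ _).1; [lra|left].
- by move=> a h1 h2; apply: (E _ _ _ _).2; [|left].
Qed.

(** Extended by 0 off the tail, [q] is the density of a measure, which is compared with [mu] on
    compact intervals. *)
Lemma tail_measure_density (mu : probability mR R) T (q : R -> R) : 0 < T ->
  (forall x, tail T x -> {for x, continuous q}) -> (forall x, tail T x -> 0 <= q x) ->
  (forall a b, a <= b -> T <= a \/ b <= - T ->
     fine (mu (cc a b)) = \int[leb]_(x in cc a b) q x) ->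
  forall A, measurable A -> mu (A `&` tail T) = (\int[leb]_(x in A `&` tail T) (q x)%:E)%E.
Proof.
move=> T0 cq q0 E A mA; have mT := measurable_tail T.
have mq : measurable_fun (tail T : set mR) q.
  apply: subspace_continuous_measurable_fun => //.
  by apply: continuous_in_subspaceT => x /set_mem /cq.
pose f := (EFin \o q) \_ (tail T : set mR).
have mf : measurable_fun setT f.
  by apply/(measurable_restrictT _ mT)/measurable_EFinP.
have f0 x : (0 <= f x)%E.
  by rewrite /f patchE; case: ifPn => // /set_mem /q0; rewrite lee_fin.
have [m Hm] := density_measure mf f0.
have mE B : B `<=` tail T -> m B = (\int[leb]_(x in B) (q x)%:E)%E.
  move=> BT; rewrite Hm; apply: eq_integral => x /set_mem /BT xT.
  by rewrite /f patchE mem_set.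
rewrite -mE; last by move=> x [].
apply: (@eq_measure_tail mu m) => // a b ab abT; split.
  exact: mu_fin (measurable_itv _).
have sub : cc a b `<=` tail T.
  move=> x; rewrite /tail /= in_itv /= => /andP[h1 h2]; rewrite ler_normr.
  case: abT => h; first by rewrite (le_trans h).
  by rewrite lerNr (le_trans h2) ?orbT.
have mab : measurable (cc a b) by exact: measurable_itv.
have rq t : a <= t <= b -> rcont (fun x => (q x)%:C) t.
  by move=> tab; apply: rcontR; apply: cq; apply: sub; rewrite /= in_itv.
have [iq _] := bmeas_integrable mab (leb_itv_fin a b) (rcont_bmeas rq).
have nf : mu (cc a b) \is a fin_num by rewrite ge0_fin_numE// mu_fin.
apply: (etrans (esym (fineK nf))); rewrite mE// E// /Rintegral fineK//.
by have := integrable_fin_num mab iq.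
Qed.

End TailMeasure.

(** * The density on the tail given by a continuation *)

Section TailOfContinuation.
Context {R : realType}.
Variables (mu : probability (measurableTypeR R) R) (r : R) (g : R[i] -> R[i]).
Hypotheses (r0 : 0 < r) (cg : continuation upper_half (G_at_inv mu) r g).
Implicit Types (a b c d e x y T : R).
Local Notation mR := (measurableTypeR R).

Let dg z : cabs z < r -> cdiff g z.
Proof. by have [+ _ _] := continuation_at0 r0 cg; apply. Qed.

Let co := taylor_coef g r.

Lemma sum_from2 (u : nat -> R) N : u 0 = 0 -> u 1%N = 0 ->
  \sum_(2 <= n < N) u n = \sum_(n < N) u n.
Proof.
move=> u0 u1; case: N => [|[|N]]; first by rewrite big_geq// big_ord0.
  by rewrite big_geq// big_ord1.
by rewrite -[RHS](big_mkord xpredT) [RHS]big_ltn// [in RHS]big_ltn// u0 u1 !add0r.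
Qed.

Let co0 : co 0 = 0.
Proof.
have [_ g0 _] := continuation_at0 r0 cg.
have := taylor_csum r0 dg (z := 0) ltac:(by rewrite cabs0); rewrite g0 -/co => H.
apply: csum_unique H => e e0; exists 1%N => -[//|n] _.
rewrite big_ord_recl /= expr0 mulr1 big1 ?addr0 ?subrr ?cabs0// => i _.
by rewrite /= exprS mul0r mulr0.
Qed.

Let co1 : co 1 = 1.
Proof. by have [_ g0 g1] := continuation_at0 r0 cg; exact: taylor_coef1. Qed.

(** For real [x] the imaginary part passes to the coefficients of [g (1 / x)]. As [g] begins with
    [0 + z], those of index 0 and 1 vanish, and the series starts at 2. *)
Definition density_coef n : R := cim (co n) / pi.
Definition boundary_density x : R := cim (g (x^-1)%:C) / pi.

Let xr_inv x : r^-1 < `|x| -> cabs (x^-1)%:C < r.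
Proof.
move=> xr; rewrite cabsR normfV -[ltRHS]invrK ltf_pV2 ?posrE ?invr_gt0//.
by apply: lt_trans xr; rewrite invr_gt0.
Qed.

Let sum_coefE x N : \sum_(2 <= n < N) density_coef n / x ^+ n =
  cim (\sum_(k < N) co k * (x^-1)%:C ^+ k) / pi.
Proof.
rewrite sum_from2; [|by rewrite /density_coef co0 cim0 !mul0r|by rewrite /density_coef co1 cim1 !mul0r].
elim: N => [|N IH]; first by rewrite !big_ord0 mul0r.
rewrite !big_ord_recr /= IH cimD mulrDl; congr (_ + _).
rewrite -rmorphXn /density_coef cimM cimR creR mulr0 add0r exprVn.
by rewrite mulrAC [in RHS]mulrC [LHS]mulrC mulrA; congr (_ * _).
Qed.

Lemma inv_series_cvg x : r^-1 < `|x| ->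
  (fun N => \sum_(2 <= n < N) density_coef n / x ^+ n) @ \oo --> boundary_density x.
Proof.
move=> xr; have H := taylor_csum r0 dg (xr_inv xr).
apply/cvgrPdist_lt => e e0; have [N HN] := H _ (mulr_gt0 e0 (pi_gt0 R)).
exists N => // n /= /HN Hn; rewrite sum_coefE distrC /boundary_density -mulrBl.
rewrite normrM normfV [X in _ / X]gtr0_norm ?pi_gt0// ltr_pdivrMr ?pi_gt0//.
by rewrite -cimB; apply: le_lt_trans Hn; exact: cim_le.
Qed.

Lemma inv_seriesE x : r^-1 < `|x| -> inv_series density_coef x = boundary_density x.
Proof. by move=> /inv_series_cvg H; exact: cvg_lim H. Qed.

Lemma inv_series_abs_cvg x : r^-1 < `|x| ->
  cvgn (fun N => \sum_(2 <= n < N) `|density_coef n / x ^+ n|).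
Proof.
move=> xr; have x0 : 0 < `|x| by apply: lt_trans xr; rewrite invr_gt0.
have xr' := xr_inv xr; rewrite cabsR normfV in xr'.
pose rho := (`|x|^-1 + r) / 2.
have ix0 : 0 < `|x|^-1 by rewrite invr_gt0.
have rho0 : 0 < rho < r by rewrite /rho; apply/andP; split; lra.
have xrho : `|x|^-1 < rho by rewrite /rho; lra.
have [M [M0 s0 HM]] := taylor_cbound r0 dg rho0.
have /andP[rhop _] := rho0.
pose s := rho^-1 * `|x|^-1.
have s01 : 0 <= s < 1.
  rewrite mulr_ge0 ?(ltW ix0) ?invr_ge0 ?(ltW rhop)//=.
  by rewrite /s mulrC ltr_pdivrMr// mul1r.
apply: nondecreasing_is_cvgn.
  apply/nondecreasing_seqP => n; have [n2|n2] := leqP 2 n.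
    by rewrite big_nat_recr//= lerDl.
  by rewrite !big_geq//; apply: leq_trans n2.
exists (M / pi * (1 - s)^-1) => _ [N _ <-].
apply: le_trans (_ : \sum_(n < N) M / pi * s ^+ n <= _); last first.
  rewrite -mulr_sumr ler_wpM2l ?geo_sum_le//.
  by rewrite divr_ge0 ?pi_ge0.
rewrite sum_from2; [|by rewrite /density_coef co0 cim0 !mul0r normr0|by rewrite /density_coef co1 cim1 !mul0r normr0].
apply: ler_sum => n _; rewrite /density_coef !normrM !normfV normrX (gtr0_norm (pi_gt0 R)).
rewrite exprMn exprVn -!mulrA mulrCA [leRHS]mulrCA ler_wpM2l ?invr_ge0 ?pi_ge0//.
rewrite mulrA [_^-1 ^+ n]exprVn ler_wpM2r ?invr_ge0 ?exprn_ge0//.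
by apply: le_trans (cim_le _) _; rewrite -exprVn.
Qed.

Let G_inv y x : 0 < y -> r^-1 < `|x| -> cauchy_transform mu (x -i* y) = g (x -i* y)^-1.
Proof.
move=> y0 xr; have x0 : 0 < `|x| by apply: lt_trans xr; rewrite invr_gt0.
rewrite cg.2 /G_at_inv ?invrK//.
  rewrite -[upper_half _]/(is_true (0 < cim (x -i* y)^-1)) cimV (_ : cim (x -i* y) = - y)// opprK divr_gt0// exprn_gt0// cabs_gt0.
  by apply/eqP => /(congr1 cre) /= x00; rewrite x00 normr0 ltxx in x0.
rewrite /disc /= cabsV -[ltRHS]invrK ltf_pV2 ?posrE ?invr_gt0//.
  exact: lt_le_trans xr (cre_le (x -i* y)).
exact: lt_le_trans x0 (cre_le (x -i* y)).
Qed.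

(** Multiplication by [- i] sends [y + i x] to [x - i y]: the approach to the real axis from below
    becomes a variation of the real part, the form required by [tube]. *)
Let axis_cont x : r^-1 < `|x| -> ccont (fun z => g (- 'i%C * z)^-1) (0 +i* x).
Proof.
move=> xr; have x0 : x != 0 by rewrite -normr_gt0 (lt_trans _ xr)// invr_gt0.
have E : - 'i%C * (0 +i* x) = x%:C :> R[i] by apply: ceqP; rewrite !creimE /=; ring.
have C : ccont (fun z => (- 'i%C * z)^-1) (0 +i* x).
  apply: ccontV; first by rewrite E Rc_eq0.
  by apply: ccontM; [exact: ccont_cst|exact: ccont_id].
apply: (ccont_comp (g := g) C); apply: cdiff_cont; apply: dg.
by rewrite E -fmorphV; exact: xr_inv.
Qed.

Let axisE y x : - 'i%C * (y +i* x) = x -i* y :> R[i].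
Proof. by apply: ceqP; rewrite !creimE /=; ring. Qed.

Let boundary_limit c d e : 0 < e -> (forall x, c <= x <= d -> r^-1 < `|x|) ->
  exists2 h, 0 < h & forall y x, 0 < y < h -> c <= x <= d ->
    `|cim (cauchy_transform mu (x -i* y)) - cim (g (x^-1)%:C)| <= e.
Proof.
move=> e0 xr.
have [h h0 H] := @tube _ (fun z => g (- 'i%C * z)^-1) 0 c d (fun x xcd => axis_cont (xr x xcd)) e e0.
exists h => // y x /andP[y0 yh] xcd.
have := H y x; rewrite subr0 gtr0_norm// => /(_ yh xcd); rewrite !axisE => /ltW.
rewrite G_inv ?xr// -cimB oppr0 (_ : (x +i* 0)^-1 = (x^-1)%:C); last by rewrite fmorphV.
by apply: le_trans; exact: cim_le.
Qed.

(** A limit of values of [Im G] in the lower half plane, which are integrals of the positive Poisson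
    kernel. *)
Lemma boundary_density_ge0 x : r^-1 < `|x| -> 0 <= boundary_density x.
Proof.
move=> xr; apply: divr_ge0; last exact: pi_ge0.
apply/ler_addgt0Pr => e e0.
have [|h h0 H] := @boundary_limit x x e e0; first by move=> z; rewrite -eq_le => /eqP <-.
have := H (h / 2) x; rewrite lexx divr_gt0// ltr_pdivrMr// ltr_pMr// ltr1n.
move=> /(_ isT isT); rewrite ler_norml => /andP[_].
have : 0 <= cim (cauchy_transform mu (x -i* (h / 2))).
  apply: Rintegral_ge0 => // t _; rewrite poisson_kernel ?divr_gt0//.
  by rewrite mulr_ge0 ?invr_ge0 ?divr_ge0 ?(ltW h0)// addr_ge0// sqr_ge0.
lra.
Qed.

Lemma continuous_boundary x : r^-1 < `|x| -> {for x, continuous (fun x => cim (g (x^-1)%:C))}.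
Proof.
move=> xr; have x0 : x != 0 by rewrite -normr_gt0 (lt_trans _ xr)// invr_gt0.
have : rcont (fun x : R => (x^-1)%:C) x by apply: rcontR; exact: inv_continuous.
by move=> /rcont_comp/(_ (cdiff_cont (dg (xr_inv xr))))[].
Qed.

Lemma tail_density_of_continuation T : r^-1 < T -> tail_density mu T density_coef.
Proof.
move=> rT; have ir0 : 0 < r^-1 by rewrite invr_gt0.
have T0 : 0 < T by apply: lt_trans rT.
have tr x : tail T x -> r^-1 < `|x| by rewrite /tail /=; exact: lt_le_trans.
split=> [x /tr /inv_series_cvg H|A mA]; first by apply/cvg_ex; exists (boundary_density x).
rewrite (tail_measure_density (q := boundary_density) T0) => //.
- apply: eq_integral => x /set_mem [_ /tr xr].
  by rewrite inv_seriesE.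
- move=> x /tr /continuous_boundary H; apply: cvgM => //; exact: cvg_cst.
- by move=> x /tr; exact: boundary_density_ge0.
move=> a b ab abT.
(* [interval_mass] needs some room around [[a, b]], which [r^-1 < T] provides. *)
have [c [d [ca bd cd]]] : exists c d, [/\ c < a, b < d & forall x, c <= x <= d -> r^-1 < `|x|].
  case: abT => h.
    exists ((T + r^-1) / 2), (b + 1); split; [lra|lra|move=> x /andP[cx _]].
    by apply: lt_le_trans (ler_norm _); lra.
  exists (a - 1), (- ((T + r^-1) / 2)); split; [lra|lra|move=> x /andP[_ xd]].
  by rewrite -normrN; apply: lt_le_trans (ler_norm _); lra.
have H1 x : c <= x <= d -> {for x, continuous (fun x => cim (g (x^-1)%:C))}.
  by move=> /cd; exact: continuous_boundary.
have H := interval_mass H1 (fun e pe => @boundary_limit c d e pe cd) ca ab bd.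
apply: (mulfI (lt0r_neq0 (pi_gt0 R))); rewrite H.
have rc t : a <= t <= b -> rcont (fun x => (boundary_density x)%:C) t.
  move=> /andP[at_ tb]; apply: rcontR; apply: cvgM; last exact: cvg_cst.
  by apply: continuous_boundary; apply: cd; lra.
have /(congr1 cre) := ciZ pi%:C rc; rewrite [RHS]creM creR cimR mul0r subr0 => <-.
apply: eq_Rintegral => x _ /=; rewrite mul0r subr0.
by rewrite /boundary_density mulrCA divff ?mulr1// lt0r_neq0// pi_gt0.
Qed.

Lemma class_P1_of_continuation : class_P1 mu.
Proof.
have ir0 : 0 < r^-1 by rewrite invr_gt0.
pose T := r^-1 + 1; have rT : r^-1 < T by rewrite /T; lra.
have tr x : tail T x -> r^-1 < `|x| by rewrite /tail /=; exact: lt_le_trans.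
have mC : measurable (~` (tail T) : set mR) by apply: measurableC; exact: measurable_tail.
pose nu : {measure set mR -> \bar R} := mrestr mu mC.
exists nu, r^-1, T, density_coef; split.
- exists `[- T, T]%classic; first exact: segment_compact.
  rewrite /nu /= /mrestr (_ : _ `&` _ = set0) ?measure0//.
  apply/seteqP; split => // x []; rewrite /tail /= in_itv /= -ler_norml => /negP h.
  by apply; rewrite ltW// ltNge.
- by rewrite ir0.
- by move=> x; exact: inv_series_abs_cvg.
- by move=> x /tr xr; rewrite inv_seriesE// boundary_density_ge0.
- move=> A mA; have [_ <-//] := tail_density_of_continuation rT.
  rewrite /nu /= /mrestr -measureU.
  + by rewrite -setIUr setUC setUv setIT.
  + exact: measurableI.
  + by apply: measurableI => //; exact: measurable_tail.
  + by rewrite setIACA setIid setICl setI0.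
Qed.

End TailOfContinuation.

(** * From a density on the tail to an entire extension *)

Section ChangeOfMeasure.
Context {R : realType}.
Local Notation mR := (measurableTypeR R).
Local Notation leb := (@lebesgue_measure R).
Local Notation cc a b := (`[a, b]%classic : set mR).
Variable mu : probability mR R.
Implicit Types (a b c x T : R) (A D : set mR).

(** The restriction of [mu] to [D] is dominated by Lebesgue measure, and its Radon-Nikodym
    derivative agrees with [q] almost everywhere on [D], having the same integrals over measurable
    subsets. *)
Lemma integral_density D (q : R -> R) (f : mR -> \bar R) : measurable D ->
  measurable_fun D q -> (forall A, measurable A -> A `<=` D -> mu A = (\int[leb]_(x in A) (q x)%:E)%E) ->
  mu.-integrable D f ->
  (\int[mu]_(x in D) f x = \int[leb]_(x in D) (f x * (q x)%:E))%E.
Proof.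
move=> mD mq Hq fi.
pose nu : {finite_measure set mR -> \bar R} := mfrestr mD (mu_fin mu mD).
have nuE A : measurable A -> A `<=` D -> nu A = mu A.
  by move=> mA AD; rewrite /nu /= /mfrestr /mrestr setIidl.
have numu (g : mR -> \bar R) : (\int[nu]_(x in D) g x = \int[mu]_(x in D) g x)%E.
  exact: eq_measure_integral.
have dom : nu `<< leb.
  apply/null_content_dominatesP => A mA A0; rewrite /nu /= /mfrestr /mrestr.
  have mAD : measurable (A `&` D) by exact: measurableI.
  rewrite Hq//.
  apply: null_set_integral => //.
    apply/measurable_EFinP; exact: measurable_funS mq.
  by apply/eqP; rewrite eq_le measure_ge0 andbT -A0 le_measure ?inE//; exact: subIsetl.
have fnu : nu.-integrable D f.
  have /integrableP[mf foo] := fi; apply/integrableP; split => //.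
  by rewrite numu.
rewrite -numu -(Radon_Nikodym_change_of_variables dom mD fnu).
have mf := measurable_int _ fi.
have RNi := Radon_Nikodym_integrable (nu := charge_of_finite_measure nu) dom.
have mRN : measurable_fun D (Radon_Nikodym (charge_of_finite_measure nu) leb).
  exact: measurable_funTS (measurable_int _ RNi).
have mqE : measurable_fun D (EFin \o q) by exact/measurable_EFinP.
apply: ae_eq_integral => //.
- exact: emeasurable_funM.
- exact: emeasurable_funM.
have H : ae_eq leb D (Radon_Nikodym (charge_of_finite_measure nu) leb) (EFin \o q).
  apply: integral_ae_eq => //; first exact: integrableS RNi.
  move=> A AD mA.
  by rewrite -(Radon_Nikodym_integral (nu := charge_of_finite_measure nu) dom mA) /= nuE// Hq.
by apply: filterS H => x Hx Dx /=; rewrite Hx.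
Qed.

Lemma cint_density D (q : R -> R) F : measurable D -> measurable_fun D q ->
  (forall A, measurable A -> A `<=` D -> mu A = (\int[leb]_(x in A) (q x)%:E)%E) ->
  bmeas D F -> cint mu D F = cint leb D (fun x => F x * (q x)%:C).
Proof.
move=> mD mq Hq bF; have [i1 i2] := bmeas_integrable mD (mu_fin mu mD) bF.
apply: ceqP; rewrite /cint /= /Rintegral (integral_density mD mq Hq) //.
- by congr fine; apply: eq_integral => x _; rewrite -EFinM creM creR cimR mulr0 subr0.
- by congr fine; apply: eq_integral => x _; rewrite -EFinM cimM creR cimR mulr0 add0r.
Qed.

Lemma ci_expR a b (F : R -> R[i]) : a <= b ->
  (forall x, expR a <= x <= expR b -> rcont F x) ->
  ci (expR a) (expR b) F = ci a b (fun u => F (expR u) * (expR u)%:C).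
Proof.
move=> ab cF.
have dE : (@expR R)^`()%classic = expR by apply/funext => x; rewrite derive1E derive_val.
have H (G : R -> R) : (forall x, expR a <= x <= expR b -> {for x, continuous G}) ->
    \int[leb]_(x in `[expR a, expR b]) G x = \int[leb]_(x in `[a, b]) (G (expR x) * expR x).
  move=> cG; congr fine; rewrite (@integration_by_substitution_increasing _ expR)//.
  - by apply: eq_integral => x _; rewrite dE.
  - by move=> x y _ _; rewrite ltr_expR.
  - by rewrite dE => x _; exact: continuous_expR.
  - by rewrite dE; apply/cvg_ex; exists (expR a); apply: cvg_at_right_filter; exact: continuous_expR.
  - by rewrite dE; apply/cvg_ex; exists (expR b); apply: cvg_at_left_filter; exact: continuous_expR.
  - split => //.
    + by apply: cvg_at_right_filter; exact: continuous_expR.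
    + by apply: cvg_at_left_filter; exact: continuous_expR.
  - by apply: continuous_in_subspaceT => x /set_mem /=; rewrite in_itv /= => /cG.
apply: ceqP; rewrite /ci /cint /= H.
- by apply: eq_Rintegral => x _; rewrite creM creR cimR mulr0 subr0.
- by move=> x /cF[].
- by apply: eq_Rintegral => x _; rewrite cimM creR cimR mulr0 add0r.
- by move=> x /cF[].
Qed.

Lemma ci_opp a b (F : R -> R[i]) : a <= b ->
  (forall x, - b <= x <= - a -> rcont F x) ->
  ci (- b) (- a) F = ci a b (fun x => F (- x)).
Proof.
move=> ab cF.
have H (G : R -> R) : (forall x, - b <= x <= - a -> {for x, continuous G}) ->
    \int[leb]_(x in `[- b, - a]) G x = \int[leb]_(x in `[a, b]) G (- x).
  move=> cG; congr fine; rewrite integration_by_substitution_oppr//.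
  by apply: continuous_in_subspaceT => x /set_mem /=; rewrite in_itv /= => /cG.
by apply: ceqP; rewrite /ci /cint /= H// => x /cF[].
Qed.

End ChangeOfMeasure.

(** * Integrals of exponentials in a complex parameter *)

Section ExponentialIntegral.
Context {R : realType} d (T : measurableType d) (m : {measure set T -> \bar R}).
Variables (D : set T) (k phi : T -> R[i]) (K S : R).
Hypotheses (mD : measurable D) (Doo : (m D < +oo)%E) (bk : bmeas D k) (bphi : bmeas D phi).
Hypotheses (K0 : 0 <= K) (S0 : 0 <= S).
Hypotheses (kK : forall x, D x -> cabs (k x) <= K) (phiS : forall x, D x -> cabs (phi x) <= S).

Lemma bmeas_cexp (f : T -> R[i]) : bmeas D f -> bmeas D (fun x => cexp (f x)).
Proof.
move=> [f1 f2 [B fB]].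
have mE : measurable_fun D (fun x => expR (cre (f x))).
  exact: (measurableT_comp (@measurable_expR R) f1).
have mcos : measurable_fun D (fun x => cos (cim (f x))).
  apply: (measurableT_comp _ f2); apply: continuous_measurable_fun; exact: continuous_cos.
have msin : measurable_fun D (fun x => sin (cim (f x))).
  apply: (measurableT_comp _ f2); apply: continuous_measurable_fun; exact: continuous_sin.
split.
- rewrite (_ : _ \o _ = (fun x => expR (cre (f x))) \* (fun x => cos (cim (f x)))).
    exact: measurable_funM.
  by apply/funext => x; rewrite /comp /cexp creM creR cimR mul0r subr0.
- rewrite (_ : _ \o _ = (fun x => expR (cre (f x))) \* (fun x => sin (cim (f x)))).
    exact: measurable_funM.
  by apply/funext => x; rewrite /comp /cexp cimM creR cimR mul0r addr0.
- by exists (expR B) => x /fB; rewrite -ler_expR; apply: le_trans; exact: cabs_cexp_le.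
Qed.

(** Both pieces of the entire extension have this form; the exponential rate is the bound [S] of
    [phi]. *)
Definition exp_integral z := cint m D (fun x => k x * cexp (z * phi x)).

Let bF z : bmeas D (fun x => k x * cexp (z * phi x)).
Proof. by apply: bmeasM => //; apply: bmeas_cexp; exact: bmeasZ. Qed.

Let cabs_exp_le z x : D x -> cabs (cexp (z * phi x)) <= expR (S * cabs z).
Proof.
move=> Dx; apply: le_trans (cabs_cexp_le _) _; rewrite ler_expR cabsM mulrC.
by rewrite ler_wpM2r ?cabs_ge0// phiS.
Qed.

Lemma exp_integral_le z : cabs (exp_integral z) <= 2 * K * fine (m D) * expR (S * cabs z).
Proof.
rewrite mulrAC -[2 * K * _]mulrA; apply: cint_le => // x Dx.
by rewrite cabsM ler_pM ?cabs_ge0 ?kK ?cabs_exp_le.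
Qed.

Lemma exp_integral_cdiff z : cdiff exp_integral z.
Proof.
exists (cint m D (fun x => k x * cexp (z * phi x) * phi x)).
have S1 : 0 < (S + 1)^-1 by rewrite invr_gt0 ltr_wpDl.
pose M := K * expR (S * cabs z) * (15 * S ^+ 2).
have M0 : 0 <= M by rewrite !mulr_ge0 ?expR_ge0 ?exprn_ge0.
apply: (cint_deriv (F := fun z x => k x * cexp (z * phi x)) mD Doo S1 M0) => //.
  exact: bmeasM.
move=> h hS x Dx.
have -> : k x * cexp ((z + h) * phi x) - k x * cexp (z * phi x) - k x * cexp (z * phi x) * phi x * h =
    k x * cexp (z * phi x) * (cexp (h * phi x) - 1 - h * phi x).
  by rewrite mulrDl cexpD; ring.
have hp : cabs (h * phi x) <= S * cabs h.
  by rewrite cabsM mulrC ler_wpM2r ?cabs_ge0 ?phiS.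
have h1 : S * cabs h <= 1.
  move: hS; rewrite -div1r ltr_pdivlMr ?ltr_wpDl// mulrDr mulr1 => /ltW; apply: le_trans.
  by rewrite mulrC lerDl cabs_ge0.
rewrite /M cabsM [cabs (k x * _)]cabsM -[leRHS]mulrA; apply: ler_pM; rewrite ?mulr_ge0 ?cabs_ge0//.
  by apply: ler_pM; rewrite ?cabs_ge0 ?kK ?cabs_exp_le.
rewrite (le_trans (cexp_approx (le_trans hp h1)))// -mulrA -exprMn ler_wpM2l//.
by rewrite lerXn2r// ?nnegrE ?cabs_ge0// mulr_ge0 ?cabs_ge0.
Qed.

End ExponentialIntegral.

(** * The inverse power series at complex arguments *)

Section InverseSeries.
Context {R : realType}.
Variables (T : R) (a : nat -> R).
Hypotheses (T0 : 0 < T) (cvgT : cvgn (fun N => \sum_(2 <= n < N) a n / T ^+ n)).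
Implicit Types (x t L : R).

Definition inv_coef n : R[i] := if (n < 2)%N then 0 else (a n)%:C.

(** Convergence at the single point [T] bounds the partial sums, hence the terms [a n / T^n], which
    gives convergence at all complex [z] with [|z| > T]. *)
Lemma inv_coef_cbound : exists M, cbound inv_coef M T.
Proof.
have /pinfty_ex_gt0[B B0 /= HB] := cvg_seq_bounded cvgT.
exists (2 * B); split; [by rewrite mulr_ge0// ltW|exact: ltW|move=> n].
rewrite /inv_coef; case: ltnP => n2; first by rewrite cabs0 !mulr_ge0 ?exprn_ge0 ?(ltW B0) ?(ltW T0).
rewrite cabsR -ler_pdivrMr ?exprn_gt0// -{1}(ger0_norm (exprn_ge0 n (ltW T0))) -normfV -normrM.
have -> : a n / T ^+ n = \sum_(2 <= n < n.+1) a n / T ^+ n - \sum_(2 <= n < n) a n / T ^+ n.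
  by rewrite big_nat_recr//= addrAC subrr add0r.
by rewrite (le_trans (ler_normB _ _))// mulr2n mulrDl mul1r lerD// HB.
Qed.

Definition inv_sum (z : R[i]) := psum inv_coef z^-1.

Let invlt (z : R[i]) : T < cabs z -> T * cabs z^-1 < 1.
Proof. by move=> Tz; rewrite cabsV ltr_pdivrMr ?mul1r// (lt_trans T0). Qed.

Lemma inv_sum_cdiff z : T < cabs z -> cdiff inv_sum z.
Proof.
move=> Tz; have z0 : z != 0 by rewrite -cabs_gt0 (lt_trans T0).
have [M cb] := inv_coef_cbound.
apply: (@cdiff_comp _ (fun z => z^-1) (psum inv_coef)); first by apply: cdiffV => //; exact: cdiff_id.
by eexists; apply: (psum_deriv cb); exact: invlt.
Qed.

(** The series starts at 2, hence the decay like [|z|^-2], by which the integral over a large half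
    circle of radius [L] is of order [1 / L]. *)
Lemma inv_sum_le T' : T < T' -> exists2 K, 0 <= K & forall z, T' <= cabs z ->
  cabs (inv_sum z) * cabs z ^+ 2 <= K.
Proof.
move=> TT'; have T'0 := lt_trans T0 TT'; have [M cb] := inv_coef_cbound.
have [M0 _ _] := cb.
have q1 : 0 < 1 - T / T' by rewrite subr_gt0 ltr_pdivrMr// mul1r.
exists (M * T ^+ 2 / (1 - T / T')).
  by rewrite !mulr_ge0 ?invr_ge0 ?exprn_ge0// ltW.
move=> z zT'; have z0 := lt_le_trans T'0 zT'.
have Tz := lt_le_trans TT' zT'.
have [_ /(_ 2%N)] := cbound_csum cb (invlt Tz).
rewrite !big_ord_recr big_ord0 /= /inv_coef /= !mul0r !addr0 subr0 -/inv_coef => H.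
rewrite -ler_pdivlMr ?exprn_gt0//; apply: le_trans H _.
have q2 : 0 < 1 - T / cabs z by rewrite subr_gt0 ltr_pdivrMr// mul1r.
rewrite cabsV exprMn exprVn mulrA [leRHS]mulrAC ler_wpM2l//.
  by rewrite !mulr_ge0 ?invr_ge0 ?exprn_ge0// ltW.
rewrite lef_pV2 ?posrE//.
by rewrite lerB// ler_wpM2l ?(ltW T0)// lef_pV2 ?posrE.
Qed.

Lemma inv_sumR x : T < `|x| -> inv_sum x%:C = (inv_series a x)%:C.
Proof.
move=> Tx; have [M cb] := inv_coef_cbound.
have Tx' : T < cabs x%:C by rewrite cabsR.
have [+ _] := cbound_csum cb (invlt Tx'); rewrite -/(inv_sum x%:C) => H.
have E N : \sum_(k < N) inv_coef k * x%:C^-1 ^+ k = (\sum_(2 <= n < N) a n / x ^+ n)%:C.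
  case: N => [|[|N]]; first by rewrite big_ord0 big_geq.
    by rewrite big_ord1 big_geq// (_ : inv_coef 0 = 0)// mul0r.
  rewrite -[LHS](big_mkord xpredT (fun k => inv_coef k * x%:C^-1 ^+ k)).
  rewrite big_ltn// [X in _ + X]big_ltn// (_ : inv_coef 0 = 0)// (_ : inv_coef 1 = 0)//.
  rewrite !mul0r !add0r rmorph_sum /=.
  by apply: eq_big_nat => i /andP[i2 _]; rewrite /inv_coef ltnNge i2 /= RcM fmorphV rmorphXn /= exprVn.
apply: ceqP.
  apply/esym; apply: cvg_lim => //; apply/cvgrPdist_lt => e e0.
  have [N HN] := H _ e0; exists N => // n /= /HN; rewrite E => Hn.
  by apply: le_lt_trans Hn; rewrite distrC -[X in X - _]creR -creB cre_le.
rewrite cimR; apply/eqP; rewrite -normr_eq0 eq_le normr_ge0 andbT; apply/ler_addgt0Pr => e e0.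
have [N HN] := H _ e0; have := HN N (leqnn N); rewrite E add0r => Hn.
apply/ltW; apply: le_lt_trans Hn; apply: le_trans (cim_le _).
by rewrite cimB cimR sub0r normrN.
Qed.

End InverseSeries.

Lemma goursat_split (R : realType) (h : R[i] -> R[i]) (a b c d : R) : a <= b -> c <= d ->
  cdiff_rect h a b c d ->
  ci a b (fun x => h (x +i* c) - h (x +i* d)) =
  ci c d (fun y => 'i%C * h (a +i* y)) - ci c d (fun y => 'i%C * h (b +i* y)).
Proof.
move=> ab cd H; have /eqP := goursat ab cd H; rewrite /rect.
have rv x : a <= x <= b -> forall y, c <= y <= d -> rcont (fun t => h (x +i* t)) y.
  by move=> xab y ycd; apply: rcont_vertical; exact: H.
have ra := rv a ltac:(by rewrite lexx ab); have rb := rv b ltac:(by rewrite lexx ab).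
by rewrite (ciB rb ra) mulrBr -(ciZ 'i%C ra) -(ciZ 'i%C rb) addr_eq0 opprB => /eqP.
Qed.

(** * Moving the tail integral to a half circle *)

Section EntireOfTail.
Context {R : realType}.
Local Notation mR := (measurableTypeR R).
Local Notation leb := (@lebesgue_measure R).
Local Notation cc a b := (`[a, b]%classic : set mR).
Local Notation phase x t := (cos (x * t) +i* sin (x * t)).
Variables (mu : probability mR R) (T T' : R) (a : nat -> R).
Hypotheses (T0 : 0 < T) (TT' : T < T') (td : tail_density mu T a).
Implicit Types (x t L u : R).

Let T'0 : 0 < T'. Proof. exact: lt_trans TT'. Qed.
Let tailT : tail T T. Proof. by rewrite /tail /= ger0_norm// ltW. Qed.
Let cvgT := td.1 T tailT.
Let Q := inv_sum a.

Let Q_cdiff z : T < cabs z -> cdiff Q z.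
Proof. exact: (inv_sum_cdiff T0 cvgT). Qed.

(* In [z = circ T' u], [outer z * cexp (t * ('i * z)) du] is
   [Q z * exp (i t z) dz]. *)
Let outer z := Q z * ('i%C * z).

Let arc z := exp_integral leb (cc 0 pi) (fun u => outer (circ T' u)) (fun u => 'i%C * circ T' u) z.
(** The part of [mu] on [|x| < T'], which is left as it is; [arc] is the integral over the half
    circle of radius [T'] that replaces the tail. *)
Let core z := exp_integral mu (~` tail T' : set mR) (fun=> 1) (fun x => 'i%C * x%:C) z.

Let rcont_arc L u : T' <= L -> rcont (fun u => outer (circ L u)) u /\
  rcont (fun u => 'i%C * circ L u) u.
Proof.
move=> LT'; have TL := lt_le_trans TT' LT'.
have ci_ : rcont (fun u => 'i%C * circ L u) u.
  by apply: rcontM; [exact: rcont_cst|exact: rcont_circ].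
split=> //; apply: rcontM => //.
apply: (rcont_comp (f := Q)); first exact: rcont_circ.
by apply: cdiff_cont; apply: Q_cdiff; rewrite cabs_circ ger0_norm// (le_trans _ LT')// ltW.
Qed.

Let cabs_i : cabs ('i%C : R[i]) = 1. Proof. exact: cabsi. Qed.

Let mcore : measurable (~` tail T' : set mR).
Proof. by apply: measurableC; exact: measurable_tail. Qed.

Let core_bmeas : bmeas (~` tail T' : set mR) (fun x => 'i%C * x%:C).
Proof.
apply: (@rcont_bmeasT _ _ T') => // x.
  by apply: rcontM; [exact: rcont_cst|apply: rcontR; exact: cvg_id].
by rewrite /tail /= cabsM cabs_i mul1r cabsR => /negP; rewrite -ltNge => /ltW.
Qed.

Let core_le x : (~` tail T' : set mR) x -> cabs ('i%C * x%:C) <= T'.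
Proof. by rewrite /tail /= cabsM cabs_i mul1r cabsR => /negP; rewrite -ltNge => /ltW. Qed.

Let K := projT1 (cid2 (inv_sum_le T0 cvgT TT')).
Let K0 : 0 <= K. Proof. by rewrite /K; case: cid2. Qed.
Let Q_le z : T' <= cabs z -> cabs (Q z) * cabs z ^+ 2 <= K.
Proof. by rewrite /K; case: cid2 => ? ? H; exact: H. Qed.

Let outer_le L u : T' <= L -> cabs (outer (circ L u)) <= K / L.
Proof.
move=> TL; have L0 := lt_le_trans T'0 TL.
have cL : cabs (circ L u) = L by rewrite cabs_circ gtr0_norm.
rewrite ler_pdivlMr// /outer cabsM cabsM cabs_i mul1r cL -mulrA -expr2.
by have := @Q_le (circ L u); rewrite cL; apply.
Qed.

Let mpi : measurable (cc 0 pi). Proof. exact: measurable_itv. Qed.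

Let entire_ext z := core z + arc z.

Let entire_ext_cdiff z : cdiff entire_ext z.
Proof.
apply: cdiffD.
  apply: (exp_integral_cdiff (K := 1) (S := T')) => //.
  - exact: mu_fin.
  - exact: bmeas_cst.
  - exact: ltW.
  - by move=> x _; rewrite cabs1.
apply: (exp_integral_cdiff (K := K / T') (S := T')) => //.
- exact: leb_itv_fin.
- by apply: rcont_bmeas => u _; case: (rcont_arc u (lexx T')).
- by apply: rcont_bmeas => u _; case: (rcont_arc u (lexx T')).
- by rewrite divr_ge0// ltW.
- exact: ltW.
- by move=> u _; exact: outer_le.
- by move=> u _; rewrite cabsM cabs_i mul1r cabs_circ gtr0_norm.
Qed.

Let entire_ext_le : exists C, forall z, cabs (entire_ext z) <= C * expR (T' * cabs z).
Proof.
exists (2 * 1 * fine (mu (~` tail T' : set mR)) + 2 * (K / T') * fine (leb (cc 0 pi))) => z.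
rewrite (le_trans (cabsD _ _))// mulrDl lerD//.
  apply: exp_integral_le => //.
  - exact: mu_fin.
  - exact: bmeas_cst.
  - by move=> x _; rewrite cabs1.
apply: exp_integral_le => //.
- exact: leb_itv_fin.
- by apply: rcont_bmeas => u _; case: (rcont_arc u (lexx T')).
- by apply: rcont_bmeas => u _; case: (rcont_arc u (lexx T')).
- by move=> u _; exact: outer_le.
- by move=> u _; rewrite cabsM cabs_i mul1r cabs_circ gtr0_norm.
Qed.

Section Contour.
Variables (t L : R).
Hypotheses (t0 : 0 < t) (TL : T' <= L).

Let L0 : 0 < L. Proof. exact: lt_le_trans TL. Qed.

Let Phi z := Q z * cexp ('i%C * t%:C * z).
(** [Phi z dz] in the coordinate [z = cexp w]: the half annulus becomes a rectangle, whose lower and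
    upper sides are the right and the left part of the tail. *)
Let h w := Phi (cexp w) * cexp w.

Let Phi_cdiff z : T < cabs z -> cdiff Phi z.
Proof.
move=> Tz; apply: cdiffM; first exact: Q_cdiff.
apply: (@cdiff_comp _ (fun z => 'i%C * t%:C * z) cexp).
  by apply: cdiffM; [exact: cdiff_cst|exact: cdiff_id].
by eexists; exact: cderiv_cexp.
Qed.

Let h_cdiff : cdiff_rect h (ln T') (ln L) 0 pi.
Proof.
move=> x y /andP[x1 _] _; apply: cdiffM; last by eexists; exact: cderiv_cexp.
apply: (@cdiff_comp _ cexp Phi); first by eexists; exact: cderiv_cexp.
apply: Phi_cdiff; rewrite cabs_cexp /=; apply: lt_le_trans TT' _.
by rewrite -[leLHS]lnK ?posrE// ler_expR.
Qed.

Let big_arc := ci 0 pi (fun u => outer (circ L u) * cexp (t%:C * ('i%C * circ L u))).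

Let h_circ M u : 0 < M -> h (ln M +i* u) = Phi (circ M u) * circ M u.
Proof. by move=> M0; rewrite /h cexp_circ lnK. Qed.

Let outerE z : 'i%C * (Phi z * z) = outer z * cexp (t%:C * ('i%C * z)).
Proof.
rewrite /Phi /outer (_ : 'i%C * t%:C * z = t%:C * ('i%C * z)); last by ring.
by ring.
Qed.

Let lnTL : ln T' <= ln L. Proof. by rewrite ler_ln ?posrE. Qed.

Let contour : ci (ln T') (ln L) (fun x => h (x +i* 0) - h (x +i* pi)) = arc t%:C - big_arc.
Proof.
rewrite (goursat_split lnTL (pi_ge0 R) h_cdiff).
by congr (_ - _); apply: eq_ci => u _; rewrite h_circ// outerE.
Qed.

(** For [t > 0] the exponential is at most 1 in modulus on the upper half plane, so the decay of [Q]
    alone gives the bound. *)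
Let big_arc_le : cabs big_arc <= 2 * (K / L) * pi.
Proof.
rewrite -[X in _ * X]subr0; apply: ci_le; first exact: pi_ge0.
  move=> u _; have [c1 c2] := rcont_arc u TL.
  apply: rcontM => //; apply: (rcont_comp (f := cexp)); last exact: cderiv_cont (cderiv_cexp _).
  by apply: rcontM => //; exact: rcont_cst.
move=> u u0pi; rewrite cabsM -[leRHS]mulr1 ler_pM ?cabs_ge0 ?outer_le//.
rewrite cabs_cexp -expR0 ler_expR /circ !creimE /=.
rewrite !(mul0r, mul1r, sub0r, subr0, add0r, addr0) mulrN oppr_le0.
by rewrite !mulr_ge0 ?(ltW t0) ?(ltW L0) ?sin_ge0_pi.
Qed.

Let PhiR x : T < `|x| -> Phi x%:C = phase x t * (inv_series a x)%:C.
Proof.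
move=> Tx; rewrite /Phi /Q (inv_sumR T0 cvgT Tx) phaseE mulrC; congr (cexp _ * _).
by apply: ceqP; rewrite !creimE /=; ring.
Qed.

Let cint_tail b c : b <= c -> (forall x, b <= x <= c -> T < `|x|) ->
  cint mu (cc b c) (fun x => phase x t) = ci b c (fun x => Phi x%:C) /\
  forall x, b <= x <= c -> rcont (fun x => Phi x%:C) x.
Proof.
move=> bc Hbc.
have rPhi x : b <= x <= c -> rcont (fun x => Phi x%:C) x.
  move=> /Hbc Tx; apply: (rcont_comp (f := Phi)); first by apply: rcontR; exact: cvg_id.
  by apply: cdiff_cont; apply: Phi_cdiff; rewrite cabsR.
have rQ x : b <= x <= c -> rcont (fun x => Q x%:C) x.
  move=> /Hbc Tx; apply: (rcont_comp (f := Q)); first by apply: rcontR; exact: cvg_id.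
  by apply: cdiff_cont; apply: Q_cdiff; rewrite cabsR.
have mbc : measurable (cc b c) by exact: measurable_itv.
have QE x : b <= x <= c -> cre (Q x%:C) = inv_series a x.
  by move=> /Hbc Tx; rewrite /Q (inv_sumR T0 cvgT Tx).
split => //.
rewrite (@cint_density _ mu _ (fun x => cre (Q x%:C))) => //.
- apply: eq_ci => x xbc; rewrite PhiR ?QE//; exact: Hbc.
- by have [] := rcont_bmeas rQ.
- move=> A mA AD; have AT : A `&` tail T = A.
    apply/setIidl => x /AD /=; rewrite in_itv /= => /Hbc; exact: ltW.
  have := td.2 A mA; rewrite AT => ->; apply: eq_integral => x /set_mem /AD /=.
  by rewrite in_itv /= => /QE ->.
- by apply: rcont_bmeas => x _; exact: rcont_phase.
Qed.

Lemma tail_contour : cint mu (cc (- L) (- T') `|` cc T' L) (fun x => phase x t) = arc t%:C - big_arc.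
Proof.
have m1 : measurable (cc (- L) (- T')) by exact: measurable_itv.
have m2 : measurable (cc T' L) by exact: measurable_itv.
rewrite cint_setU //; last 3 first.
- by apply: mu_fin; exact: measurableU.
- apply/disj_setPS => x []; rewrite /= !in_itv /= => /andP[_ x1] /andP[x2 _].
  by have := le_trans x2 x1; rewrite leNgt; have := T'0; lra.
- by apply: bmeasS (bmeas_phase t).
have H1 x : - L <= x <= - T' -> T < `|x|.
  by move=> /andP[_ x1]; rewrite -normrN; apply: (lt_le_trans _ (ler_norm (- x))); have := TT'; lra.
have H2 x : T' <= x <= L -> T < `|x|.
  by move=> /andP[x1 _]; apply: (lt_le_trans _ (ler_norm x)); have := TT'; lra.
have LT : - L <= - T' by rewrite lerN2.
have [-> r1] := cint_tail LT H1.
have [-> r2] := cint_tail TL H2.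
rewrite (ci_opp TL r1).
have r1' x : T' <= x <= L -> rcont (fun x => Phi (- x)%:C) x.
  move=> /H2 Tx; apply: (rcont_comp (f := Phi)).
    by apply: rcontR; apply: cvgN; exact: cvg_id.
  by apply: cdiff_cont; apply: Phi_cdiff; rewrite cabsR normrN.
rewrite addrC -(ciD r2 r1') -contour.
have E : ci T' L = ci (expR (ln T')) (expR (ln L)) by rewrite !lnK ?posrE.
rewrite E ci_expR//; last first.
  by rewrite !lnK ?posrE// => x xTL; apply: rcontD; [exact: r2|exact: r1'].
apply: eq_ci => u _; rewrite mulrDl /h !cexp_circ circ_0; congr (_ + _).
have -> : circ (expR u) pi = (- expR u)%:C.
  by rewrite /circ cospi sinpi; apply: ceqP; rewrite !creimE /=; ring.
by rewrite rmorphN mulrN opprK.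
Qed.

Lemma fourier_contour : cabs (entire_ext t%:C - fourier mu t) <=
  2 * (K / L) * pi + 2 * fine (mu [set x | L < `|x|]).
Proof.
pose U := cc (- L) (- T') `|` cc T' L; pose V : set mR := [set x | L < `|x|].
pose D : set mR := ~` tail T'.
have mV : measurable V by exact: measurable_abs_gt.
have mU : measurable U by apply: measurableU; exact: measurable_itv.
have mDU : measurable (D `|` U) by exact: measurableU.
have bP B : measurable B -> bmeas B (fun x : mR => phase x t).
  by move=> _; apply: bmeasS (bmeas_phase t).
have UE x : U x <-> T' <= `|x| <= L.
  rewrite /U /= !in_itv /=; split.
    by case=> /andP[x1 x2]; [rewrite ler0_norm|rewrite ger0_norm]; rewrite ?(le_trans _ x1)//; have := T'0; lra.
  have [x0|x0] := leP 0 x; first by rewrite ger0_norm//; right.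
  by rewrite ltr0_norm// => /andP[x1 x2]; left; lra.
have ET : setT = (D `|` U) `|` V.
  apply/esym/seteqP; split => // x _.
  have [xL|Lx] := leP `|x| L; last by right.
  have [xT|Tx] := leP T' `|x|; first by left; right; apply/UE; rewrite xT.
  by left; left; rewrite /D /tail /= => /le_lt_trans/(_ Tx); rewrite ltxx.
have -> : fourier mu t = cint mu D (fun x => phase x t) + cint mu U (fun x => phase x t) + cint mu V (fun x => phase x t).
  rewrite -[LHS]/(cint mu setT (fun x => phase x t)) ET cint_setU//.
  - rewrite cint_setU//; [exact: mu_fin| |exact: bP].
    apply/disj_setPS => x [Dx /UE/andP[Tx _]]; exact: Dx.
  - by apply: mu_fin; exact: measurableU.
  - apply/disj_setPS => x [[Dx|/UE/andP[_ xL]] Lx]; last by have := lt_le_trans Lx xL; rewrite ltxx.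
    by apply: Dx; rewrite /tail /=; apply: le_trans TL (ltW Lx).
  - by apply: bP; exact: measurableU.
rewrite tail_contour.
have -> : cint mu D (fun x => phase x t) = core t%:C.
  apply: eq_cint => x _; rewrite mul1r phaseE; congr cexp.
  by apply: ceqP; rewrite !creimE /=; ring.
have -> : entire_ext t%:C - (core t%:C + (arc t%:C - big_arc) + cint mu V (fun x => phase x t)) =
   big_arc - cint mu V (fun x => phase x t) by rewrite /entire_ext; ring.
rewrite (le_trans (cabsB _ _))// lerD// ?big_arc_le//.
rewrite -[X in X * _]mulr1; apply: cint_le => //; [exact: mu_fin|exact: bP|].
by move=> x _; rewrite cabs_phase.
Qed.

End Contour.

(** The extension does not depend on [L]; as [L] grows, the large half circle and the mass beyond
    [L] disappear from the comparison with the Fourier transform. *)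
Lemma entire_of_tail_density : exists f, [/\ forall z, cdiff f z,
  forall t, 0 < t -> f t%:C = fourier mu t &
  exists C, forall z, cabs (f z) <= C * expR (T' * cabs z)].
Proof.
exists entire_ext; split => // t t0.
apply/eqP; rewrite -subr_eq0 -cabs_eq0 eq_le cabs_ge0 andbT; apply/ler_addgt0Pr => e e0.
have [L1 L10 HL1] := tight mu (e := e / 4) ltac:(by rewrite divr_gt0).
(* The last bound makes [2 (K / L) pi <= e / 2], and [L1] makes twice the mass beyond [L] at most
   [e / 2]. *)
pose L := Num.max (Num.max T' L1) (4 * (K * pi + 1) / e).
have LT' : T' <= L by rewrite /L !le_max lexx.
have LL1 : L1 <= L by rewrite /L !le_max lexx orbT.
have LK : 4 * (K * pi + 1) / e <= L by rewrite /L !le_max lexx orbT.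
have L0 : 0 < L := lt_le_trans T'0 LT'.
apply: le_trans (fourier_contour t0 LT') _.
have h1 : fine (mu [set x | L < `|x|]) <= fine (mu [set x | L1 < `|x|]).
  apply: fine_le; rewrite ?ge0_fin_numE ?mu_fin//; try exact: measurable_abs_gt.
  apply: le_measure; rewrite ?inE; try exact: measurable_abs_gt.
  by move=> x /=; exact: le_lt_trans.
have h2 : K / L * pi <= e / 4.
  rewrite mulrAC ler_pdivrMr//; move: LK; rewrite ler_pdivrMr//.
  have := mulr_ge0 K0 (pi_ge0 R); lra.
lra.
Qed.

End EntireOfTail.

(** * Exponential type and the radii *)

Section ExponentialType.
Context {R : realType}.
Variable f : R[i] -> R[i].
Implicit Types (T x rho C : R).

Definition exp_bounded T := exists C, forall z, cabs (f z) <= C * expR (T * cabs z).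

Lemma entire_cdiff : entire f <-> forall z, cdiff f z.
Proof.
split=> [ef z|cf z _].
  have /cdiff_on_disc/(_ z) : analytic_on (disc (cabs z + 1)) f by move=> w _; exact: ef.
  by apply; rewrite ltrDl.
have /cdiff_on_disc/(_ z) : forall w, cabs w < cabs z + 1 -> cdiff f w by [].
by apply; rewrite /disc /= ltrDl.
Qed.

Lemma exp_bounded_pos T : exp_bounded T ->
  exists2 C, 1 <= C & forall z, cabs (f z) <= C * expR (T * cabs z).
Proof.
move=> [C HC]; exists (Num.max 1 C); first by rewrite le_max lexx.
by move=> z; apply: le_trans (HC z) _; rewrite ler_wpM2r ?expR_ge0// le_max lexx orbT.
Qed.

Lemma exp_bounded_order T : 0 < T -> exp_bounded T -> (entire_order f <= 1)%E.
Proof.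
move=> T0 /exp_bounded_pos[C C1 HC]; apply: ereal_inf_lbound; exists 1 => //; split => //.
exists C, T; split => // [|z]; first exact: lt_le_trans C1.
by rewrite powRr1 ?cabs_ge0.
Qed.

Lemma exp_boundedE T : exp_bounded T <->
  (ereal_sup [set (cabs (f z) / expR (T * cabs z))%:E | z in setT] < +oo)%E.
Proof.
split=> [[C HC]|].
  apply: (@le_lt_trans _ _ C%:E); last exact: ltry.
  by apply: ge_ereal_sup => _ [z _ <-]; rewrite lee_fin ler_pdivrMr ?expR_gt0.
set s := ereal_sup _ => soo.
have s0 z : ((cabs (f z) / expR (T * cabs z))%:E <= s)%E by apply: ereal_sup_ubound; exists z.
case: s soo s0 => // [C _ s0|_ /(_ 0)//]; exists C => z.
by have := s0 z; rewrite lee_fin ler_pdivrMr ?expR_gt0.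
Qed.

Lemma powR_le_linear (rho C T : R) : 0 <= rho < 1 -> 0 < C -> 0 < T ->
  exists D, forall x, 0 <= x -> C * x `^ rho <= T * x + D.
Proof.
move=> /andP[rho0 rho1] C0 T0; have r0 : 0 < 1 - rho by lra.
(* Beyond this point the linear term [T x] exceeds [C x^rho]. *)
pose X := (C / T) `^ (1 - rho)^-1.
have CT0 : 0 < C / T by rewrite divr_gt0.
have X0 : 0 < X by rewrite powR_gt0.
exists (C * X `^ rho) => x x0.
have [xX|Xx] := leP x X.
  rewrite ler_wpDl ?mulr_ge0 ?(ltW T0)//.
  by rewrite ler_wpM2l ?(ltW C0)// ge0_ler_powR// nnegrE// ltW.
have x1 : 0 < x := lt_trans X0 Xx.
rewrite ler_wpDr ?mulr_ge0 ?powR_ge0 ?(ltW C0)//.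
have xE : x = x `^ rho * x `^ (1 - rho).
  rewrite -powRD; last by rewrite (gt_eqF x1) implybT.
  by rewrite addrC subrK powRr1.
have CX : C / T <= x `^ (1 - rho).
  have -> : C / T = X `^ (1 - rho) by rewrite /X -powRrM mulVf ?gt_eqF// powRr1 ?ltW.
  by rewrite ge0_ler_powR ?nnegrE ?ltW.
rewrite {2}xE mulrCA mulrC ler_wpM2l ?powR_ge0//.
by rewrite mulrC -ler_pdivrMr.
Qed.

(** A power of exponent below 1 is eventually under any linear function, so that every positive rate
    is admissible. *)
Lemma order_bound_lt1 rho T : 0 <= rho < 1 -> order_bound f rho -> 0 < T -> exp_bounded T.
Proof.
move=> rho1 [C1 [C2 [C10 C20 H]]] T0.
have [D HD] := powR_le_linear rho1 C20 T0.
exists (C1 * expR D) => z; apply: le_trans (H z) _.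
rewrite -mulrA ler_wpM2l ?(ltW C10)// -expRD ler_expR addrC.
by apply: HD; exact: cabs_ge0.
Qed.

Lemma max_modulus_le T C a : 0 <= T -> (forall z, cabs (f z) <= C * expR (T * cabs z)) ->
  0 <= C -> (max_modulus f a <= (C * expR (T * a))%:E)%E.
Proof.
move=> T0 HC C0; apply: ge_ereal_sup => _ [z za <-]; rewrite lee_fin.
by apply: le_trans (HC z) _; rewrite ler_wpM2l// ler_expR ler_wpM2l.
Qed.

Lemma cabs_le_max_modulus z a : cabs z <= a -> ((cabs (f z))%:E <= max_modulus f a)%E.
Proof. by move=> za; apply: ereal_sup_ubound; exists z. Qed.

Lemma entire_type_le T : 0 < T -> exp_bounded T -> (entire_type 1 f <= T%:E)%E.
Proof.
move=> T0 /exp_bounded_pos[C C1 HC]; have C0 : 0 < C by lra.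
apply/lee_addgt0Pr => e e0.
pose V := [set a : R | Num.max 1 (ln C / e) < a].
apply: (@le_trans _ _ (ereal_sup
    [set ((a `^ (-1))%:E * lne (max_modulus f a))%E | a in V])).
  by apply: ereal_inf_lbound; exists V => //; exists (Num.max 1 (ln C / e)); split => //; exact: num_real.
apply: ge_ereal_sup => _ [a + <-]; rewrite /V /= gt_max => /andP[a1 Ca].
have a0 : 0 < a by lra.
have a'0 : 0 < a `^ (-1) by rewrite powR_gt0.
have M1 : (max_modulus f a <= (C * expR (T * a))%:E)%E.
  by apply: max_modulus_le => //; exact: ltW.
have M0 : (0 <= max_modulus f a)%E.
  apply: le_trans (cabs_le_max_modulus (z := 0) _); first by rewrite lee_fin cabs_ge0.
  by rewrite cabs0 ltW.
apply: (@le_trans _ _ ((a `^ (-1))%:E * lne (C * expR (T * a))%:E)%E).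
  rewrite lee_pmul2l ?lte_fin// lee_lne// in_itv /= leey ?andbT//.
  by rewrite lee_fin mulr_ge0 ?expR_ge0// ltW.
rewrite lne_EFin ?mulr_gt0 ?expR_gt0// lnM ?posrE ?expR_gt0// expRK -EFinM lee_fin.
rewrite powR_inv1 ?(ltW a0)// mulrC ler_pdivrMr// mulrDl addrC lerD2l.
by move: Ca; rewrite ltr_pdivrMr// mulrC => /ltW.
Qed.

Lemma entire_type_lt T : 0 < T -> (entire_type 1 f < T%:E)%E -> exp_bounded T.
Proof.
move=> T0 /ereal_inf_lt[_ [V [M [_ VM]] <-] supT].
pose N := Num.max 0 M + 1.
have N0 : 0 < N by rewrite /N ltr_wpDl// le_max lexx.
have NM : M < N by rewrite /N ltr_pwDr// le_max lexx orbT.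
have MT a : N <= a -> (max_modulus f a <= (expR (T * a))%:E)%E.
  move=> Na; have a0 : 0 < a := lt_le_trans N0 Na.
  have Va : V a by apply: VM; exact: lt_le_trans NM Na.
  have : ((a `^ (-1))%:E * lne (max_modulus f a) <= T%:E)%E.
    by apply: le_trans (ltW supT); apply: ereal_sup_ubound; exists a.
  rewrite powR_inv1 ?(ltW a0)//; case: (max_modulus f a) => [s| |]; last by rewrite leNye.
    (* For [s <= 0] the bound is immediate; otherwise the inequality between logarithms is
       exponentiated. *)
    have [s0|s0] := leP s 0; first by rewrite lee_fin (le_trans s0) ?expR_ge0.
    rewrite lne_EFin// -EFinM !lee_fin mulrC ler_pdivrMr// => h.
    by rewrite -(lnK s0) ler_expR.
  by rewrite /= gt0_muley ?lte_fin ?invr_gt0.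
exists (expR (T * N)) => z; have [zN|Nz] := leP (cabs z) N.
  have := le_trans (cabs_le_max_modulus zN) (MT N (lexx N)).
  rewrite lee_fin => /le_trans; apply.
  by rewrite ler_peMr ?expR_ge0// -expR0 ler_expR mulr_ge0 ?cabs_ge0// ltW.
have := le_trans (cabs_le_max_modulus (lexx (cabs z))) (MT _ (ltW Nz)).
rewrite lee_fin => /le_trans; apply.
by rewrite ler_peMl ?expR_ge0// -expR0 ler_expR mulr_ge0// ltW.
Qed.

(** The logarithm of the maximum modulus is bounded below by that of one nonzero value, and divided
    by [a] this tends to 0. *)
Lemma entire_type_ge0 z : f z != 0 -> (0 <= entire_type 1 f)%E.
Proof.
move=> fz; have m0 : 0 < cabs (f z) by rewrite cabs_gt0.
apply: le_ereal_inf_tmp => _ [V [M [_ VM]] <-].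
apply/lee_subgt0Pr => e e0; rewrite sub0e.
pose a := Num.max (Num.max 1 (cabs z)) (Num.max (M + 1) (`|ln (cabs (f z))| / e)).
have a1 : 1 <= a by rewrite /a !le_max lexx.
have za : cabs z <= a by rewrite /a !le_max lexx orbT.
have Ma : M + 1 <= a by rewrite /a !le_max lexx !orbT.
have la : `|ln (cabs (f z))| / e <= a by rewrite /a !le_max lexx !orbT.
have a0 : 0 < a by lra.
apply: (@le_trans _ _ ((a `^ (-1))%:E * lne (max_modulus f a))%E); last first.
  by apply: ereal_sup_ubound; exists a => //; apply: VM; lra.
apply: (@le_trans _ _ ((a `^ (-1))%:E * lne (cabs (f z))%:E)%E); last first.
  rewrite lee_pmul2l ?lte_fin ?powR_gt0// lee_lne ?cabs_le_max_modulus//.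
    by rewrite in_itv /= lee_fin cabs_ge0 leey.
  rewrite in_itv /= leey andbT; apply: le_trans (cabs_le_max_modulus za).
  by rewrite lee_fin cabs_ge0.
rewrite lne_EFin// powR_inv1 ?(ltW a0)// -EFinM lee_fin mulrC ler_pdivlMr//.
move: la; rewrite ler_pdivrMr// => la.
by have := ler_norm (- ln (cabs (f z))); rewrite normrN; lra.
Qed.

End ExponentialType.

(** * Infima and suprema of sets related up to an arbitrarily small loss *)

Section RadiusSets.
Context {R : realType}.
Implicit Types (A B : set R) (T r : R).

Lemma ereal_inf_cofinal A B :
  (forall T T', A T -> T < T' -> B T') -> (forall T T', B T -> T < T' -> A T') ->
  ereal_inf [set T%:E | T in A] = ereal_inf [set T%:E | T in B].
Proof.
have H (C D : set R) : (forall T T', C T -> T < T' -> D T') ->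
    (ereal_inf [set T%:E | T in D] <= ereal_inf [set T%:E | T in C])%E.
  move=> CD; apply: le_ereal_inf_tmp => _ [T CT <-].
  apply/lee_addgt0Pr => e e0; apply: ereal_inf_lbound; exists (T + e) => //.
  by apply: CD CT _; rewrite ltrDl.
by move=> AB BA; apply/eqP; rewrite eq_le !H.
Qed.

(** Inversion reverses the order of the nonnegative extended reals; with [0^-1 = +oo] this includes
    an infinite radius. *)
Lemma ereal_sup_inv A B : (forall T, A T -> 0 < T) -> (forall r, B r -> 0 < r) -> A !=set0 ->
  (forall T T', A T -> T < T' -> B T'^-1) -> (forall r T, B r -> r^-1 < T -> A T) ->
  ereal_sup [set r%:E | r in B] = ((ereal_inf [set T%:E | T in A])^-1)%E.
Proof.
move=> A0 B0 [T1 AT1] AB BA; set I := ereal_inf _; set S := ereal_sup _.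
have I0 : (0 <= I)%E by apply: le_ereal_inf_tmp => _ [T /A0 T0 <-]; rewrite lee_fin ltW.
have lbI T : A T -> (I <= T%:E)%E by move=> AT; apply: ereal_inf_lbound; exists T.
have ubS r : B r -> (r%:E <= S)%E by move=> Br; apply: ereal_sup_ubound; exists r.
have S0 : (0 <= S)%E.
  apply: le_trans (ubS (T1 + 1)^-1 _).
    by rewrite lee_fin invr_ge0 addr_ge0// ltW// A0.
  by apply: AB AT1 _; rewrite ltrDl.
have BI r : B r -> (I <= r^-1%:E)%E.
  move=> Br; apply/lee_addgt0Pr => e e0; apply: lbI; apply: BA Br _.
  by rewrite ltrDl.
have IT T : (I < T%:E)%E -> (T^-1%:E <= S)%E.
  by move=> /ereal_inf_lt[_ [T2 AT2 <-]]; rewrite lte_fin => T2T; apply: ubS; exact: AB AT2 T2T.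
apply/eqP; rewrite eq_le; apply/andP; split.
  apply: ge_ereal_sup => _ [r Br <-]; have r0 := B0 _ Br.
  rewrite inve_pge ?inE ?lee_fin ?(ltW r0)//.
  by rewrite inver gt_eqF//; exact: BI.
rewrite inve_ple ?inE//.
case: S ubS S0 IT => [s| |] ubS S0 IT; last by [].
- have s0 : 0 < s.
    have := ubS _ (AB _ _ AT1 (ltac:(by rewrite ltrDl) : T1 < T1 + 1)).
    by rewrite lee_fin; apply: lt_le_trans; rewrite invr_gt0 addr_gt0// A0.
  rewrite inver gt_eqF// leNgt; apply/negP.
  case: I I0 lbI BI IT => [i| |] I0 lbI BI IT //.
  rewrite lte_fin => h; have i0 : 0 <= i by rewrite -lee_fin.
  (* If [i < s^-1], the inverse of their midpoint exceeds [s], although [IT] bounds it by [s]. *)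
  have T0 : 0 < (i + s^-1) / 2 by rewrite divr_gt0 ?ltr_wpDl ?invr_gt0.
  have := IT ((i + s^-1) / 2); rewrite lte_fin lee_fin => /(_ ltac:(lra)).
  by rewrite -[X in _ <= X]invrK lef_pV2 ?posrE ?invr_gt0//; lra.
- by rewrite invey.
Qed.

End RadiusSets.

(** * The equivalences, the radii and the exponential type *)

Section Assembly.
Context {R : realType}.
Variable mu : probability (measurableTypeR R) R.
Local Notation mR := (measurableTypeR R).
Implicit Types (T r t : R).

Let tailP T := 0 < T /\ exists a, tail_density mu T a.
Let contG r := 0 < r /\ has_continuation upper_half (G_at_inv mu) r.

Lemma tail_density_of_class_P1 : class_P1 mu -> exists T, tailP T.
Proof.
move=> [nu [r [T [a [[K cK nuK] /andP[r0 rT] cvg_a _ muE]]]]].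
have [M [_ HM]] := compact_bounded cK.
(* [K] lies in [|x| <= |M| + 1], so that [nu] does not charge [tail T1]. *)
pose T1 := Num.max T (`|M| + 1 + 1).
have T1T : T <= T1 by rewrite /T1 le_max lexx.
have T1M : `|M| + 1 + 1 <= T1 by rewrite /T1 le_max lexx orbT.
exists T1; split; first by rewrite (lt_le_trans _ T1T)// (lt_trans r0).
exists a; split=> [x Tx|A mA].
  have xr : r < `|x| by apply: lt_le_trans rT (le_trans T1T Tx).
  pose u n := if (n < 2)%N then 0 else a n / x ^+ n.
  have E (v : R -> R) : v 0 = 0 ->
      (fun N => \sum_(2 <= n < N) v (a n / x ^+ n)) = series (fun n => v (u n)).
    move=> v0; apply/funext => N; rewrite /series /= big_mkord.
    apply: etrans (@sum_from2 _ (fun n => v (u n)) N _ _) => //.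
    by apply: eq_big_nat => n /andP[n2 _]; rewrite /u ltnNge n2.
  rewrite (E id)//; apply: normed_cvg.
  by have := cvg_a x xr; rewrite (E Num.norm) ?normr0.
have mK : measurable (~` K : set mR) by apply: measurableC; exact: compact_measurable.
have mAT : measurable (A `&` tail T1) by apply: measurableI => //; exact: measurable_tail.
rewrite muE// -setIA (_ : tail T1 `&` tail T = tail T1); last first.
  by apply/setIidl => x; rewrite /tail /=; exact: le_trans.
rewrite (_ : nu (A `&` tail T1) = 0%E) ?add0e//.
apply/eqP; rewrite eq_le measure_ge0 andbT -nuK le_measure ?inE//.
move=> x [_ Tx] Kx; have : `|x| <= `|M| + 1.
  by apply: HM Kx; rewrite (le_lt_trans (ler_norm M))// ltrDl.
by move: Tx; rewrite /tail /=; lra.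
Qed.

Lemma contG_of_tail T T' : tailP T -> T < T' -> contG T'^-1.
Proof.
move=> [T0 [a td]] TT'; have T'0 : 0 < T' := lt_trans T0 TT'.
have [f [df fmu [C HC]]] := entire_of_tail_density T0 TT' td.
split; first by rewrite invr_gt0.
exact: continuation_G_of_entire T'0 df HC fmu.
Qed.

Lemma tail_of_contG r T : contG r -> r^-1 < T -> tailP T.
Proof.
move=> [r0 [g cg]] rT; split; first by rewrite (lt_trans _ rT)// invr_gt0.
by exists (density_coef r g); exact: tail_density_of_continuation cg T rT.
Qed.

Lemma class_P1_iff_contG : class_P1 mu <-> exists r, contG r.
Proof.
split=> [/tail_density_of_class_P1[T tT]|[r [r0 [g cg]]]]; last exact: class_P1_of_continuation r0 cg.
by exists (T + 1)^-1; apply: contG_of_tail tT _; rewrite ltrDl.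
Qed.

Lemma contG_of_exp_bounded f T : fourier_extension mu f -> 0 < T -> exp_bounded f T ->
  contG T^-1.
Proof.
move=> [/entire_cdiff df fmu _ _] T0 [C HC]; split; first by rewrite invr_gt0.
exact: continuation_G_of_entire T0 df HC fmu.
Qed.

(** By this, any given extension inherits the growth bounds of the one built from the tail
    density. *)
Lemma fourier_extension_unique f h : (forall z, cdiff f z) -> (forall z, cdiff h z) ->
  (forall t, 0 < t -> f t%:C = fourier mu t) -> (forall t, 0 < t -> h t%:C = fourier mu t) ->
  f =1 h.
Proof.
move=> df dh fmu hmu z; apply/eqP; rewrite -subr_eq0; apply/eqP.
apply: (@isolated_zero _ (fun z => f z - h z) 0 1 (cabs z + 1) 1) => //.
- by rewrite ltr_wpDl ?cabs_ge0.
- by move=> w _; apply: cdiffD => //; exact: cdiffN.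
- by move=> t /andP[t0 _]; rewrite add0r mulr1 fmu// hmu// subrr.
- by rewrite subr0 ltrDl.
Qed.

(** For small [t] the integrand is close to 1 except on a small mass. This excludes the zero
    function when the type is bounded below. *)
Lemma fourier_neq0 : exists2 t, 0 < t & fourier mu t != 0.
Proof.
have [L L0 HL] := tight mu (e := 8^-1) ltac:(by rewrite invr_gt0).
(* For [|x| <= L] the integrand is within 1/4 of 1; elsewhere within 2, on a mass below 1/8. The
   total deviation is less than [4/8 + 2/4 = 1]. *)
pose t := (8 * L)^-1; have t0 : 0 < t by rewrite invr_gt0 mulr_gt0.
exists t => //; apply/eqP => F0.
pose T := setT : set mR; have mT : measurable T by exact: measurableT.
have finT := mu_fin mu mT.
have b1 : bmeas T (fun=> 1 : R[i]) := bmeas_cst _ _.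
have bF : bmeas T (fun x : mR => cos (x * t) +i* sin (x * t) - 1) :=
  bmeasD (bmeas_phase t) (bmeasN b1).
have F1 : cabs (cint mu T (fun x : mR => cos (x * t) +i* sin (x * t) - 1)) = 1.
  rewrite (cintB mT finT (bmeas_phase t) b1) cint_cst// mu_setT1 mulr1.
  by rewrite (F0 : cint mu T _ = 0) sub0r cabsN cabs1.
have mL := measurable_abs_gt L.
have : 1 <= 2 * 2 * fine (mu (T `&` [set x | L < `|x|]))
    + 2 * 4^-1 * fine (mu (T `\` [set x | L < `|x|])).
  rewrite -[leLHS]F1; apply: (cint_le_split mT mL finT bF) => x _ xL.
    by rewrite (le_trans (cabsB _ _))// cabs_phase cabs1.
  apply: le_trans (phaseB1_le _ _) _; rewrite (gtr0_norm t0) mulrA ler_pdivrMr ?mulr_gt0//.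
  by move/negP: xL; rewrite -leNgt; lra.
rewrite setTI; have /andP[_] := mu_le1 mu (measurableD mT mL).
by move: HL; lra.
Qed.

Lemma fourier_extension_of_class_P1 : class_P1 mu -> exists f, fourier_extension mu f.
Proof.
move=> /tail_density_of_class_P1[T [T0 [a td]]].
have T1 : 0 < T + 1 by lra.
have [f [df fmu HC]] := entire_of_tail_density T0 (ltac:(by rewrite ltrDl) : T < T + 1) td.
exists f; split => //; first exact/entire_cdiff.
  exact: exp_bounded_order T1 HC.
by apply: le_lt_trans (entire_type_le T1 HC) _; rewrite ltry.
Qed.

Lemma contG_of_fourier_extension f : fourier_extension mu f -> exists r, contG r.
Proof.
move=> ext; have [_ _ _ foo] := ext.
have [T T0 fT] : exists2 T, 0 < T & (entire_type 1 f < T%:E)%E.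
  case: (entire_type 1 f) foo => [s _| |_] //.
    exists (`|s| + 1); first by rewrite ltr_wpDl.
    by rewrite lte_fin (le_lt_trans (ler_norm s))// ltrDl.
  by exists 1 => //; rewrite ltNyr.
by exists T^-1; apply: contG_of_exp_bounded ext T0 (entire_type_lt T0 fT).
Qed.

Lemma exp_bounded_of_tail f T T' : fourier_extension mu f -> tailP T -> T < T' ->
  0 < T' /\ exp_bounded f T'.
Proof.
move=> [/entire_cdiff df fmu _ _] [T0 [a td]] TT'; split; first exact: lt_trans TT'.
have [h [dh hmu [C HC]]] := entire_of_tail_density T0 TT' td.
by exists C => z; rewrite (fourier_extension_unique df dh fmu hmu).
Qed.

Lemma exp_bound_infE (f : R[i] -> R[i]) : exp_bound_inf f =
  ereal_inf [set T%:E | T in [set T | 0 < T /\ exp_bounded f T]].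
Proof.
congr ereal_inf; apply/seteqP; split => _ [T [T0 /exp_boundedE fT] <-]; by exists T.
Qed.

Lemma exp_bound_inf_R_mu f : fourier_extension mu f -> exp_bound_inf f = R_mu mu.
Proof.
move=> ext; rewrite exp_bound_infE; apply: ereal_inf_cofinal => T T' [T0 fT] TT'.
  apply: tail_of_contG (contG_of_exp_bounded ext T0 fT) _.
  by rewrite invrK.
exact: exp_bounded_of_tail ext (conj T0 fT) TT'.
Qed.

(** A rate [T] with [exp_bounded f T] is at least the type, and a positive rate above the type is
    such a [T]. For the rates above the type to be positive, the type must be nonnegative. *)
Lemma entire_type_R_mu f : fourier_extension mu f -> entire_type 1 f = R_mu mu.
Proof.
move=> ext; rewrite -(exp_bound_inf_R_mu ext) exp_bound_infE; have [_ fmu _ foo] := ext.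
apply/eqP; rewrite eq_le; apply/andP; split.
  by apply: le_ereal_inf_tmp => _ [T [T0 fT] <-]; exact: entire_type_le.
have [t t0 ft] := fourier_neq0; rewrite -fmu// in ft.
have := entire_type_ge0 ft; case E : (entire_type 1 f) foo => [s| |] //= _ s0.
apply/lee_addgt0Pr => e e0; rewrite lee_fin in s0; apply: ereal_inf_lbound.
exists (s + e) => //; have se : 0 < s + e by rewrite ltr_wpDl.
by split => //; apply: entire_type_lt => //; rewrite E lte_fin ltrDl.
Qed.

(** An order bound with exponent below 1 would make every positive rate admissible, so that
    [exp_bound_inf f] would be 0. *)
Lemma entire_order_R_mu f : fourier_extension mu f -> (0 < R_mu mu)%E -> entire_order f = 1%E.
Proof.
move=> ext; rewrite -(exp_bound_inf_R_mu ext) exp_bound_infE => I0; have [_ _ o1 _] := ext.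
apply/eqP; rewrite eq_le o1 /=; apply: le_ereal_inf_tmp => _ [rho [rho0 ob] <-].
rewrite lee_fin leNgt; apply/negP => rho1; move: I0; rewrite ltNge => /negP; apply.
apply/lee_addgt0Pr => e e0; rewrite add0e; apply: ereal_inf_lbound; exists e => //.
by split => //; apply: order_bound_lt1 ob e0; rewrite rho0.
Qed.

Lemma r_mu2E : class_P1 mu -> r_mu2 mu = ((R_mu mu)^-1)%E.
Proof.
move=> /tail_density_of_class_P1 tP; apply: ereal_sup_inv tP _ _ => [T [] //|r [] //||].
  exact: contG_of_tail.
exact: tail_of_contG.
Qed.

(** Without zeros to turn into poles, the admissible radii for [G_mu] and [F_mu] are the same. *)
Lemma r_mu3E : class_P1 mu -> zero_free mu -> r_mu3 mu = ((R_mu mu)^-1)%E.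
Proof.
move=> P1 [zG zF]; rewrite -r_mu2E//; congr ereal_sup; congr image.
apply/seteqP; split => r [r0 [g cg]]; split => //.
  by apply: (continuation_G_of_F r0 cg) => z zr; exact: (zF r g cg).
by apply: (continuation_F_of_G r0 cg) => z zr z0; exact: (zG r g cg).
Qed.

End Assembly.

Theorem theorem4p1 (R : realType) (mu : probability (measurableTypeR R) R) :
  [/\ [<-> class_P1 mu;
           exists r : R, 0 < r /\ has_continuation upper_half (G_at_inv mu) r;
           exists r : R, 0 < r /\
             has_continuation upper_half (F_at_inv_sub mu) r;
           exists f, fourier_extension mu f],
      forall beta Finv, right_inverse mu beta Finv ->
        (class_P1 mu <-> exists r : R, 0 < r /\
           has_continuation (cone_union_inv beta) (Finv_at_inv_sub Finv) r) &
      class_P1 mu ->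
        [/\ r_mu2 mu = ((R_mu mu)^-1)%E,
            zero_free mu -> r_mu3 mu = ((R_mu mu)^-1)%E &
            forall f, fourier_extension mu f ->
              [/\ exp_bound_inf f = R_mu mu,
                  entire_type 1 f = R_mu mu &
                  (0 < R_mu mu)%E -> entire_order f = 1%E]]].
Proof.
split.
- tfae.
  + by move=> /class_P1_iff_contG.
  + by move=> /G_iff_F.
  + by move=> /G_iff_F /class_P1_iff_contG; exact: fourier_extension_of_class_P1.
  + by move=> [f /contG_of_fourier_extension]; move/class_P1_iff_contG.
- move=> beta Finv inv; split => [/class_P1_iff_contG[r [r0 [g cg]]]|[r [r0 cF]]].
    exact: (Finv_of_G inv r0 cg).
  by apply/class_P1_iff_contG; exact: (G_of_Finv inv r0 cF).
- move=> P1; split => [|zf|f ext]; [exact: r_mu2E|exact: r_mu3E|split].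
  + exact: exp_bound_inf_R_mu.
  + exact: entire_type_R_mu.
  + exact: entire_order_R_mu.
Qed.
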